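(* Let $m=d$, $g\equiv I_m$, and let $f:\mathbb{R}^m\to\mathbb{R}^m$ be differentiable. Suppose there are constants $\lambda>0$ and $\gamma,\mu,q>0$ such that for all $x,y\in\mathbb{R}^m$ $$\langle x-y,f(x)-f(y)\rangle\le-\lambda\|x-y\|^2,$$ $$\|f(x)-f(y)\|+\|\nabla f(x)-\nabla f(y)\|\le\big(\gamma(\|x\|^q+\|y\|^q)+\mu\big)\|x-y\|.$$ Let $0<h_{\max}<\infty$ and let $h:\mathbb{R}^m\to(0,h_{\max}]$ be continuous and such that, for some $\alpha,\beta>0$ and all $x\in\mathbb{R}^m$, $$\langle x,f(x)\rangle+\tfrac12h(x)\|f(x)\|^2\le-\alpha\|x\|^2+\beta .$$ For each $\delta\in(0,1]$ let $h^\delta:\mathbb{R}^m\to(0,\infty)$ be a measurable function with $$\delta\min(h_{\max},h(x))\le h^\delta(x)\le\min(\delta h_{\max},h(x))\qquad\text{for all }x\in\mathbb{R}^m .$$ Let $X$ be the solution of $dX_t=f(X_t)\,dt+dW_t$ with $X_0=x_0$, and let $\widehat X$ be the continuous interpolant of the adaptive Euler-Maruyama discretisation with timestep function $h^\delta$, the same Brownian motion $W$ and the same initial value $x_0$. Then for every $p\in(0,\infty)$ there exists a constant $C_p$ (independent of $\delta$ and $t$) such that for all $\delta\in(0,1]$ and all $t\ge0$ $$\mathbb{E}\big[\|\widehat X_t-X_t\|^p\big]\le C_p\,\delta^{p}.$$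
   Context: $\|\cdot\|$ is the Euclidean norm for vectors and the Frobenius norm for matrices; $W$ is a standard $m$-dimensional Brownian motion on a filtered probability space; $I_m$ is the $m\times m$ identity matrix. Adaptive Euler-Maruyama discretisation with timestep function $h^\delta$: $t_0=0$, $\widehat X_0=x_0$ (fixed), $h_n=h^\delta(\widehat X_{t_n})$, $t_{n+1}=t_n+h_n$, $\Delta W_n=W_{t_{n+1}}-W_{t_n}$, and $\widehat X_{t_{n+1}}=\widehat X_{t_n}+f(\widehat X_{t_n})h_n+\Delta W_n$. For $t\ge0$ put $\underline t=\max\{t_n:\ t_n\le t\}$. The continuous interpolant is $\widehat X_t=\widehat X_{\underline t}+f(\widehat X_{\underline t})(t-\underline t)+(W_t-W_{\underline t})$. It is defined for all $t\ge 0$ on the event $t_n\to\infty$, which has probability one under the stated hypotheses. *)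

(* Defs.v *)
From HB Require Import structures.
From mathcomp Require Import all_boot all_order all_algebra.
From mathcomp Require Import all_classical all_reals all_analysis.

Set Implicit Arguments.
Unset Strict Implicit.
Unset Printing Implicit Defensive.

Import Order.TTheory GRing.Theory Num.Theory.
Import numFieldNormedType.Exports.

Local Open Scope classical_set_scope.
Local Open Scope ring_scope.

(* R^m is 'rV[R]_m over R : realType.  The library norm
   `|_| on matrices is the sup norm, so the Euclidean/Frobenius norm is defined
   here; the two induce the same topology, hence the library's continuity and
   differentiability on 'rV[R]_m are the usual notions. *)

Definition dotv (R : realType) (m : nat) (u v : 'rV[R]_m) : R :=
  \sum_i u ord0 i * v ord0 i.

(* Frobenius norm; on row vectors ('M_(1, m)) it is the Euclidean norm. *)
Definition normF (R : realType) (m n : nat) (A : 'M[R]_(m, n)) : R :=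
  Num.sqrt (\sum_i \sum_j A i j ^+ 2).

Definition borelV (R : realType) (m : nat) : measurableType _ :=
  g_sigma_algebraType (@open 'rV[R]_m).

Section processes.
Context {R : realType} {d : measure_display} {Omega : measurableType d}.

(* Time is R restricted to t >= 0; values at negative times are irrelevant. *)
Record is_filtration (Ft : R -> set (set Omega)) : Prop := {
  filtration_sigma : forall t, 0 <= t -> sigma_algebra setT (Ft t) ;
  filtration_measurable : forall t, 0 <= t -> Ft t `<=` measurable ;
  filtration_nondecreasing : forall s t : R, 0 <= s -> s <= t -> Ft s `<=` Ft t }.

Definition adapted (m : nat) (Ft : R -> set (set Omega))
    (Y : R -> Omega -> 'rV[R]_m) : Prop :=
  forall t, 0 <= t -> forall B : set (borelV R m), measurable B ->
    Ft t (Y t @^-1` B).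

Definition continuous_paths (m : nat) (Y : R -> Omega -> 'rV[R]_m) : Prop :=
  forall w, {within `[0, +oo[, continuous (Y ^~ w)}.

Variable P : probability Omega R.

(* The last two fields: for s < t the increment W_t - W_s is independent of
   F_s and has the product law N(0, t - s)^{(x) m} = N(0, (t - s) I_m);
   the second parameter of normal_prob is the standard deviation. *)
Record brownian_motion (m : nat) (Ft : R -> set (set Omega))
    (W : R -> Omega -> 'rV[R]_m) : Prop := {
  brownian_adapted : adapted Ft W ;
  brownian_continuous : continuous_paths W ;
  brownian0 : {ae P, forall w, W 0 w = 0} ;
  brownian_independent : forall s t : R, 0 <= s -> s < t ->
    forall (A : set Omega) (B : set (borelV R m)), Ft s A -> measurable B ->
    P (A `&` (fun w => W t w - W s w) @^-1` B) =
    (P A * P ((fun w => (W t w - W s w)%R) @^-1` B))%E ;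
  brownian_normal : forall s t : R, 0 <= s -> s < t ->
    forall B : 'I_m -> set R, (forall i, measurable (B i)) ->
    P [set w | forall i, B i ((W t w - W s w) ord0 i)] =
    \big[*%E/1%E]_(i < m) normal_prob 0 (Num.sqrt (t - s)) (B i) }.

Definition integralV (m : nat) (t : R) (g : R -> 'rV[R]_m) : 'rV[R]_m :=
  \row_i Rintegral lebesgue_measure `[0, t] (fun s => g s ord0 i).

(* Solution of dX = f(X) dt + dW, X_0 = x0, in integral form; since the noise is
   additive the stochastic integral of I_m is W_t - W_0. *)
Record sde_solution (m : nat) (Ft : R -> set (set Omega))
    (W : R -> Omega -> 'rV[R]_m) (f : 'rV[R]_m -> 'rV[R]_m) (x0 : 'rV[R]_m)
    (X : R -> Omega -> 'rV[R]_m) : Prop := {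
  sde_adapted : adapted Ft X ;
  sde_continuous : continuous_paths X ;
  sde_integral : {ae P, forall w, forall t, 0 <= t ->
    X t w = x0 + integralV t (fun s => f (X s w)) + (W t w - W 0 w)} }.

End processes.

(* The scheme is defined path by path, b : R -> 'rV[R]_m being a path of the
   driving Brownian motion. *)
Section euler_maruyama.
Context {R : realType} {m : nat}.
Variables (f : 'rV[R]_m -> 'rV[R]_m) (hd : 'rV[R]_m -> R) (x0 : 'rV[R]_m).
Variable b : R -> 'rV[R]_m.

(* em n = (t_n, value of the scheme at t_n) *)
Fixpoint em (n : nat) : R * 'rV[R]_m :=
  if n is n'.+1 then
    let: (t, x) := em n' in
    (t + hd x, x + hd x *: f x + (b (t + hd x) - b t))
  else (0, x0).

Definition em_time (n : nat) : R := (em n).1.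
Definition em_value (n : nat) : 'rV[R]_m := (em n).2.

(* An index n with t_n = max {t_k : t_k <= t}, unique when hd > 0.  If the
   maximum does not exist, which for t >= 0 requires the t_k to stay bounded,
   the index is 0 by convention. *)
Definition em_index (t : R) : nat :=
  xget 0%N [set n | em_time n <= t /\
                    forall k, em_time k <= t -> em_time k <= em_time n].

Definition em_interpolant (t : R) : 'rV[R]_m :=
  let n := em_index t in
  em_value n + (t - em_time n) *: f (em_value n) + (b t - b (em_time n)).

End euler_maruyama.

(* Main.v *)
Require Import Defs.
From HB Require Import structures.
From mathcomp Require Import all_boot all_order all_algebra.
From mathcomp Require Import all_classical all_reals all_analysis.
From mathcomp Require Import measurable_realfun.
From mathcomp Require Import ring lra.

Import Order.TTheory GRing.Theory Num.Theory.
Import numFieldNormedType.Exports.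

Local Open Scope classical_set_scope.
Local Open Scope ring_scope.

Set Implicit Arguments.
Unset Strict Implicit.
Unset Printing Implicit Defensive.

(* Contractivity of the drift makes [expR (c t) * |e|^(2k+2)] a Lyapunov function
   of the error [e = Xhat - X], which is absolutely continuous because the noise
   cancels: its derivative is [f(Xhat_u) - f(X)], with [u] the last grid time.
   The defect [f(Xhat_u) - f(Xhat)] is [O(delta^(1/2))] in every moment, which
   gives order one half.  For order one, the defect is written [r - dW J], where
   [J = grad f(Xhat_u)], [dW = W - W_u] and [r = O(delta)] contains the Taylor
   remainder.  In [|e|^(2k) <e, dW J>] the error is replaced by its value at
   [u], which leaves a term of mean zero by the strong Markov property.  The
   price is [|e - e_u| |dW J|], and since [e] has derivative [O(delta^(1/2))] on a
   step of length [O(delta)], this is [O(delta^(3/2) delta^(1/2))].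
   The moments of [Xhat_u] are bounded uniformly in time by summing the recursion
   for [expR (kappa t_n) |Xhat_n|^(2k+2)] over the steps up to the one that
   contains [t]; the same bound and Fatou's lemma show that [t_n] tends to
   infinity almost surely.  Only even integer moments occur, and [|x|^q] is
   bounded by [1 + |x|^N]. *)

(** * Powers of real numbers *)

(** The noise is additive, so the error satisfies an ordinary differential equation inside each
    step. The difficulty is that the grid is random: its times depend on the state, and the step
    that contains a fixed time [s] is selected by a random index. What makes this tractable is that
    [t_{n+1}] is already determined at [t_n]. Hence the event that [s] lies in step [n] belongs to
    the past of [t_n], and an expectation at time [s] is a sum over [n] of expectations tested
    against such events; non-explosion makes these events cover almost every path. For the scheme,
    Ito's formula is replaced by a Taylor expansion over one step, whose linear term has mean zero
    and whose remainder is controlled by even moments of the increments. Moments of the exact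
    solution follow from those of the scheme once the error is known to be of order one half.
    Constants are uniform in [t] because exponential weights integrate to a multiple of their final
    value, and uniform in [delta] because they are chosen before the timestep function. *)

Ltac nonneg := repeat first [done | exact: ltW | exact: expR_ge0
  | apply: exprn_ge0 | apply: addr_ge0 | apply: mulr_ge0 | rewrite invr_ge0].

Section scalar_inequalities.
Context {R : realFieldType}.
Implicit Types a b x y : R.

Lemma powD_le n a b : 0 <= a -> 0 <= b ->
  (a + b) ^+ n <= 2 ^+ n * (a ^+ n + b ^+ n).
Proof.
wlog ab : a b / a <= b => [wl a0 b0|a0 b0].
  have /orP[/wl|/wl] := le_total a b; first exact.
  by rewrite addrC [a ^+ n + _]addrC; apply.
have ab2 : a + b <= 2 * b by lra.
apply: (@le_trans _ _ ((2 * b) ^+ n)).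
  by apply: lerXn2r => //; rewrite nnegrE ?addr_ge0// mulr_ge0.
by rewrite exprMn ler_pM2l ?exprn_gt0// lerDr exprn_ge0.
Qed.

(** Split at [b = eta * a]: below it the first term alone dominates; above it [eta * a < b] and the
    second one does. The constant is not sharp, but only integer powers occur. *)
Lemma young_pow n (eta : R) a b : 0 < eta -> 0 <= a -> 0 <= b ->
  a ^+ n * b <= eta * a ^+ n.+1 + eta ^- n * b ^+ n.+1.
Proof.
move=> eta0 a0 b0; have [bea|bea] := leP b (eta * a).
  apply: (@le_trans _ _ (eta * a ^+ n.+1)).
    by rewrite exprSr mulrCA; apply: ler_wpM2l => //; exact: exprn_ge0.
  by rewrite lerDl mulr_ge0 ?exprn_ge0// invr_ge0 exprn_ge0// ltW.
apply: (@le_trans _ _ (eta ^- n * b ^+ n.+1)); last first.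
  by rewrite lerDr mulr_ge0 ?exprn_ge0// ltW.
rewrite exprSr mulrA ler_wpM2r// -exprVn -exprMn; apply: lerXn2r => //.
  by rewrite nnegrE mulr_ge0// invr_ge0 ltW.
by rewrite mulrC ler_pdivlMr// mulrC ltW.
Qed.

Lemma pow_le1D n k x : (n <= k)%N -> 0 <= x -> x ^+ n <= 1 + x ^+ k.
Proof.
move=> nk x0; have [x1|x1] := leP x 1.
  by apply: (@le_trans _ _ 1); [exact: exprn_ile1|rewrite lerDl exprn_ge0].
apply: (@le_trans _ _ (x ^+ k)); last by rewrite lerDr.
by apply: ler_weXn2l => //; exact: ltW.
Qed.

(** By convexity the slope of [x ^+ n.+1] between [a] and [a + b] is at most its slope at the right
    end point. *)
Lemma powD_le_linear n a b : 0 <= a -> 0 <= b ->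
  (a + b) ^+ n.+1 <= a ^+ n.+1 + n.+1%:R * b * (a + b) ^+ n.
Proof.
move=> a0 b0; elim: n => [|n IH]; first by rewrite !expr1 expr0 mulr1 mul1r.
have ab0 : 0 <= a + b by rewrite addr_ge0.
have aab : a ^+ n.+1 <= (a + b) ^+ n.+1.
  by apply: lerXn2r => //; rewrite lerDl.
rewrite [X in X <= _]exprSr; apply: (le_trans (ler_wpM2r ab0 IH)).
have -> : (a ^+ n.+1 + n.+1%:R * b * (a + b) ^+ n) * (a + b) =
    a ^+ n.+2 + a ^+ n.+1 * b + n.+1%:R * b * (a + b) ^+ n.+1.
  by rewrite !exprS; ring.
rewrite -addrA lerD2l [n.+2%:R]mulrSr [(_ + 1) * b]mulrDl mulrDl addrC lerD2l mul1r.
by rewrite [b * _]mulrC ler_wpM2r.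
Qed.

(* Second order Taylor bound of the power function; [y] is allowed to be
   negative, and [b] is meant to be [|xi|^2] when [a = |phi|^2] and
   [a + y = |phi + xi|^2]. *)
Lemma pow_taylor2 (k : nat) : exists2 C : R, 0 <= C &
  forall a b y, 0 <= a -> 0 <= b -> 0 <= a + y ->
    y ^+ 2 <= 8 * a * b + 2 * b ^+ 2 -> y <= a + 2 * b ->
  (a + y) ^+ k.+1 <=
    a ^+ k.+1 + k.+1%:R * a ^+ k * y + C * (a ^+ k * b + b ^+ k.+1).
Proof.
elim: k => [|k [C C0 IH]].
  exists 0 => // a b y a0 b0 ay0 y2 yle; rewrite !expr1 expr0; lra.
exists (10 * k.+1%:R + 8 * C).
  by rewrite addr_ge0 ?mulr_ge0.
move=> a b y a0 b0 ay0 y2 yle.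
have mixed i : (i <= k)%N -> a ^+ i * b ^+ (k.+2 - i) <=
    a ^+ k.+1 * b + b ^+ k.+2.
  move=> ik; have [ab|/ltW ba] := leP a b.
    apply: (@le_trans _ _ (b ^+ k.+2)).
      rewrite -[X in _ <= b ^+ X](subnKC (leqW (leqW ik))) exprD.
      by rewrite ler_wpM2r ?exprn_ge0//; apply: lerXn2r.
    by rewrite lerDr mulr_ge0 ?exprn_ge0.
  apply: (@le_trans _ _ (a ^+ k.+1 * b)); last by rewrite lerDl exprn_ge0.
  rewrite subSn 1?leqW// exprSr mulrA ler_wpM2r//.
  rewrite -[X in _ <= a ^+ X](subnKC (leqW ik)) exprD ler_wpM2l ?exprn_ge0//.
  by apply: lerXn2r.
have m1 := mixed k (leqnn k).
rewrite (_ : (k.+2 - k = 2)%N) in m1; last by rewrite -[k.+2]addn2 addKn.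
have h1 := IH a b y a0 b0 ay0 y2 yle.
have h2 := ler_wpM2l ay0 h1.
rewrite [X in X <= _]exprS; apply: (le_trans h2) => {h1 h2}.
rewrite 2!mulrDr.
have e1 : (a + y) * a ^+ k.+1 + (a + y) * (k.+1%:R * a ^+ k * y) =
    a ^+ k.+2 + k.+2%:R * a ^+ k.+1 * y + k.+1%:R * (a ^+ k * y ^+ 2).
  by rewrite [k.+2%:R]mulrSr !exprS; ring.
rewrite e1 -[X in X <= _]addrA lerD2l.
have ak0 : 0 <= a ^+ k by exact: exprn_ge0.
have bk0 : 0 <= b ^+ k by exact: exprn_ge0.
have t1 : a ^+ k * y ^+ 2 <= 10 * (a ^+ k.+1 * b + b ^+ k.+2).
  apply: (@le_trans _ _ (a ^+ k * (8 * a * b + 2 * b ^+ 2))).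
    exact: ler_wpM2l.
  have -> : a ^+ k * (8 * a * b + 2 * b ^+ 2) =
     8 * (a ^+ k.+1 * b) + 2 * (a ^+ k * b ^+ 2) by rewrite !exprS; ring.
  have := exprn_ge0 k.+2 b0; set X := b ^+ k.+2 in m1 *; lra.
have t2 : (a + y) * (a ^+ k * b + b ^+ k.+1) <=
    8 * (a ^+ k.+1 * b + b ^+ k.+2).
  apply: (@le_trans _ _ ((2 * a + 2 * b) * (a ^+ k * b + b ^+ k.+1))).
    apply: ler_wpM2r; first by rewrite addr_ge0 ?mulr_ge0// exprn_ge0.
    lra.
  have abk : a * b ^+ k.+1 <= a ^+ k.+1 * b + b ^+ k.+2.
    have [ab|/ltW ba] := leP a b.
      apply: (@le_trans _ _ (b ^+ k.+2)).
        by rewrite [b ^+ k.+2]exprS ler_wpM2r ?exprn_ge0.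
      by rewrite lerDr mulr_ge0 ?exprn_ge0.
    apply: (@le_trans _ _ (a ^+ k.+1 * b)); last by rewrite lerDl exprn_ge0.
    rewrite exprSr mulrA ler_wpM2r// exprS ler_wpM2l//.
    by apply: lerXn2r.
  have -> : (2 * a + 2 * b) * (a ^+ k * b + b ^+ k.+1) =
     2 * (a ^+ k.+1 * b) + 2 * (a * b ^+ k.+1) + 2 * (a ^+ k * b ^+ 2)
     + 2 * b ^+ k.+2 by rewrite !exprS; ring.
  have := mulr_ge0 (exprn_ge0 k.+1 a0) b0; have := exprn_ge0 k.+2 b0.
  move: m1 abk; set X := b ^+ k.+2; set Y := a ^+ k.+1 * b; lra.
rewrite [X in _ <= X]mulrDl; apply: lerD.
  by rewrite [10 * _]mulrC -mulrA; apply: ler_wpM2l.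
rewrite mulrCA [8 * C]mulrC -mulrA; apply: le_trans (ler_wpM2l C0 t2) _.
by [].
Qed.

End scalar_inequalities.

(** * Euclidean norm *)

Lemma continuous_sum {R : realType} (T : topologicalType) n (F : 'I_n -> T -> R) :
  (forall i, continuous (F i)) -> continuous (fun x => \sum_i F i x).
Proof.
move=> cF.
have ac : continuous (fun z : R * R => z.1 + z.2) by exact: add_continuous.
exact: (@continuous_big R _ +%R 0 xpredT ac T (index_enum 'I_n) F (fun i _ => cF i)).
Qed.

Section euclid.
Context {R : realType} {m : nat}.
Implicit Types u v w x y : 'rV[R]_m.

Lemma dotvC u v : dotv u v = dotv v u.
Proof. by apply: eq_bigr => i _; rewrite mulrC. Qed.

Lemma dotvDl u v w : dotv (u + v) w = dotv u w + dotv v w.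
Proof. by rewrite -big_split; apply: eq_bigr => i _; rewrite mxE mulrDl. Qed.

Lemma dotvZl (c : R) u w : dotv (c *: u) w = c * dotv u w.
Proof. by rewrite /dotv mulr_sumr; apply: eq_bigr => i _; rewrite mxE mulrA. Qed.

Lemma dotvNl u w : dotv (- u) w = - dotv u w.
Proof. by rewrite -scaleN1r dotvZl mulN1r. Qed.

Lemma dotvBl u v w : dotv (u - v) w = dotv u w - dotv v w.
Proof. by rewrite dotvDl dotvNl. Qed.

Lemma dotvDr u v w : dotv w (u + v) = dotv w u + dotv w v.
Proof. by rewrite dotvC dotvDl !(dotvC w). Qed.

Lemma dotvZr (c : R) u w : dotv w (c *: u) = c * dotv w u.
Proof. by rewrite dotvC dotvZl (dotvC w). Qed.

Lemma dotvNr u w : dotv w (- u) = - dotv w u.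
Proof. by rewrite dotvC dotvNl (dotvC w). Qed.

Lemma dotvBr u v w : dotv w (u - v) = dotv w u - dotv w v.
Proof. by rewrite dotvDr dotvNr. Qed.

Lemma normF_ge0 p n (A : 'M[R]_(p, n)) : 0 <= normF A.
Proof. exact: sqrtr_ge0. Qed.

Lemma normF_sqrM p n (A : 'M[R]_(p, n)) :
  normF A ^+ 2 = \sum_i \sum_j A i j ^+ 2.
Proof.
by rewrite sqr_sqrtr//; do 2!apply: sumr_ge0 => ? _; exact: sqr_ge0.
Qed.

Lemma normF_sqr u : normF u ^+ 2 = dotv u u.
Proof. by rewrite normF_sqrM big_ord1; apply: eq_bigr => i _; rewrite expr2. Qed.

Lemma normF0 : normF (0 : 'rV[R]_m) = 0.
Proof.
apply/eqP; rewrite -sqrf_eq0 normF_sqr; apply/eqP.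
by apply: big1 => i _; rewrite mxE mul0r.
Qed.

Lemma normF_eq0 u : normF u = 0 -> u = 0.
Proof.
move=> u0; apply/rowP => i; rewrite mxE; apply/eqP.
have : dotv u u = 0 by rewrite -normF_sqr u0 expr0n.
move/psumr_eq0P => H; rewrite -sqrf_eq0 expr2; apply/eqP/H => // j _.
by rewrite -expr2 sqr_ge0.
Qed.

Lemma dotv_le u v : dotv u v <= normF u * normF v.
Proof.
have [u0|u0] := eqVneq (normF u) 0.
  by rewrite u0 mul0r (normF_eq0 u0) -(scale0r 0) dotvZl mul0r.
have [v0|v0] := eqVneq (normF v) 0.
  by rewrite v0 mulr0 (normF_eq0 v0) -(scale0r 0) dotvZr mul0r.
have a0 : 0 < normF u by rewrite lt_neqAle eq_sym u0 normF_ge0.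
have b0 : 0 < normF v by rewrite lt_neqAle eq_sym v0 normF_ge0.
have : 0 <= normF (normF v *: u - normF u *: v) ^+ 2 by exact: sqr_ge0.
rewrite normF_sqr dotvBl !dotvBr !dotvZl !dotvZr -!normF_sqr (dotvC v u).
set a := normF u in a0 *; set b := normF v in b0 *; set c := dotv u v.
have -> : b * (b * a ^+ 2) - b * (a * c) - (a * (b * c) - a * (a * b ^+ 2)) =
  (2 * (a * b)) * (a * b - c) by ring.
by rewrite pmulr_rge0 ?subr_ge0// mulr_gt0 ?mulr_gt0.
Qed.

Lemma normFN u : normF (- u) = normF u.
Proof.
apply/eqP; rewrite -(@eqrXn2 _ 2) ?normF_ge0//.
by rewrite !normF_sqr dotvNl dotvNr opprK.
Qed.

Lemma normr_dotv_le u v : `|dotv u v| <= normF u * normF v.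
Proof.
rewrite ler_norml dotv_le andbT lerNl -dotvNl -(normFN u); exact: dotv_le.
Qed.

Lemma normFD u v : normF (u + v) <= normF u + normF v.
Proof.
rewrite -(@ler_pXn2r _ 2) ?nnegrE ?addr_ge0 ?normF_ge0//.
rewrite normF_sqr dotvDl !dotvDr -!normF_sqr (dotvC v u).
have := dotv_le u v; nra.
Qed.

Lemma normFZ (c : R) u : normF (c *: u) = `|c| * normF u.
Proof.
apply/eqP; rewrite -(@eqrXn2 _ 2) ?mulr_ge0 ?normF_ge0//.
by rewrite exprMn !normF_sqr dotvZl dotvZr mulrA -expr2 real_normK// num_real.
Qed.

Lemma coord_le_normF u i : `|u ord0 i| <= normF u.
Proof.
rewrite -(@ler_pXn2r _ 2) ?nnegrE ?normF_ge0//.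
rewrite real_normK ?num_real// normF_sqr /dotv (bigD1 i)//= -expr2 lerDl.
by apply: sumr_ge0 => j _; rewrite -expr2 sqr_ge0.
Qed.

Lemma normF_mulmx u (A : 'M[R]_m) : normF (u *m A) <= normF u * normF A.
Proof.
rewrite -(@ler_pXn2r _ 2) ?nnegrE ?mulr_ge0 ?normF_ge0//.
rewrite [leLHS]normF_sqr exprMn [normF A ^+ 2]normF_sqrM exchange_big/= mulr_sumr.
apply: ler_sum => j _.
have -> : (u *m A) ord0 j = dotv u (col j A)^T.
  by rewrite mxE; apply: eq_bigr => i _; rewrite !mxE.
rewrite -expr2 -real_normK ?num_real//.
apply: (@le_trans _ _ ((normF u * normF (col j A)^T) ^+ 2)).
  by apply: lerXn2r; rewrite ?nnegrE ?mulr_ge0 ?normF_ge0//; exact: normr_dotv_le.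
rewrite exprMn [X in _ * X]normF_sqr le_eqVlt; apply/orP; left; apply/eqP.
by congr (_ * _); apply: eq_bigr => i _; rewrite !mxE expr2.
Qed.

Lemma normF_continuous : continuous (@normF R 1 m).
Proof.
have -> : @normF R 1 m = Num.sqrt \o (fun u : 'rV[R]_m => \sum_i u ord0 i ^+ 2).
  by apply/funext => u; rewrite /normF big_ord1.
move=> x; apply: continuous_comp; last exact: sqrt_continuous.
apply: (@continuous_sum _ _ _ (fun i (u : 'rV[R]_m) => u ord0 i ^+ 2)) => i {}x.
apply: (@continuous_comp _ _ _ (fun u : 'rV[R]_m => u ord0 i) (fun r => r ^+ 2)); last first.
  exact: exprn_continuous.
exact: coord_continuous.
Qed.

End euclid.

(** * Taylor remainder of a differentiable vector field *)

Section taylor.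
Context {R : realType} {m : nat}.
Variable f : 'rV[R]_m -> 'rV[R]_m.
Hypothesis f_differentiable : forall x : 'rV[R]_m, differentiable f x.

Lemma is_derive_coord n (F : R -> 'rV[R]_n) (s : R) (dF : 'rV[R]_n) i :
  is_derive s 1 F dF -> is_derive s 1 (fun s => F s ord0 i) (dF ord0 i).
Proof.
move=> [Fs <-]; have /derivable_mxP/(_ ord0 i) dF' := Fs.
by apply: DeriveDef => //; rewrite derive_mx// mxE.
Qed.

Lemma is_derive_segment (x y : 'rV[R]_m) (s : R) :
  is_derive s 1 (fun s => f (x + s *: y)) (y *m jacobian f (x + s *: y)).
Proof.
have E : (fun h : R => h^-1 *: (((fun s : R => f (x + s *: y)) \o shift s) (h *: 1)
    - f (x + s *: y))) =
  (fun h : R => h^-1 *: ((f \o shift (x + s *: y)) (h *: y) - f (x + s *: y))).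
  apply/funext => h /=; congr (_ *: (f _ - _)).
  by rewrite scalerDl addrCA scaler1.
have df := @diff_derivable _ _ _ _ _ y (f_differentiable (x + s *: y)).
apply: DeriveDef; first by rewrite /derivable E.
by rewrite -deriveEjacobian// /derive E.
Qed.

(** The mean value theorem has no direct vector-valued version. It is applied to the scalar function
    [s -> <r, f (x + s y)>], where [r] is the remainder itself: this gives
    [|r|^2 = <r, y (J(x + c y) - J(x))>] for one [c] in the unit interval, and division by [|r|]
    finishes. *)
Lemma taylor1_normF (L : R) (x y : 'rV[R]_m) :
  (forall s : R, 0 <= s <= 1 ->
    normF (jacobian f (x + s *: y) - jacobian f x) <= L) ->
  normF (f (x + y) - f x - y *m jacobian f x) <= L * normF y.
Proof.
move=> HL; set r := (X in normF X).
have L0 : 0 <= L.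
  by apply: le_trans (HL 0 _); rewrite ?normF_ge0// lexx ler01.
pose F (s : R) := dotv r (f (x + s *: y)).
have dF s : is_derive s (1 : R) F (dotv r (y *m jacobian f (x + s *: y))).
  have -> : F = \sum_i (fun s => r ord0 i *: (f (x + s *: y)) ord0 i).
    by apply/funext => t; rewrite fct_sumE.
  apply: is_derive_sum => i; apply: is_deriveZ.
  exact/is_derive_coord/is_derive_segment.
have [|c /andP[c0 c1]] := @MVT_segment _ F _ 0 1 ler01 (fun s _ => dF s).
  by apply: derivable_within_continuous => s _; have [] := dF s.
rewrite subr0 mulr1 /F scale1r scale0r addr0 -dotvBr => rE.
have : normF r ^+ 2 <= normF r * (normF y * L).
  rewrite normF_sqr {2}/r dotvBr rE -dotvBr -mulmxBr.
  apply: le_trans (dotv_le _ _) _; rewrite ler_wpM2l ?normF_ge0//.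
  apply: le_trans (normF_mulmx _ _) _; rewrite ler_wpM2l ?normF_ge0//.
  by apply: HL; rewrite !bnd_simp in c0 c1; rewrite c0 c1.
have [->|r0] := eqVneq (normF r) 0; first by rewrite mulr_ge0 ?normF_ge0.
by rewrite expr2 ler_pM2l 1?mulrC// lt_neqAle eq_sym r0 normF_ge0.
Qed.

End taylor.

(** * Measurability of vector-valued functions *)

Section countable_index.
Context d d' (T : measurableType d) (T' : measurableType d').

(** Gluing along a countable partition; it serves for roundings of a real argument as well as for
    the random grid index. *)
Lemma measurable_fun_index (I : countType) (idx : T -> I) (q : I -> T -> T') :
  (forall i, measurable (idx @^-1` [set i])) ->
  (forall i, measurable_fun [set: T] (q i)) ->
  measurable_fun [set: T] (fun z => q (idx z) z).
Proof.
move=> midx mq _ U mU; rewrite setTI.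
have -> : (fun z => q (idx z) z) @^-1` U =
    \bigcup_i (idx @^-1` [set i] `&` q i @^-1` U).
  apply/seteqP; split => [z Uz|z [i _ [/= <-]]//].
  by exists (idx z).
apply: countable_bigcupT_measurable => [|i]; first exact: countableP.
apply: measurableI; first exact: midx.
by rewrite -[X in measurable X]setTI; exact: mq.
Qed.

End countable_index.

Section caratheodory.
Context {R : realType} d (T : measurableType d).

(** Rounding the second argument down to multiples of [1 / (n + 1)] gives functions that are
    measurable on countably many strips; by continuity in [s] they converge pointwise to [F]. *)
Lemma measurable_fun_caratheodory (F : T -> R -> R) :
  (forall s, measurable_fun [set: T] (F ^~ s)) ->
  (forall w, continuous (F w)) ->
  measurable_fun [set: T * R] (fun z => F z.1 z.2).
Proof.
move=> mF cF.
pose rnd (n : nat) (s : R) : R := (Num.floor (s * n.+1%:R))%:~R / n.+1%:R.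
have rndP n s : `|s - rnd n s| <= n.+1%:R^-1.
  have n0 : (0 : R) < n.+1%:R by rewrite ltr0n.
  have -> : s - rnd n s = (s * n.+1%:R - (Num.floor (s * n.+1%:R))%:~R) / n.+1%:R.
    by rewrite mulrBl mulfK// gt_eqF.
  rewrite normrM normfV (ger0_norm (ltW n0)) ler_pdivrMr// mulVf ?gt_eqF//.
  have /andP[f1 f2] := floor_itv (s * n.+1%:R).
  by rewrite ger0_norm ?subr_ge0// lerBlDr addrC -intrD1 ltW.
have rnd_cvg s : rnd n s @[n --> \oo] --> s.
  apply/cvgrPdist_le => e e0; near=> n; apply: (le_trans (rndP n s)).
  by apply: ltW; near: n; exact: (near_infty_natSinv_lt (PosNum e0)).
apply: (@measurable_fun_cvg _ _ _ _
    (fun n (z : T * R) => F z.1 (rnd n z.2))) => //; last first.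
  by move=> z _; apply: continuous_cvg; [exact: cF|exact: rnd_cvg].
move=> n.
apply: (@measurable_fun_index _ _ _ _ _ (fun z : T * R => Num.floor (z.2 * n.+1%:R))
  (fun k z => F z.1 (k%:~R / n.+1%:R))).
  move=> k; have mfl : measurable_fun [set: T * R] (fun z : T * R => z.2 * n.+1%:R).
    by apply: measurable_funM => //; exact: measurable_snd.
  have -> : (fun z : T * R => Num.floor (z.2 * n.+1%:R)) @^-1` [set k] =
      [set: T * R] `&` (fun z : T * R => z.2 * n.+1%:R) @^-1` `[k%:~R, (k + 1)%:~R[.
    rewrite setTI; apply/seteqP; split => z /=; rewrite in_itv/=.
      by move=> <-; exact: floor_itv.
    by move=> h; exact: floor_def.
  exact: mfl.
by move=> k; apply: measurableT_comp (mF _) _; exact: measurable_fst.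
Unshelve. all: by end_near. Qed.

End caratheodory.

Section borel_vectors.
Context {R : realType} d (T : measurableType d) {m : nat}.

Lemma measurable_fun_borelV (F : T -> 'rV[R]_m) :
  (forall U : set 'rV[R]_m, open U -> measurable (F @^-1` U)) ->
  measurable_fun [set: T] (F : T -> borelV R m).
Proof.
move=> oF; apply: (@measurability _ _ T (borelV R m) _ _ (@open 'rV[R]_m)) => //.
by move=> _ [U oU <-]; rewrite setTI; exact: oF.
Qed.

Lemma continuous_borelV_measurable (g : 'rV[R]_m -> R) : continuous g ->
  measurable_fun [set: borelV R m] (g : borelV R m -> R).
Proof.
move=> /continuousP cg; apply: (measurability _ (RGenOpens.measurableE R)).
move=> _ [_ [a [b ->] <-]]; rewrite setTI; apply: sub_sigma_algebra.
exact/cg/interval_open.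
Qed.

(** For the converse, an open set is a countable union of balls of rational centre and radius
    [1 / (n + 1)]; in the sup norm such a ball is a finite intersection of conditions on single
    coordinates. *)
Lemma measurable_fun_coordP (F : T -> 'rV[R]_m) :
  measurable_fun [set: T] (F : T -> borelV R m) <->
  forall i, measurable_fun [set: T] (fun w => F w ord0 i).
Proof.
split=> [mF i|mF].
  apply: (measurableT_comp (@continuous_borelV_measurable (fun u => u ord0 i) _) mF).
  exact: coord_continuous.
apply: measurable_fun_borelV => U oU.
pose box (k : 'rV[rat]_m * nat) : set 'rV[R]_m :=
  ball (map_mx ratr k.1 : 'rV[R]_m) k.2.+1%:R^-1.
have -> : F @^-1` U = \bigcup_(k in [set k | box k `<=` U]) (F @^-1` (box k)).
  apply/seteqP; split => [w Uw|w [k kU] /=]; last exact: kU.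
  have /nbhs_ballP[e /= e0 eU] : nbhs (F w) U by exact: open_nbhs_nbhs.
  have [n ne] : exists n : nat, n.+1%:R^-1 < e / 2 :> R.
    have e20 : 0 < e / 2 by rewrite divr_gt0.
    by have [N _ HN] := near_infty_natSinv_lt (PosNum e20); exists N; exact: HN (leqnn N).
  have n0 : 0 < n.+1%:R^-1 :> R by rewrite invr_gt0 ltr0n.
  have cP i : {q : rat | `|ratr q - F w ord0 i| < n.+1%:R^-1}.
    apply/cid.
    have /rat_in_itvoo[q] : F w ord0 i - n.+1%:R^-1 < F w ord0 i + n.+1%:R^-1.
      by rewrite ltrD2l gtrN.
    rewrite in_itv/= => /andP[q1 q2]; exists q.
    by rewrite ltr_norml ltrBlDl q2 andbT ltrBrDl.
  pose c : 'rV[rat]_m := \row_i sval (cP i).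
  have bc : box (c, n) (F w).
    split=> // i j; rewrite (ord1 i) /ball/= mxE mxE.
    exact: (svalP (cP j)).
  exists (c, n) => //= y by_; apply: eU.
  rewrite [e]splitr; apply: (@ball_triangle _ _ (map_mx ratr c : 'rV[R]_m)).
    by apply/ball_sym; apply: le_ball bc; exact: ltW.
  by apply: le_ball by_; exact: ltW.
rewrite bigcup_mkcond; apply: countable_bigcupT_measurable => [|k].
  exact: countableP.
case: ifPn => // _.
have -> : F @^-1` (box k) = \bigcap_(i in [set: 'I_m])
    [set w | ball (ratr (k.1 ord0 i) : R) k.2.+1%:R^-1 (F w ord0 i)].
  apply/seteqP; split => [w [_ bw] i _ /=|w bw]; first by have := bw ord0 i; rewrite mxE.
  split=> [|i j]; first by rewrite invr_gt0 ltr0n.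
  by rewrite (ord1 i) mxE; exact: bw.
apply: fin_bigcap_measurable => // i _.
rewrite -[X in measurable X]setTI; apply: mF => //.
exact: measurable_ball.
Qed.

End borel_vectors.

Section borel_vector_closure.
Context {R : realType} d (T : measurableType d) {m : nat}.
Local Notation mv F := (measurable_fun [set: T] (F : T -> borelV R m)).

Lemma measurable_coord (F : T -> 'rV[R]_m) i : mv F ->
  measurable_fun [set: T] (fun w => F w ord0 i).
Proof. by move/measurable_fun_coordP. Qed.

Lemma measurable_addv (F G : T -> 'rV[R]_m) : mv F -> mv G ->
  mv (fun w => F w + G w).
Proof.
move=> mF mG; apply/measurable_fun_coordP => i.
rewrite (_ : (fun _ => _) = fun w => F w ord0 i + G w ord0 i); last first.
  by apply/funext => w; rewrite mxE.
by apply: measurable_funD; exact: measurable_coord.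
Qed.

Lemma measurable_scalev (c : T -> R) (F : T -> 'rV[R]_m) :
  measurable_fun [set: T] c -> mv F -> mv (fun w => c w *: F w).
Proof.
move=> mc mF; apply/measurable_fun_coordP => i.
rewrite (_ : (fun _ => _) = fun w => c w * F w ord0 i); last first.
  by apply/funext => w; rewrite mxE.
by apply: measurable_funM => //; exact: measurable_coord.
Qed.

Lemma measurable_subv (F G : T -> 'rV[R]_m) : mv F -> mv G ->
  mv (fun w => F w - G w).
Proof.
move=> mF mG; apply: measurable_addv => //.
rewrite (_ : (fun _ => _) = fun w => (-1) *: G w); last first.
  by apply/funext => w; rewrite scaleN1r.
by apply: measurable_scalev.
Qed.

Lemma measurable_dotv (F G : T -> 'rV[R]_m) : mv F -> mv G ->
  measurable_fun [set: T] (fun w => dotv (F w) (G w)).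
Proof.
move=> mF mG; apply: measurable_sum => i.
by apply: measurable_funM; exact: measurable_coord.
Qed.

Lemma measurable_normF (F : T -> 'rV[R]_m) : mv F ->
  measurable_fun [set: T] (fun w => normF (F w)).
Proof.
by apply: measurableT_comp; apply: continuous_borelV_measurable; exact: normF_continuous.
Qed.

Lemma measurable_compv (f : 'rV[R]_m -> 'rV[R]_m) (F : T -> 'rV[R]_m) :
  continuous f -> mv F -> mv (fun w => f (F w)).
Proof.
move=> cf mF; apply: (@measurableT_comp _ _ _ _ _ _ (f : borelV R m -> borelV R m)) mF.
apply: measurable_fun_borelV => U oU; apply: sub_sigma_algebra.
by move/continuousP : cf; exact.
Qed.

Lemma measurable_mulmxv (J : 'rV[R]_m -> 'M[R]_m) (F G : T -> 'rV[R]_m) :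
  continuous J -> mv F -> mv G -> mv (fun w => F w *m J (G w)).
Proof.
move=> cJ mF mG; apply/measurable_fun_coordP => j.
rewrite (_ : (fun _ => _) = fun w => \sum_i F w ord0 i * J (G w) i j); last first.
  by apply/funext => w; rewrite mxE.
apply: measurable_sum => i; apply: measurable_funM; first exact: measurable_coord.
apply: (measurableT_comp (@continuous_borelV_measurable _ _ (fun u => J u i j) _) mG).
move=> x; apply: (@continuous_comp _ _ _ J (fun A : 'M[R]_m => A i j)).
  exact: cJ.
exact: coord_continuous.
Qed.

End borel_vector_closure.

Lemma measurable_EFin_comp {R : realType} d (T : measurableType d) (D : set T)
  (f : T -> R) : measurable_fun D f -> measurable_fun D (fun x => (f x)%:E).
Proof. by move=> mf; exact/measurable_EFinP. Qed.

(** * From indicators to nonnegative functions, for weighted image measures *)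

Section transfer.
Local Open Scope ereal_scope.
Context {R : realType} dY (Y : measurableType dY).
Import HBNNSimple.

Let int_nnsfun d (X : measurableType d) (mu : {measure set X -> \bar R})
    (b : X -> R) (phi : X -> Y) (f : {nnsfun Y >-> R}) :
  measurable_fun setT b -> measurable_fun setT phi -> (forall x, 0 <= b x)%R ->
  \int[mu]_x (b x * f (phi x))%:E =
  \sum_(k \in range f) k%:E * \int[mu]_x (b x * \1_(f @^-1` [set k]) (phi x))%:E.
Proof.
move=> mb mphi b0.
have mk k : measurable_fun setT (fun x => (b x * \1_(f @^-1` [set k]) (phi x))%R).
  by apply: measurable_funM => //; exact: measurableT_comp.
transitivity (\int[mu]_x
    (\sum_(k \in range f) (k * (b x * \1_(f @^-1` [set k]) (phi x)))%:E)).
  apply: eq_integral => x _; rewrite fsumEFin//; congr EFin.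
  rewrite fimfunE mulrC mulr_fsuml//; apply: eq_fsbigr => k _.
  by rewrite -mulrA [X in (_ * X)%R]mulrC.
rewrite ge0_integral_fsum//.
- apply: eq_fsbigr => k /[!inE] -[y _ fyk].
  under eq_integral do rewrite EFinM.
  rewrite ge0_integralZl//.
  + exact: measurable_EFin_comp.
  + by move=> x _; rewrite lee_fin mulr_ge0// indicE.
  + by rewrite lee_fin -fyk.
- by move=> k; apply: measurable_EFin_comp; apply: measurable_funM => //; exact: mk.
- move=> k x _; rewrite lee_fin mulrCA mulr_ge0//.
  by rewrite indicE; case: (boolP (_ \in _)) => [/set_mem/= <-|_]; rewrite ?mulr1 ?mulr0.
Qed.

Let cvg_nnsfun d (X : measurableType d) (mu : {measure set X -> \bar R})
    (b : X -> R) (phi : X -> Y) (g : Y -> R) (mg : measurable_fun setT (EFin \o g)) :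
  measurable_fun setT b -> measurable_fun setT phi ->
  (forall x, 0 <= b x)%R -> (forall y, 0 <= g y)%R ->
  \int[mu]_x (b x * nnsfun_approx measurableT mg n (phi x))%:E @[n --> \oo] -->
  \int[mu]_x (b x * g (phi x))%:E.
Proof.
move=> mb mphi b0 g0.
set f_ := nnsfun_approx measurableT mg.
have fg y : (f_ n y)%:E @[n --> \oo] --> (g y)%:E.
  by apply: cvg_nnsfun_approx => // ? _; rewrite lee_fin.
have -> : \int[mu]_x (b x * g (phi x))%:E =
    \int[mu]_x limn (fun n => (b x * f_ n (phi x))%:E).
  apply: eq_integral => x _; apply/esym/cvg_lim => //.
  under eq_fun do rewrite EFinM.
  rewrite EFinM; apply: cvgeZl => //; exact: fg.
apply: cvg_monotone_convergence => //.
- move=> n; apply: measurable_EFin_comp; apply: measurable_funM => //.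
  exact: measurableT_comp.
- by move=> n x _; rewrite lee_fin mulr_ge0.
- move=> x _ n k nk; rewrite lee_fin ler_wpM2l//.
  exact/lefP/nd_nnsfun_approx.
Qed.

(** The weights [b1], [b2] and the factor [c] are there so that densities, reflected laws and
    independence (for the past as well as for the increment) are all instances of one statement. *)
Lemma ge0_integral_transfer d1 d2 (X1 : measurableType d1) (X2 : measurableType d2)
    (mu1 : {measure set X1 -> \bar R}) (mu2 : {measure set X2 -> \bar R})
    (b1 : X1 -> R) (b2 : X2 -> R) (phi1 : X1 -> Y) (phi2 : X2 -> Y) (c : R)
    (g : Y -> R) :
  measurable_fun setT b1 -> measurable_fun setT phi1 -> (forall x, 0 <= b1 x)%R ->
  measurable_fun setT b2 -> measurable_fun setT phi2 -> (forall x, 0 <= b2 x)%R ->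
  (forall V, measurable V -> \int[mu1]_x (b1 x * \1_V (phi1 x))%:E =
     c%:E * \int[mu2]_x (b2 x * \1_V (phi2 x))%:E) ->
  measurable_fun setT g -> (forall y, 0 <= g y)%R ->
  \int[mu1]_x (b1 x * g (phi1 x))%:E = c%:E * \int[mu2]_x (b2 x * g (phi2 x))%:E.
Proof.
move=> mb1 mphi1 b10 mb2 mphi2 b20 H mg g0.
have mg' : measurable_fun setT (EFin \o g) by exact/measurable_EFinP.
have c1 := @cvg_nnsfun _ _ mu1 _ _ _ mg' mb1 mphi1 b10 g0.
have c2 := @cvg_nnsfun _ _ mu2 _ _ _ mg' mb2 mphi2 b20 g0.
set f_ := nnsfun_approx measurableT mg' in c1 c2.
have E n : \int[mu1]_x (b1 x * f_ n (phi1 x))%:E =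
    c%:E * \int[mu2]_x (b2 x * f_ n (phi2 x))%:E.
  rewrite !int_nnsfun// ge0_mule_fsumr//.
    by apply: eq_fsbigr => k _; rewrite H// muleCA.
  move=> k; have [[y _ <-]|nk] := pselect (range (f_ n) k).
    rewrite mule_ge0 ?lee_fin// integral_ge0// => x _.
    by rewrite lee_fin mulr_ge0.
  have -> : f_ n @^-1` [set k] = set0.
    by apply/seteqP; split => // y /= fy; apply: nk; exists y.
  by rewrite integral0_eq ?mule0// => x _; rewrite indic0 mulr0.
have cE : c%:E * \int[mu2]_x (b2 x * f_ n (phi2 x))%:E @[n --> \oo] -->
   c%:E * \int[mu2]_x (b2 x * g (phi2 x))%:E by exact: cvgeZl.
move: c1; have -> := funext E => c1.
exact: (cvg_unique _ c1 cE).
Qed.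

End transfer.

(** * Gaussian moments *)

Section gaussian.
Context {R : realType}.
Local Notation mu := (@lebesgue_measure R).

Lemma pow_le_fact_expR k (z : R) : 0 <= z -> z ^+ k <= k`!%:R * expR z.
Proof.
move=> z0; case: k => [|k]; first by rewrite fact0 mul1r expr0 -expR0 ler_expR.
rewrite mulrC -ler_pdivrMr ?ltr0n ?fact_gt0//.
by apply: le_trans (expR_ge1Dxn k z0); rewrite lerDr.
Qed.

Lemma normal_probN (s : R) V : s != 0 -> measurable V ->
  normal_prob 0 s ((-%R : R -> R) @^-1` V) = normal_prob 0 s V.
Proof.
move=> s0 mV; rewrite /normal_prob.
rewrite [RHS](_ : _ = \int[pushforward mu (-%R : R -> measurableTypeR R)]_(x in V)
    (normal_pdf 0 s x)%:E)%E; last first.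
  by apply: eq_measure_integral => //= A mA AS; rewrite lebesgue_measureN.
rewrite ge0_integral_pushforward; [|exact: oppr_measurable|exact: mV| |].
- apply: eq_integral => y _; rewrite /= !normal_pdfE// /normal_fun !subr0 sqrrN.
  by [].
- by apply: measurable_funTS; apply: measurable_EFin_comp; exact: measurable_normal_pdf.
- by move=> y _; rewrite lee_fin normal_pdf_ge0.
Qed.

Lemma normal_prob_density (s : R) (g : R -> R) :
  measurable_fun setT g -> (forall y, 0 <= g y) ->
  (\int[normal_prob 0 s]_y (g y)%:E = \int[mu]_y (normal_pdf 0 s y * g y)%:E)%E.
Proof.
move=> mg g0.
have := @ge0_integral_transfer R _ _ _ _ _ _ (normal_prob 0 s) mu (cst 1)
  (normal_pdf 0 s) id id 1 g.
rewrite mul1e => <- //.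
- by apply: eq_integral => y _; rewrite mul1r.
- exact: measurable_normal_pdf.
- by move=> y; exact: normal_pdf_ge0.
- move=> V mV; rewrite mul1e.
  under eq_integral do rewrite mul1r.
  rewrite integral_indic// setIT [RHS](_ : _ = \int[mu]_(x in V) (normal_pdf 0 s x)%:E)%E//.
  rewrite [RHS]integral_mkcond; apply: eq_integral => x _.
  by rewrite patchE indicE; case: ifP; rewrite ?mulr1 ?mulr0.
Qed.

(** Half of the Gaussian exponent pays for the power: with [z = y^2 / (4 s^2)] the density contains
    [exp (- 2 z)], and [z^k <= k! exp z] leaves a multiple of the density of variance [2 s^2]. The
    change of normalisation contributes [sqrt 2 <= 2]. *)
Lemma normal_moment_le k (s : R) : 0 < s ->
  (\int[normal_prob 0 s]_y (y ^+ (2 * k))%:E <=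
    (2 * 4 ^+ k * k`!%:R * (s ^+ 2) ^+ k)%:E)%E.
Proof.
move=> s0; have s2 : 0 < s ^+ 2 by rewrite exprn_gt0.
rewrite normal_prob_density; last 2 first.
- exact: exprn_measurable.
- by move=> y; rewrite exprM exprn_ge0// sqr_ge0.
pose t := Num.sqrt 2 * s.
have sqrt2 : 0 < Num.sqrt 2 :> R by rewrite sqrtr_gt0.
have t0 : 0 < t by rewrite mulr_gt0.
set c := 4 ^+ k * k`!%:R * (s ^+ 2) ^+ k.
have c0 : 0 <= c by rewrite !mulr_ge0 ?exprn_ge0 ?ltW.
apply: (@le_trans _ _ (\int[mu]_y ((Num.sqrt 2 * c) * normal_pdf 0 t y)%:E)%E).
  apply: ge0_le_integral => //.
  - move=> y _; rewrite lee_fin mulr_ge0 ?normal_pdf_ge0//.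
    by rewrite exprM exprn_ge0// sqr_ge0.
  - apply: measurable_EFin_comp; apply: measurable_funM.
      exact: measurable_normal_pdf.
    exact: exprn_measurable.
  - apply: measurable_EFin_comp; apply: measurable_funM => //.
    exact: measurable_normal_pdf.
  move=> y _; rewrite lee_fin.
  pose z := y ^+ 2 / (4 * s ^+ 2).
  have s4 : 0 < 4 * s ^+ 2 by rewrite mulr_gt0.
  have z0 : 0 <= z by apply: divr_ge0; [exact: sqr_ge0|exact: ltW].
  have yz : y ^+ (2 * k) = (4 * s ^+ 2) ^+ k * z ^+ k.
    by rewrite -exprMn /z mulrC divfK ?exprM// gt_eqF.
  have yle : y ^+ (2 * k) <= c * expR z.
    have -> : c * expR z = (4 * s ^+ 2) ^+ k * (k`!%:R * expR z).
      by rewrite /c [(4 * _) ^+ k]exprMn -!mulrA [X in _ * X]mulrCA.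
    by rewrite yz; apply: ler_wpM2l; [exact/exprn_ge0/ltW|exact: pow_le_fact_expR].
  set p := Num.sqrt (s ^+ 2 * pi *+ 2).
  have p0 : 0 < p.
    by rewrite sqrtr_gt0 mulrn_wgt0// mulr_gt0 ?pi_gt0.
  have -> : normal_pdf 0 s y = p^-1 * expR (- z) * expR (- z).
    rewrite normal_pdfE ?gt_eqF// /normal_peak /normal_fun -mulrA -expRD subr0.
    congr (_ * expR _); rewrite /z; field; lra.
  have -> : normal_pdf 0 t y = (Num.sqrt 2 * p)^-1 * expR (- z).
    rewrite normal_pdfE ?gt_eqF// /normal_peak /normal_fun subr0.
    have -> : t ^+ 2 = 2 * s ^+ 2 by rewrite exprMn sqr_sqrtr.
    congr (_^-1 * expR _).
      by rewrite /p -sqrtrM//; rewrite [in RHS]mulrnAr [2 * (_ * pi)]mulrA.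
    by rewrite /z; field; lra.
  have -> : Num.sqrt 2 * c * ((Num.sqrt 2 * p)^-1 * expR (- z)) =
      (p^-1 * expR (- z)) * c by field; lra.
  rewrite -[leLHS]mulrA ler_pM2l ?mulr_gt0 ?invr_gt0 ?expR_gt0//.
  apply: le_trans (ler_wpM2l (expR_ge0 _) yle) _.
  by rewrite mulrCA -expRD addNr expR0 mulr1.
under eq_integral do rewrite EFinM.
rewrite ge0_integralZl//=.
- rewrite integral_normal_pdf mule1 lee_fin.
  have -> : 2 * 4 ^+ k * k`!%:R * (s ^+ 2) ^+ k = 2 * c by rewrite /c !mulrA.
  apply: ler_wpM2r => //.
  rewrite -(@ler_pXn2r _ 2) ?nnegrE ?(ltW sqrt2)// sqr_sqrtr//; lra.
- by apply: measurable_EFin_comp; exact: measurable_normal_pdf.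
- by move=> y _; rewrite lee_fin normal_pdf_ge0.
- by rewrite lee_fin mulr_ge0// ltW.
Qed.

Lemma normal_integralN (s : R) (g : R -> R) : s != 0 ->
  measurable_fun setT g -> (forall y, 0 <= g y) ->
  (\int[normal_prob 0 s]_y (g (- y))%:E = \int[normal_prob 0 s]_y (g y)%:E)%E.
Proof.
move=> s0 mg g0.
have H V : measurable V -> (\int[normal_prob 0 s]_y (1 * \1_V (- y))%:E =
    1%:E * \int[normal_prob 0 s]_y (1 * \1_V y)%:E)%E.
  move=> mV; rewrite mul1e.
  under eq_integral do rewrite mul1r.
  under [RHS]eq_integral do rewrite mul1r.
  have mN : measurable ((-%R : R -> R) @^-1` V).
    by rewrite -[X in measurable X]setTI; exact: oppr_measurable.
  transitivity (\int[normal_prob 0 s]_y (\1_((-%R : R -> R) @^-1` V) y)%:E)%E => //.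
  by rewrite !integral_indic// !setIT; exact: normal_probN.
have := @ge0_integral_transfer R _ _ _ _ _ _ (normal_prob 0 s) (normal_prob 0 s)
  (cst 1) (cst 1) (-%R : R -> R) id 1 g.
move/(_ (measurable_cst _) (@oppr_measurable _ _) (fun=> ler01) (measurable_cst _)
  (@measurable_id _ _ _) (fun=> ler01) H mg g0); rewrite mul1e.
under eq_integral do rewrite mul1r.
by under [X in _ = X -> _]eq_integral do rewrite mul1r.
Qed.

End gaussian.

(** * Stopping times and the strong Markov property *)

(** The domain is retyped with the sigma-algebra generated by [G], so that the closure properties of
    measurable functions apply verbatim to a sub-sigma-algebra. *)
Definition measurable_wrt d d' (T : measurableType d) (G : set (set T))
    (T' : measurableType d') (f : T -> T') : Prop :=
  measurable_fun [set: g_sigma_algebraType G] (f : g_sigma_algebraType G -> T').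

Section measurable_wrt.
Context d d' (T : measurableType d) (T' : measurableType d').
Implicit Types (G : set (set T)) (f : T -> T').

Lemma measurable_wrtP G f : sigma_algebra setT G ->
  measurable_wrt G f <-> forall U, measurable U -> G (f @^-1` U).
Proof.
move=> sG; have GE : <<s G >> = G by exact: sigma_algebra_id.
split=> [mf U mU|mf _ U mU]; last by rewrite setTI /measurable/= GE; exact: mf.
have := mf measurableT U mU; by rewrite setTI /measurable/= GE.
Qed.

Lemma measurable_wrt_sub G G' f : G `<=` G' ->
  measurable_wrt G f -> measurable_wrt G' f.
Proof.
move=> GG' mf _ U mU.
by apply: (@sub_sigma_algebra2 _ setT G' G GG'); exact: mf.
Qed.

Lemma measurable_wrt_measurable G f : G `<=` measurable ->
  measurable_wrt G f -> measurable_fun setT f.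
Proof.
move=> GM mf _ U mU.
apply: (@smallest_sub _ (sigma_algebra setT) G measurable) => //.
  split=> //[A mA|F mF]; [by rewrite setTD; exact: measurableC|exact: bigcupT_measurable].
exact: mf.
Qed.

End measurable_wrt.

Section filtration.
Context {R : realType} d (T : measurableType d).

Variable Ft : R -> set (set T).
Hypothesis FtS : forall t, sigma_algebra setT (Ft t).
Hypothesis FtM : forall t, Ft t `<=` measurable.
Hypothesis Ftle : forall s t, s <= t -> Ft s `<=` Ft t.

Definition stopping (tau : T -> R) : Prop := forall s, Ft s [set w | tau w <= s].

(** The sigma-algebra [F_tau] of the past of [tau]. As [tau] is real-valued, [A] is the union of its
    traces on [tau <= n], which makes it an event. *)
Definition stopped_sets (tau : T -> R) : set (set T) :=
  [set A | forall s, Ft s (A `&` [set w | tau w <= s])].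

Let FtC t A : Ft t A -> Ft t (~` A).
Proof. by rewrite -setTD; have [_ + _] := FtS t; apply. Qed.

Let FtU t A B : Ft t A -> Ft t B -> Ft t (A `|` B).
Proof.
have [F0 _ FU] := FtS t => FA FB; rewrite -bigcup2E; apply: FU => n.
by rewrite /bigcup2; case: ifP => // _; case: ifP.
Qed.

Let FtI t A B : Ft t A -> Ft t B -> Ft t (A `&` B).
Proof.
by move=> FA FB; rewrite -[_ `&` _]setCK setCI; apply/FtC/FtU; exact: FtC.
Qed.

Lemma stopped_sets_sigma (tau : T -> R) : stopping tau ->
  sigma_algebra setT (stopped_sets tau).
Proof.
move=> st; split=> [s|A FA s|A FA s].
- by rewrite set0I; have [] := FtS s.
- rewrite setTD (_ : _ `&` _ = [set w | tau w <= s] `&` ~` (A `&` [set w | tau w <= s])).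
    by apply: FtI => //; apply: FtC.
  apply/seteqP; split => [w [Aw ts]|w [ts nA]]; split => //; first by case.
  by move=> Aw; apply: nA.
- rewrite setI_bigcupl; have [_ _] := FtS s; apply => n; exact: FA.
Qed.

Lemma stopped_sets_measurable (tau : T -> R) : stopping tau ->
  stopped_sets tau `<=` measurable.
Proof.
move=> st A FA.
have -> : A = \bigcup_n (A `&` [set w | tau w <= n%:R]).
  apply/seteqP; split => [w Aw|w [n _ []//]].
  by exists (Num.truncn (tau w)).+1 => //; split => //=; rewrite ltW// truncnS_gt.
by apply: bigcupT_measurable => n; apply: FtM; exact: FA.
Qed.

Lemma stopping_measurable_wrt (tau : T -> R) : stopping tau ->
  measurable_wrt (stopped_sets tau) tau.
Proof.
move=> st; apply: (measurability _ (RGenOInfty.measurableE R)).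
move=> _ [_ [a ->] <-]; rewrite setTI; apply: sub_sigma_algebra => s.
rewrite (_ : _ `&` _ = ~` [set w | tau w <= Num.min a s] `&` [set w | tau w <= s]).
  by apply: FtI => //; apply/FtC/(@Ftle (Num.min a s)) => //; rewrite ge_min lexx orbT.
apply/seteqP; split => [w []|w []] /=; rewrite in_itv/= andbT le_min.
  by move=> ta ts; split => // /andP[]; rewrite leNgt ta.
by move=> /negP + ts; rewrite ts andbT -ltNge.
Qed.

(** Since [tau <= sigma], the event [sigma <= s] is its own trace on [tau <= s]. This is how a grid
    time computed from the previous one becomes a stopping time. *)
Lemma stopping_ge (tau sigma : T -> R) : stopping tau ->
  (forall w, tau w <= sigma w) -> measurable_wrt (stopped_sets tau) sigma ->
  stopping sigma.
Proof.
move=> st ts /(measurable_wrtP _ (stopped_sets_sigma st)) ms s.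
have := ms _ (measurable_itv `]-oo, s]) s.
congr (Ft s _); apply/seteqP; split=> [w [/=]|w /= sw]; rewrite in_itv//=.
by split => //; exact: le_trans sw.
Qed.

Lemma stopped_sets_le (tau sigma : T -> R) : stopping sigma ->
  (forall w, tau w <= sigma w) -> stopped_sets tau `<=` stopped_sets sigma.
Proof.
move=> ss ts A FA s; have := FtI (FA s) (ss s).
congr (Ft s _); apply/seteqP; split=> [w [[Aw _] ?]//|w [Aw sw]].
by split => //; split => //=; exact: le_trans sw.
Qed.

(** Where [tau > u] the function vanishes, and the trace of [F_tau] on [tau <= u] lies in [F_u].
    This brings a test function of the random past into a deterministic sigma-algebra, where
    independence of increments is known. *)
Lemma measurable_wrt_restrict (tau B : T -> R) u : stopping tau ->
  measurable_wrt (stopped_sets tau) B -> (forall w, B w != 0 -> tau w <= u) ->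
  measurable_wrt (Ft u) B.
Proof.
move=> st /(measurable_wrtP _ (stopped_sets_sigma st)) mB Bu.
apply/(measurable_wrtP _ (FtS u)) => U mU.
have [U0|U0] := pselect (U 0).
  rewrite (_ : _ @^-1` _ = (B @^-1` U `&` [set w | tau w <= u]) `|` ~` [set w | tau w <= u]).
    by apply: FtU; [exact: mB|exact/FtC].
  apply/seteqP; split => [w Uw|w [[]//|/= /negP tu]].
    by have [tu|tu] := boolP (tau w <= u); [left|right; exact/negP].
  have [->//|/Bu] := eqVneq (B w) 0; by rewrite (negbTE tu).
rewrite (_ : _ @^-1` _ = B @^-1` U `&` [set w | tau w <= u]); first exact: mB.
apply/seteqP; split => [w Uw|w []//]; split => //=.
by apply: Bu; apply/eqP => Bw0; apply: U0; rewrite -Bw0.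
Qed.

Lemma measurable_evaluation (Y : R -> T -> R) (rho : T -> R) :
  (forall t, measurable_wrt (Ft t) (Y t)) -> (forall w, continuous (Y ^~ w)) ->
  measurable_fun setT rho -> measurable_fun setT (fun w => Y (rho w) w).
Proof.
move=> mY cY mrho.
have mYr : measurable_fun setT (fun z : T * R => Y z.2 z.1).
  apply: (@measurable_fun_caratheodory _ _ _ (fun w r => Y r w)) => // r.
  exact: measurable_wrt_measurable (@FtM r) (mY r).
by apply: (measurableT_comp mYr (measurable_fun_pair (@measurable_id _ _ _) mrho)).
Qed.

(** Progressive measurability: on [tau <= s] the value is that of the process at [min (tau, s)], and
    [(w, r) -> Y (min r s) w] is jointly measurable for [F_s] because the paths are continuous. *)
Lemma stopped_process_measurable (Y : R -> T -> R) (tau : T -> R) :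
  (forall t, measurable_wrt (Ft t) (Y t)) -> (forall w, continuous (Y ^~ w)) ->
  stopping tau -> measurable_wrt (stopped_sets tau) (fun w => Y (tau w) w).
Proof.
move=> mY cY st; apply/(measurable_wrtP _ (stopped_sets_sigma st)) => U mU s.
pose Fs := g_sigma_algebraType (Ft s).
have mts : measurable_wrt (Ft s) (fun w => Num.min (tau w) s).
  apply: (measurability _ (RGenOInfty.measurableE R)).
  move=> _ [_ [a ->] <-]; rewrite setTI; apply: sub_sigma_algebra.
  have [ats|sa] := ltP a s; last first.
    rewrite (_ : _ @^-1` _ = set0); first by have [] := FtS s.
    apply/seteqP; split => // w /=.
    by rewrite in_itv/= andbT lt_min => /andP[_]; rewrite ltNge sa.
  rewrite (_ : _ @^-1` _ = ~` [set w | tau w <= a]).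
    by apply/FtC/(Ftle (ltW ats)).
  apply/seteqP; split => w /=; rewrite in_itv/= andbT lt_min ats andbT ltNge => /negP//.
have mYr : measurable_fun setT (fun z : Fs * R => Y (Num.min z.2 s) z.1).
  apply: (@measurable_fun_caratheodory _ _ Fs (fun w r => Y (Num.min r s) w)).
    move=> r; apply: measurable_wrt_sub (mY _).
    by apply: Ftle; rewrite ge_min lexx orbT.
  move=> w r; apply: (@continuous_comp _ _ _ (fun r => Num.min r s) (Y ^~ w)).
    by apply: continuous_min => //; exact: cst_continuous.
  exact: cY.
have mYs : measurable_wrt (Ft s) (fun w => Y (Num.min (Num.min (tau w) s) s) w).
  by apply: (measurableT_comp mYr (measurable_fun_pair (@measurable_id _ Fs _) mts)).
have := FtI (iffLR (measurable_wrtP _ (FtS s)) mYs U mU) (st s).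
congr (Ft s _); apply/seteqP; split=> [w []|w []] /= + ts; rewrite min_l ?ge_min ?lexx ?orbT// min_l//.
Qed.

End filtration.

Lemma limn_einf_le {R : realType} (u v : (\bar R)^nat) :
  (forall n, u n <= v n)%E -> (limn_einf u <= limn_einf v)%E.
Proof.
move=> uv; rewrite !limn_einf_lim; apply: lee_lim; [exact: is_cvg_einfs|exact: is_cvg_einfs|].
apply: nearW => n; apply: le_ereal_inf_tmp => _ [k /= nk <-].
by apply: le_trans (uv k); apply: ereal_inf_lbound; exists k.
Qed.

(** * Strong Markov inequality *)

Section strong_markov.
Context {R : realType} d (T : measurableType d) (P : probability T R).
Variable Ft : R -> set (set T).
Hypothesis FtS : forall t, sigma_algebra setT (Ft t).
Hypothesis FtM : forall t, Ft t `<=` measurable.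
Hypothesis Ftle : forall s t, s <= t -> Ft s `<=` Ft t.
Variable Z : R -> T -> R.
Hypothesis Za : forall t, measurable_wrt (Ft t) (Z t).
Hypothesis Zc : forall w, continuous (Z ^~ w).
Hypothesis Zi : forall (s t : R), 0 <= s -> s < t ->
  forall (A : set T) (V : set R), Ft s A -> measurable V ->
  (P (A `&` [set w | V (Z t w - Z s w)%R]) =
   P A * normal_prob 0 (Num.sqrt (t - s)) V)%E.

Let mZ t : measurable_fun setT (Z t).
Proof. exact: (measurable_wrt_measurable (@FtM t) (@Za t)). Qed.

Let mxi s t : measurable_fun setT (fun w => Z t w - Z s w).
Proof. exact: measurable_funB. Qed.

Lemma bounded_integral_fin (B : T -> R) (M : R) : measurable_fun setT B ->
  (forall w, 0 <= B w <= M) -> (\int[P]_w (B w)%:E)%E \is a fin_num.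
Proof.
move=> mB BM; rewrite ge0_fin_numE; last first.
  by apply: integral_ge0 => w _; rewrite lee_fin; have /andP[] := BM w.
apply: (@le_lt_trans _ _ (\int[P]_w M%:E)%E).
  apply: ge0_le_integral => //.
  - by move=> w _; rewrite lee_fin; have /andP[] := BM w.
  - exact: measurable_EFin_comp.
  - by move=> w _; rewrite lee_fin; have /andP[] := BM w.
by rewrite integral_cst// [X in (_ * X)%E]probability_setT mule1 ltry.
Qed.

(** Independence on events is lifted twice by [ge0_integral_transfer]: first from events of the past
    to [B], with the set [V] fixed, then from [V] to [g]. *)
Lemma independent_increment_integral (s t M : R) (B : T -> R) (g : R -> R) :
  0 <= s -> s < t -> measurable_wrt (Ft s) B -> (forall w, 0 <= B w <= M) ->
  measurable_fun setT g -> (forall y, 0 <= g y) ->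
  (\int[P]_w (B w * g (Z t w - Z s w))%:E =
   \int[P]_w (B w)%:E * \int[normal_prob 0 (Num.sqrt (t - s))]_y (g y)%:E)%E.
Proof.
move=> s0 st mB BM mg g0.
have mB' : measurable_fun setT B := measurable_wrt_measurable (@FtM s) mB.
have B0 w : 0 <= B w by have /andP[] := BM w.
have mBs U : measurable U -> measurable (B @^-1` U).
  by move=> mU; rewrite -[X in measurable X]setTI; exact: mB'.
have mxiV V : measurable V -> measurable [set w | V (Z t w - Z s w)].
  by move=> mV; rewrite -[X in measurable X]setTI; exact: (mxi s t).
set N := normal_prob 0 (Num.sqrt (t - s)).
have H1 V : measurable V ->
    (\int[P]_w (B w * \1_V (Z t w - Z s w))%:E = N V * \int[P]_w (B w)%:E)%E.
  move=> mV.
  have fNV : N V \is a fin_num by exact: fin_num_measure.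
  have mind : measurable_fun setT (fun w => \1_V (Z t w - Z s w) : R).
    by apply: measurableT_comp.
  (* The transferred function must be nonnegative on the whole line; [|x|] agrees with the identity
     on the values of [B]. *)
  have key : (\int[P]_w (\1_V (Z t w - Z s w) * `|B w|)%:E =
      (fine (N V))%:E * \int[P]_w (1 * `|B w|)%:E)%E.
    apply: (@ge0_integral_transfer R _ _ _ _ _ _ P P
      (fun w => \1_V (Z t w - Z s w)) (cst 1) B B (fine (N V)) (fun x => `|x|)) => //.
    move=> U mU; rewrite fineK//.
    transitivity (\int[P]_w (\1_(B @^-1` U `&` [set w | V (Z t w - Z s w)]) w)%:E)%E.
      by apply: eq_integral => w _; rewrite indicI mulrC.
    rewrite integral_indic//; last by apply: measurableI; [exact: mBs|exact: mxiV].
    rewrite setIT; transitivity (P (B @^-1` U) * N V)%E.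
      by apply: Zi => //; exact: (iffLR (measurable_wrtP _ (FtS s)) mB).
    rewrite muleC; congr (_ * _)%E.
    transitivity (\int[P]_w (\1_(B @^-1` U) w)%:E)%E.
      by rewrite integral_indic ?setIT//; exact: mBs.
    by apply: eq_integral => w _; rewrite mul1r.
  transitivity (\int[P]_w (\1_V (Z t w - Z s w) * `|B w|)%:E)%E.
    by apply: eq_integral => w _; rewrite mulrC ger0_norm.
  rewrite key fineK//; congr (_ * _)%E.
  by apply: eq_integral => w _; rewrite mul1r ger0_norm.
have fB := bounded_integral_fin mB' BM.
have key : (\int[P]_w (B w * g (Z t w - Z s w))%:E =
    (fine (\int[P]_w (B w)%:E))%:E * \int[N]_y (1 * g y)%:E)%E.
  apply: (@ge0_integral_transfer R _ _ _ _ _ _ P N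
    B (cst 1) (fun w => Z t w - Z s w) id (fine (\int[P]_w (B w)%:E)) g) => //.
  move=> V mV; rewrite H1// fineK// muleC; congr (_ * _)%E.
  transitivity (\int[N]_y (\1_V y)%:E)%E; first by rewrite integral_indic// setIT.
  by apply: eq_integral => w _; rewrite mul1r.
rewrite key fineK//; congr (_ * _)%E.
by apply: eq_integral => w _; rewrite mul1r.
Qed.

Section stopping_times.
Variables (tau sigma B : T -> R) (s M : R) (g1 g2 : R -> R -> R) (M2 : R).
Hypothesis tau0 : forall w, 0 <= tau w.
Hypothesis stau : stopping Ft tau.
Hypothesis tausigma : forall w, tau w <= sigma w.
Hypothesis msigma : measurable_wrt (stopped_sets Ft tau) sigma.
Hypothesis mB : measurable_wrt (stopped_sets Ft tau) B.
Hypothesis BM : forall w, 0 <= B w <= M.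
Hypothesis Bs : forall w, B w != 0 -> sigma w <= s.
Hypothesis g1c : continuous (fun p : R * R => g1 p.1 p.2).
Hypothesis g2c : continuous (fun p : R * R => g2 p.1 p.2).
Hypothesis g10 : forall y v, 0 <= g1 y v.
Hypothesis g20 : forall y v, 0 <= g2 y v.
Hypothesis g2M : forall y v, 0 <= v <= s + 1 -> g2 y v <= M2.
Hypothesis det : forall a b (B' : T -> R), 0 <= a -> a <= b ->
  measurable_wrt (Ft a) B' -> (forall w, 0 <= B' w <= M) ->
  (\int[P]_w (B' w * g1 (Z b w - Z a w) (b - a))%:E <=
   \int[P]_w (B' w * g2 (Z b w - Z a w) (b - a))%:E)%E.

(** [up j r] is the right end of the cell of mesh [1 / (j + 1)] that contains [r]. Thus
    [tau <= grid j a] on the event that [tau] lies in cell [a], as [measurable_wrt_restrict]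
    requires, and the rounded times tend to the true ones. *)
Let grid j (n : nat) : R := n.+1%:R / j.+1%:R.
Let kap j (r : R) : nat := Num.truncn (r * j.+1%:R).
Let up j r := grid j (kap j r).

Let upP j r : 0 <= r -> r < up j r <= r + j.+1%:R^-1.
Proof.
move=> r0; have j0 : (0 : R) < j.+1%:R by rewrite ltr0n.
rewrite /up /grid ltr_pdivlMr// ler_pdivrMr// mulrDl mulVf ?gt_eqF//.
rewrite truncnS_gt/= -natr1 lerD2r truncn_le mulr_ge0//; exact: ltW.
Qed.

Let up_cvg r : 0 <= r -> up j r @[j --> \oo] --> r.
Proof.
move=> r0; apply/cvgrPdist_le => e e0; near=> j.
have /andP[u1 u2] := upP j r0.
rewrite distrC ger0_norm ?subr_ge0 ?(ltW u1)// lerBlDl (le_trans u2)//.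
rewrite lerD2l ltW//; near: j; exact: (near_infty_natSinv_lt (PosNum e0)).
Unshelve. all: by end_near. Qed.

Let up_le j r r' : r <= r' -> up j r <= up j r'.
Proof.
move=> rr; rewrite /up /grid ler_pM2r ?invr_gt0 ?ltr0n// ler_nat ltnS.
by apply: le_truncn; rewrite ler_pM2r ?ltr0n.
Qed.

Let sigma0 w : 0 <= sigma w. Proof. exact: le_trans (tau0 w) (tausigma w). Qed.

Let mtauT : measurable_fun setT tau.
Proof.
exact: measurable_wrt_measurable (stopped_sets_measurable (@FtM) stau)
  (stopping_measurable_wrt FtS (@Ftle) stau).
Qed.

Let msigmaT : measurable_fun setT sigma.
Proof.
exact: measurable_wrt_measurable (stopped_sets_measurable (@FtM) stau) msigma.
Qed.

Let mBT : measurable_fun setT B.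
Proof.
exact: measurable_wrt_measurable (stopped_sets_measurable (@FtM) stau) mB.
Qed.

Let mkap d' (T' : measurableType d') (rho : T' -> R) j a : measurable_fun setT rho ->
  (forall w, 0 <= rho w) -> measurable_fun setT (fun w => (kap j (rho w) == a)%:R : R).
Proof.
move=> mrho rho0.
pose I : set R := [set` `[a%:R / j.+1%:R, a.+1%:R / j.+1%:R[%R].
rewrite (_ : (fun _ => _) = (\1_I : R -> R) \o rho); last first.
  apply/funext => w /=; rewrite /kap truncn_eq ?mulr_ge0// indicE; congr (nat_of_bool _)%:R.
  by apply/idP/idP; rewrite ?inE /I/= in_itv/= ler_pdivrMr ?ltr0n// ltr_pdivlMr ?ltr0n.
by apply: measurableT_comp => //; apply: measurable_indic; exact: measurable_itv.
Qed.

Let mg (g : R -> R -> R) (rho1 rho2 : T -> R) : continuous (fun p : R * R => g p.1 p.2) ->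
  measurable_fun setT rho1 -> measurable_fun setT rho2 ->
  measurable_fun setT (fun w => g (rho1 w) (rho2 w)).
Proof.
move=> gc m1 m2.
have pc (y : R) : continuous (fun v : R => (y, v)).
  by move=> v; exact: (cvg_pair (cvg_cst y) (cvg_id : id @ nbhs v --> v)).
have pc' (v : R) : continuous (fun y : R => (y, v)).
  by move=> y; exact: (cvg_pair (cvg_id : id @ nbhs y --> y) (cvg_cst v)).
have mgj : measurable_fun setT (fun p : R * R => g p.1 p.2).
  apply: (@measurable_fun_caratheodory R _ R g).
    move=> v; apply: continuous_measurable_fun => y.
    by apply: (@continuous_comp _ _ _ (fun y => (y, v)) (fun p => g p.1 p.2)); [exact: pc'|exact: gc].
  move=> y v.
  by apply: (@continuous_comp _ _ _ (fun v => (y, v)) (fun p => g p.1 p.2)); [exact: pc|exact: gc].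
exact: (measurableT_comp mgj (measurable_fun_pair m1 m2)).
Qed.

Let sum_grid (g : R -> R -> R) j w :
  B w * g (Z (up j (sigma w)) w - Z (up j (tau w)) w) (up j (sigma w) - up j (tau w)) =
  \sum_(a < (kap j s).+1) \sum_(b < (kap j s).+1)
    (B w * (kap j (tau w) == a)%:R * (kap j (sigma w) == b)%:R) *
       g (Z (grid j b) w - Z (grid j a) w) (grid j b - grid j a).
Proof.
have [B0|B0] := eqVneq (B w) 0.
  by rewrite B0 mul0r big1// => a _; rewrite big1// => b _; rewrite !mul0r.
have kst r : r <= sigma w -> (kap j r < (kap j s).+1)%N.
  move=> rs; rewrite ltnS; apply: le_truncn; rewrite ler_pM2r ?ltr0n//.
  exact: le_trans rs (Bs B0).
rewrite [RHS](bigD1 (Ordinal (kst _ (tausigma w))))//= [X in _ = _ + X]big1 => [|a an]; last first.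
  rewrite big1// => b _; rewrite (_ : (kap j (tau w) == a) = false) ?mulr0 ?mul0r//.
  by apply/negbTE; apply: contraNneq an => e; apply/eqP/val_inj.
rewrite addr0 [RHS](bigD1 (Ordinal (kst _ (lexx (sigma w)))))//= [X in _ = _ + X]big1 => [|b bn].
  by rewrite !eqxx !mulr1 addr0.
rewrite (_ : (kap j (sigma w) == b) = false) ?mulr0 ?mul0r//.
by apply/negbTE; apply: contraNneq bn => e; apply/eqP/val_inj.
Qed.

(** On each pair of cells the rounded times are constants. As [sigma] is known at [tau], the
    indicators of both cells join [B] in a test function for [det]; pairs with [b < a] are empty.
    Finitely many pairs suffice because [B] is supported on [sigma <= s]. *)
Let grid_le j :
  (\int[P]_w (B w * g1 (Z (up j (sigma w)) w - Z (up j (tau w)) w)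
      (up j (sigma w) - up j (tau w)))%:E <=
   \int[P]_w (B w * g2 (Z (up j (sigma w)) w - Z (up j (tau w)) w)
      (up j (sigma w) - up j (tau w)))%:E)%E.
Proof.
pose B' a b w := B w * (kap j (tau w) == a)%:R * (kap j (sigma w) == b)%:R.
have B'0 a b w : 0 <= B' a b w.
  by rewrite !mulr_ge0//; have /andP[] := BM w.
have mB'F a b : measurable_wrt (stopped_sets Ft tau) (B' a b).
  apply: measurable_funM; first apply: measurable_funM => //.
    by apply: mkap => //; exact: (stopping_measurable_wrt FtS (@Ftle) stau).
  exact: mkap.
have mB' a b : measurable_fun setT (B' a b).
  exact: measurable_wrt_measurable (stopped_sets_measurable (@FtM) stau) (mB'F a b).
have expand (g : R -> R -> R) : continuous (fun p : R * R => g p.1 p.2) -> (forall y v, 0 <= g y v) ->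
  (\int[P]_w (B w * g (Z (up j (sigma w)) w - Z (up j (tau w)) w)
      (up j (sigma w) - up j (tau w)))%:E =
   \sum_(a < (kap j s).+1) \sum_(b < (kap j s).+1)
    \int[P]_w (B' a b w * g (Z (grid j b) w - Z (grid j a) w) (grid j b - grid j a))%:E)%E.
  move=> gc g0; under eq_integral do rewrite sum_grid -sumEFin.
  have mterm a b : measurable_fun setT (fun w =>
      (B' a b w * g (Z (grid j b) w - Z (grid j a) w) (grid j b - grid j a))).
    by apply: measurable_funM => //; apply: mg.
  rewrite ge0_integral_sum//.
  - apply: eq_bigr => a _; under eq_integral do rewrite -sumEFin.
    rewrite ge0_integral_sum// => b.
      exact/measurable_EFin_comp/mterm.
    by move=> w _; rewrite lee_fin; exact: (mulr_ge0 (B'0 a b w)).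
  - move=> a; apply: measurable_EFin_comp; apply: measurable_sum => b; exact: mterm.
  - move=> a w _; rewrite lee_fin; apply: sumr_ge0 => b _.
    exact: (mulr_ge0 (B'0 a b w)).
rewrite !expand//; apply: lee_sum => a _; apply: lee_sum => b _.
have [ab|ba] := leqP a b; last first.
  rewrite !integral0_eq// => w _; rewrite (_ : B' a b w = 0) ?mul0r//.
    rewrite /B'; case: eqP => [ka|_]; last by rewrite mulr0 mul0r.
    case: eqP => [kb|_]; last by rewrite mulr0.
    move: ba; rewrite ltnNge -ka -kb; suff -> : (kap j (tau w) <= kap j (sigma w))%N by [].
    by apply: le_truncn; rewrite ler_pM2r ?ltr0n.
  rewrite /B'; case: eqP => [ka|_]; last by rewrite mulr0 mul0r.
  case: eqP => [kb|_]; last by rewrite mulr0.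
  move: ba; rewrite ltnNge -ka -kb; suff -> : (kap j (tau w) <= kap j (sigma w))%N by [].
  by apply: le_truncn; rewrite ler_pM2r ?ltr0n.
apply: det.
- by rewrite divr_ge0.
- by rewrite ler_pM2r ?invr_gt0 ?ltr0n// ler_nat ltnS.
- apply: (measurable_wrt_restrict FtS stau (mB'F a b)) => w.
  rewrite /B'; case: (eqVneq (kap j (tau w)) a) => [<-|]; last by rewrite mulr0 mul0r eqxx.
  by move=> _; apply: ltW; have /andP[] := upP j (tau0 w).
- move=> w; rewrite B'0/=; have /andP[B0 Bm] := BM w; apply: le_trans Bm.
  by rewrite /B'; case: eqP => _; case: eqP => _; rewrite ?mulr1 ?mulr0.
Qed.

(* [tau] and [sigma] are rounded up to the grid [Z / (j + 1)], on which [det]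
   applies cell by cell; the limit is taken by Fatou on the left and by dominated
   convergence on the right. *)
Lemma strong_markov_le :
  (\int[P]_w (B w * g1 (Z (sigma w) w - Z (tau w) w) (sigma w - tau w))%:E <=
   \int[P]_w (B w * g2 (Z (sigma w) w - Z (tau w) w) (sigma w - tau w))%:E)%E.
Proof.
have mup j (rho : T -> R) : measurable_fun setT rho -> (forall w, 0 <= rho w) ->
    measurable_fun setT (fun w : T => up j (rho w)).
  move=> mrho rho0; apply: (@measurable_fun_index _ _ _ _ _ (fun w => kap j (rho w))
    (fun n _ => grid j n)) => // n.
  have := mkap j n mrho rho0 => /(_ measurableT _ (measurable_set1 1)).
  rewrite setTI; congr measurable; apply/seteqP; split => w /=.
    by case: eqP => // _ /esym/eqP; rewrite oner_eq0.
  by move=> ->; rewrite eqxx.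
have mZr (rho : T -> R) : measurable_fun setT rho -> measurable_fun setT (fun w => Z (rho w) w).
  by move=> mrho; exact: (measurable_evaluation (@FtM) (@Za) Zc mrho).
have mterm (g : R -> R -> R) j : continuous (fun p : R * R => g p.1 p.2) ->
   measurable_fun setT (fun w => (B w * g (Z (up j (sigma w)) w - Z (up j (tau w)) w)
      (up j (sigma w) - up j (tau w)))%:E).
  move=> gc; apply: measurable_EFin_comp; apply: measurable_funM => //; apply: mg => //.
    by apply: measurable_funB; apply: mZr; apply: mup.
  by apply: measurable_funB; apply: mup.
have mlim (g : R -> R -> R) : continuous (fun p : R * R => g p.1 p.2) ->
   measurable_fun setT (fun w => (B w * g (Z (sigma w) w - Z (tau w) w)
      (sigma w - tau w))%:E).
  move=> gc; apply: measurable_EFin_comp; apply: measurable_funM => //; apply: mg => //.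
    by apply: measurable_funB; apply: mZr.
  exact: measurable_funB.
have lim (g : R -> R -> R) w : continuous (fun p : R * R => g p.1 p.2) ->
  (B w * g (Z (up j (sigma w)) w - Z (up j (tau w)) w)
      (up j (sigma w) - up j (tau w)))%:E @[j --> \oo] -->
  (B w * g (Z (sigma w) w - Z (tau w) w) (sigma w - tau w))%:E.
  move=> gc; apply: cvg_EFin; first by apply: nearW.
  apply: cvgM; first exact: cvg_cst.
  apply: (@cvg_comp _ _ _ (fun j => (Z (up j (sigma w)) w - Z (up j (tau w)) w,
    up j (sigma w) - up j (tau w))) (fun p : R * R => g p.1 p.2) _
    (nbhs (Z (sigma w) w - Z (tau w) w, sigma w - tau w))); last first.
    by have := gc (Z (sigma w) w - Z (tau w) w, sigma w - tau w); rewrite /continuous_at/=.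
  have cZ rho : 0 <= rho -> Z (up j rho) w @[j --> \oo] --> Z rho w.
    by move=> rho0; exact: (cvg_comp _ _ (up_cvg rho0) (@Zc w rho)).
  exact: (cvg_pair (cvgB (cZ _ (sigma0 w)) (cZ _ (tau0 w)))
    (cvgB (up_cvg (sigma0 w)) (up_cvg (tau0 w)))).
have B0 w : 0 <= B w by have /andP[] := BM w.
apply: (@le_trans _ _ (limn_einf (fun j =>
   \int[P]_w (B w * g1 (Z (up j (sigma w)) w - Z (up j (tau w)) w)
      (up j (sigma w) - up j (tau w)))%:E))%E).
  apply: le_trans (fatou _ measurableT (fun j => mterm g1 j g1c) _); last first.
    by move=> j w _; rewrite lee_fin mulr_ge0.
  rewrite le_eqVlt; apply/orP; left; apply/eqP; apply: eq_integral => w _.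
  by have [-> _] := cvg_limn_einf_sup (lim g1 w g1c).
(* Rounding up moves [sigma] by at most [1], so on the support of [B] the elapsed time stays in
   [[0, s + 1]], the range of [g2M]. *)
have dom j w : (`|(B w * g2 (Z (up j (sigma w)) w - Z (up j (tau w)) w)
      (up j (sigma w) - up j (tau w)))%:E| <= (`|M * M2|)%:E)%E.
  rewrite /= lee_fin ger0_norm ?mulr_ge0//.
  have [->|Bw] := eqVneq (B w) 0; first by rewrite mul0r.
  apply: le_trans (ler_norm _); have /andP[_ Bm] := BM w.
  apply: ler_pM => //; apply: g2M.
  rewrite subr_ge0 up_le//=.
  have /andP[u1 _] := upP j (tau0 w); have /andP[_ u2] := upP j (sigma0 w).
  have : j.+1%:R^-1 <= 1 :> R by rewrite invf_le1 ?ltr0n// ler1n.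
  move: u1 u2 (Bs Bw) (tau0 w); set e := _^-1; move=> u1 u2 ss t0 e1.
  rewrite lerBlDr (le_trans u2)//.
  apply: (@le_trans _ _ (s + 1)); first exact: lerD.
  by rewrite lerDl (le_trans t0)// ltW.
have [_ _ cvg2] := dominated_convergence measurableT (fun j => mterm g2 j g2c)
  (mlim g2 g2c) (aeW _ (fun w _ => lim g2 w g2c))
  (finite_measure_integrable_cst P (`|M * M2|) measurableT)
  (aeW _ (fun w j _ => dom j w)).
rewrite -(cvg_limn_einf_sup cvg2).1.
by apply: limn_einf_le => j; exact: grid_le.
Qed.

End stopping_times.
End strong_markov.

(** * Moments and mean of an increment after a stopping time *)

Section increments.
Context {R : realType} d (T : measurableType d) (P : probability T R).
Variable Ft : R -> set (set T).
Hypothesis FtS : forall t, sigma_algebra setT (Ft t).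
Hypothesis FtM : forall t, Ft t `<=` measurable.
Hypothesis Ftle : forall s t, s <= t -> Ft s `<=` Ft t.
Variable Z : R -> T -> R.
Hypothesis Za : forall t, measurable_wrt (Ft t) (Z t).
Hypothesis Zc : forall w, continuous (Z ^~ w).
Hypothesis Zi : forall (s t : R), 0 <= s -> s < t ->
  forall (A : set T) (V : set R), Ft s A -> measurable V ->
  (P (A `&` [set w | V (Z t w - Z s w)%R]) =
   P A * normal_prob 0 (Num.sqrt (t - s)) V)%E.
Variables (tau sigma : T -> R) (s : R).
Hypothesis tau0 : forall w, 0 <= tau w.
Hypothesis stau : stopping Ft tau.
Hypothesis tausigma : forall w, tau w <= sigma w.
Hypothesis msigma : measurable_wrt (stopped_sets Ft tau) sigma.

Let D w := Z (sigma w) w - Z (tau w) w.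

Let FM : stopped_sets Ft tau `<=` measurable := stopped_sets_measurable (@FtM) stau.

Let mtauT : measurable_fun setT tau.
Proof. exact: measurable_wrt_measurable FM (stopping_measurable_wrt FtS (@Ftle) stau). Qed.

Let msigmaT : measurable_fun setT sigma.
Proof. exact: measurable_wrt_measurable FM msigma. Qed.

Let mD : measurable_fun setT D.
Proof.
apply: measurable_funB.
  exact: (measurable_evaluation (@FtM) (@Za) Zc msigmaT).
exact: (measurable_evaluation (@FtM) (@Za) Zc mtauT).
Qed.

Definition moment_cst (k : nat) : R := 2 * 4 ^+ k * k`!%:R.

Lemma moment_cst_ge0 k : 0 <= moment_cst k.
Proof. by rewrite /moment_cst !mulr_ge0// exprn_ge0. Qed.

Lemma increment_moment_le (k : nat) (B : T -> R) (M : R) : (0 < k)%N -> 0 <= s ->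
  measurable_wrt (stopped_sets Ft tau) B -> (forall w, 0 <= B w <= M) ->
  (forall w, B w != 0 -> sigma w <= s) ->
  (\int[P]_w (B w * D w ^+ (2 * k))%:E <=
   \int[P]_w (B w * (moment_cst k * (sigma w - tau w) ^+ k))%:E)%E.
Proof.
move=> k0 s0 mB BM Bs.
pose g1 (y v : R) := y ^+ (2 * k).
(* The absolute value makes [g2] nonnegative for every [v]; it is evaluated at elapsed times, which
   are nonnegative. *)
pose g2 (y v : R) := moment_cst k * `|v| ^+ k.
have c0 := moment_cst_ge0 k.
have -> : (\int[P]_w (B w * (moment_cst k * (sigma w - tau w) ^+ k))%:E =
    \int[P]_w (B w * g2 (D w) (sigma w - tau w))%:E)%E.
  by apply: eq_integral => w _; rewrite /g2 ger0_norm// subr_ge0.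
apply: (strong_markov_le FtS (@FtM) (@Ftle) (@Za) Zc tau0 stau tausigma msigma mB BM
  Bs (g1 := g1) (g2 := g2) (M2 := moment_cst k * (s + 1) ^+ k)).
- move=> p; apply: (@continuous_comp _ _ _ fst (fun y : R => y ^+ (2 * k))).
    exact: cvg_fst.
  exact: exprn_continuous.
- move=> p; apply: (@continuous_comp _ _ _ snd (fun v : R => moment_cst k * `|v| ^+ k)).
    exact: cvg_snd.
  apply: cvgM; first exact: cvg_cst.
  apply: (@continuous_comp _ _ _ (fun v : R => `|v|) (fun v : R => v ^+ k)).
    exact: norm_continuous.
  exact: exprn_continuous.
- by move=> y v; rewrite /g1 exprM exprn_ge0// sqr_ge0.
- by move=> y v; rewrite /g2 mulr_ge0// exprn_ge0.
- move=> y v /andP[v0 vs]; rewrite /g2 ler_wpM2l//; apply: lerXn2r => //.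
    by rewrite nnegrE (le_trans v0).
  by rewrite ger0_norm.
- move=> a b B' a0 ab mB' B'M; have [ab'|ba] := ltP a b; last first.
    have -> : b = a by apply/eqP; rewrite eq_le ab ba.
    rewrite integral0_eq; last by move=> w _; rewrite /g1 subrr expr0n -[k]prednK// mulnS mulr0.
    apply: integral_ge0 => w _; rewrite lee_fin mulr_ge0//; first by have /andP[] := B'M w.
    by rewrite mulr_ge0// exprn_ge0.
  rewrite /g1 (independent_increment_integral FtS (@FtM) (@Za) Zi a0 ab' mB' B'M
    (g := fun y => y ^+ (2 * k))); last 2 first.
  + exact: exprn_measurable.
  + by move=> y; rewrite exprM exprn_ge0// sqr_ge0.
  have mB'T : measurable_fun setT B' := measurable_wrt_measurable (@FtM a) mB'.
  have ba0 : 0 < b - a by rewrite subr_gt0.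
  apply: (@le_trans _ _ (\int[P]_w (B' w)%:E * (moment_cst k * (b - a) ^+ k)%:E)%E).
    apply: lee_wpmul2l.
      by apply: integral_ge0 => w _; rewrite lee_fin; have /andP[] := B'M w.
    apply: le_trans (normal_moment_le k _) _; first by rewrite sqrtr_gt0.
    by rewrite lee_fin sqr_sqrtr// ltW.
  rewrite -ge0_integralZr//; last 3 first.
  + exact: measurable_EFin_comp.
  + by move=> w _; rewrite lee_fin; have /andP[] := B'M w.
  + by rewrite lee_fin mulr_ge0// exprn_ge0// ltW.
  rewrite le_eqVlt; apply/orP; left; apply/eqP; apply: eq_integral => w _.
  by rewrite /g2 ger0_norm ?(ltW ba0).
Qed.

(** Symmetry of the normal law takes the place of its mean: positive and negative parts of an
    increment between deterministic times have the same integral. The truncation at [K] supplies the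
    bound [g2M] and is removed by monotone convergence. The signs [e = 1] and [e = -1] give both
    inequalities. *)
Let half_mean (B : T -> R) (M : R) : 0 <= s ->
  measurable_wrt (stopped_sets Ft tau) B -> (forall w, 0 <= B w <= M) ->
  (forall w, B w != 0 -> sigma w <= s) -> forall e : R, `|e| = 1 ->
  (\int[P]_w (B w * Num.max (e * D w) 0)%:E <=
   \int[P]_w (B w * Num.max (- (e * D w)) 0)%:E)%E.
Proof.
move=> s0 mB BM Bs e e1.
have mBT : measurable_fun setT B := measurable_wrt_measurable FM mB.
have B0 w : 0 <= B w by have /andP[] := BM w.
pose tr (e : R) (K : nat) (y v : R) := Num.min (Num.max (e * y) 0) K%:R.
have trc1 e' K v : continuous (fun y => tr e' K y v).
  rewrite /tr => y.
  apply: (@continuous_min _ _ (fun y => Num.max (e' * y) 0) (cst K%:R)); last exact: cst_continuous.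
  apply: (@continuous_max _ _ (fun y => e' * y) (cst 0)); last exact: cst_continuous.
  exact: mulrl_continuous.
have trc e' K : continuous (fun p : R * R => tr e' K p.1 p.2).
  move=> p; apply: (@continuous_comp _ _ _ fst (fun y : R => tr e' K y 0)).
    exact: cvg_fst.
  exact: trc1.
have tr0 e' K y v : 0 <= tr e' K y v by rewrite le_min le_max lexx orbT ler0n.
have trK (K : nat) : (\int[P]_w (B w * tr e K (D w) (sigma w - tau w))%:E <=
    \int[P]_w (B w * tr (- e) K (D w) (sigma w - tau w))%:E)%E.
  apply: (strong_markov_le FtS (@FtM) (@Ftle) (@Za) Zc tau0 stau tausigma msigma mB BM
    Bs (g1 := tr e K) (g2 := tr (- e) K) (M2 := K%:R)) => //.
    by move=> y v _; rewrite ge_min lexx orbT.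
  move=> a b B' a0 ab mB' B'M; have [ab'|ba] := ltP a b; last first.
    have -> : b = a by apply/eqP; rewrite eq_le ab ba.
    rewrite le_eqVlt; apply/orP; left; apply/eqP; apply: eq_integral => w _.
    by rewrite /tr subrr !mulr0.
  have mtr e' : measurable_fun setT (fun y => tr e' K y (b - a)).
    exact: continuous_measurable_fun.
  rewrite (independent_increment_integral FtS (@FtM) (@Za) Zi a0 ab' mB' B'M
    (mtr e) (fun y => tr0 e K y _)).
  rewrite (independent_increment_integral FtS (@FtM) (@Za) Zi a0 ab' mB' B'M
    (mtr (- e)) (fun y => tr0 (- e) K y _)).
  rewrite -(normal_integralN _ (mtr e) (fun y => tr0 e K y _)); last first.
    by rewrite gt_eqF// sqrtr_gt0 subr_gt0.
  rewrite le_eqVlt; apply/orP; left; apply/eqP; congr (_ * _)%E.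
  by apply: eq_integral => y _; rewrite /tr mulrN mulNr.
have lim e' : (\int[P]_w (B w * tr e' K (D w) (sigma w - tau w))%:E)%E @[K --> \oo] -->
   (\int[P]_w (B w * Num.max (e' * D w) 0)%:E)%E.
  have -> : (\int[P]_w (B w * Num.max (e' * D w) 0)%:E)%E =
      (\int[P]_w (limn (fun K => (B w * tr e' K (D w) (sigma w - tau w))%:E)))%E.
    apply: eq_integral => w _; apply/esym/cvg_lim => //.
    apply: cvg_near_cst; exists (Num.truncn (Num.max (e' * D w) 0)).+1 => // K /= hK.
    rewrite /tr; congr (_ * _)%:E; apply: min_l.
    by apply: le_trans (ltW (truncnS_gt _)) _; rewrite ler_nat.
  apply: cvg_monotone_convergence => //.
  - move=> K; apply: measurable_EFin_comp; apply: measurable_funM => //.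
    apply: (@measurableT_comp _ _ _ _ _ _ (fun y => tr e' K y 0)) => //.
    exact: continuous_measurable_fun.
  - by move=> K w _; rewrite lee_fin mulr_ge0.
  - move=> w _ K K' KK'; rewrite lee_fin ler_wpM2l// /tr le_min ge_min lexx/=.
    by rewrite ge_min ler_nat KK' orbT.
have lime := lim (- e); under [leRHS]eq_integral do rewrite -mulNr.
rewrite -(cvg_lim _ (lim e))// -(cvg_lim _ lime)//.
apply: lee_lim; [by apply/cvg_ex; eexists; exact: lim e|by apply/cvg_ex; eexists; exact: lime|].
exact: nearW.
Qed.

Lemma increment_integrable (B : T -> R) (M : R) : 0 <= s ->
  measurable_wrt (stopped_sets Ft tau) B -> (forall w, `|B w| <= M) ->
  (forall w, B w != 0 -> sigma w <= s) ->
  P.-integrable setT (fun w => (B w * D w)%:E).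
Proof.
move=> s0 mB BM Bs.
have mBT : measurable_fun setT B := measurable_wrt_measurable FM mB.
have mabsB : measurable_wrt (stopped_sets Ft tau) (fun w => `|B w|).
  by apply: measurableT_comp.
have absB w : 0 <= `|B w| <= M by rewrite normr_ge0 BM.
have absBs w : `|B w| != 0 -> sigma w <= s by rewrite normr_eq0; exact: Bs.
apply/integrableP; split; first by apply/measurable_EFin_comp/measurable_funM.
apply: (@le_lt_trans _ _ (\int[P]_w ((M%:E) + (`|B w| * D w ^+ (2 * 1))%:E))%E).
  apply: ge0_le_integral => //.
  - by apply: measurableT_comp => //; apply/measurable_EFin_comp/measurable_funM.
  - apply: emeasurable_funD => //; apply/measurable_EFin_comp/measurable_funM.
      exact: measurableT_comp.
    exact: measurable_funX.
  move=> w _; rewrite /= lee_fin normrM muln1.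
  apply: (@le_trans _ _ (`|B w| + `|B w| * D w ^+ 2)); last by rewrite lerD2r.
  rewrite -{2}[`|B w|]mulr1 -mulrDr ler_wpM2l//.
  rewrite -[D w ^+ 2]real_normK ?num_real//; have := sqr_ge0 (`|D w| - 1); nra.
rewrite ge0_integralD//; last 3 first.
- by move=> w _; rewrite lee_fin (le_trans _ (BM w)).
- by move=> w _; rewrite lee_fin mulr_ge0// exprM sqr_ge0.
- apply/measurable_EFin_comp/measurable_funM; first exact: measurableT_comp.
  exact: measurable_funX.
rewrite lte_add_pinfty//.
  by rewrite integral_cst// [X in (_ * X)%E]probability_setT mule1 ltry.
apply: le_lt_trans (increment_moment_le (ltn0Sn 0) s0 mabsB absB absBs) _.
rewrite -ge0_fin_numE; last first.
  apply: integral_ge0 => w _; rewrite lee_fin !mulr_ge0 ?moment_cst_ge0//.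
  by rewrite exprn_ge0// subr_ge0.
apply: (@bounded_integral_fin _ _ _ _ _ (M * (moment_cst 1 * s))).
  apply: measurable_funM; first exact: measurableT_comp.
  by apply: measurable_funM => //; apply: measurable_funX; exact: measurable_funB.
move=> w; rewrite expr1 mulr_ge0 ?mulr_ge0 ?moment_cst_ge0 ?subr_ge0//=.
have [->|B0] := eqVneq (B w) 0.
  by rewrite normr0 mul0r !mulr_ge0 ?moment_cst_ge0// (le_trans _ (BM w)).
apply: ler_pM; rewrite ?mulr_ge0 ?moment_cst_ge0 ?subr_ge0//.
rewrite ler_wpM2l ?moment_cst_ge0// lerBlDr (le_trans (Bs w B0))// lerDl//.
Qed.

Lemma increment_mean0 (B : T -> R) (M : R) : 0 <= s ->
  measurable_wrt (stopped_sets Ft tau) B -> (forall w, `|B w| <= M) ->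
  (forall w, B w != 0 -> sigma w <= s) ->
  (\int[P]_w (B w * D w)%:E = 0)%E.
Proof.
move=> s0 mB BM Bs.
have pos (B' : T -> R) (M' : R) : measurable_wrt (stopped_sets Ft tau) B' ->
    (forall w, 0 <= B' w <= M') -> (forall w, B' w != 0 -> sigma w <= s) ->
    (\int[P]_w (B' w * D w)%:E = 0)%E.
  move=> mB' B'M B's; have B'0 w : 0 <= B' w by have /andP[] := B'M w.
  have intB : P.-integrable setT (fun w => (B' w * D w)%:E).
    by apply: (increment_integrable s0 mB' _ B's (M := M')) => w; rewrite ger0_norm//; have /andP[] := B'M w.
  rewrite integralE.
  have -> : (\int[P]_w (fun w => (B' w * D w)%:E)^\+ w = \int[P]_w (B' w * Num.max (1 * D w) 0)%:E)%E.
    apply: eq_integral => w _; rewrite funeposE mul1r -EFin_max; congr EFin.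
    by rewrite maxr_pMr// mulr0.
  have -> : (\int[P]_w (fun w => (B' w * D w)%:E)^\- w = \int[P]_w (B' w * Num.max (- (1 * D w)) 0)%:E)%E.
    apply: eq_integral => w _; rewrite funenegE mul1r -EFinN -EFin_max; congr EFin.
    by rewrite -mulrN maxr_pMr// mulr0.
  have h1 := half_mean s0 mB' B'M B's (normr1 _).
  have h2 := half_mean s0 mB' B'M B's (normrN1 _).
  have -> : (\int[P]_w (B' w * Num.max (- (1 * D w)) 0)%:E =
      \int[P]_w (B' w * Num.max (1 * D w) 0)%:E)%E.
    apply/eqP; rewrite eq_le h1 andbT; move: h2.
    under eq_integral do rewrite mulN1r.
    under [X in (_ <= X)%E -> _]eq_integral do rewrite mulN1r opprK.
    under [X in _ -> (X <= _)%E]eq_integral do rewrite mul1r.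
    by under [X in _ -> (_ <= X)%E]eq_integral do rewrite mul1r.
  rewrite subee//; have := integrable_pos_fin_num measurableT intB.
  congr (_ \is a fin_num).
  apply: eq_integral => w _; rewrite funeposE mul1r -EFin_max; congr EFin.
  by rewrite maxr_pMr// mulr0.
(* A signed [B] is the difference of [B + B0] and [B0], both nonnegative. [B0] equals [M] only where
   [B] is nonzero, so that the support condition is preserved. *)
pose B0 w : R := M * (B w != 0)%:R.
have M0 : 0 <= M by apply: le_trans (BM point).
have mB0 : measurable_wrt (stopped_sets Ft tau) B0.
  apply: measurable_funM => //.
  rewrite (_ : (fun _ => _) = (\1_(~` [set 0]) : R -> R) \o B); last first.
    apply/funext => w; rewrite /= indicE; congr (nat_of_bool _)%:R.
    by apply/idP/idP => [/eqP|]; rewrite inE => // /eqP.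
  apply: measurableT_comp => //; apply: measurable_indic; exact: measurableC.
have B00 w : B0 w != 0 -> sigma w <= s.
  by rewrite /B0; have [|/Bs] := eqVneq (B w) 0; rewrite ?mulr0 ?eqxx.
have BB0 w : 0 <= B w + B0 w <= M + M.
  rewrite /B0; have [->|_] := eqVneq (B w) 0.
    by rewrite mulr0 addr0 lexx addr_ge0.
  have := BM w; rewrite ler_norml mulr1 => /andP[b1 b2].
  by rewrite lerD2r b2 andbT -lerBlDr sub0r.
have B0M w : 0 <= B0 w <= M.
  by rewrite /B0; case: (B w != 0); rewrite ?mulr1 ?mulr0 ?lexx ?M0.
have BB0s w : B w + B0 w != 0 -> sigma w <= s.
  by rewrite /B0; have [->|/Bs] := eqVneq (B w) 0; rewrite ?mulr0 ?addr0 ?eqxx.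
have absM (B' : T -> R) M' w : 0 <= B' w <= M' -> `|B' w| <= M'.
  by move=> /andP[? ?]; rewrite ger0_norm.
have i1 := increment_integrable s0 (measurable_funD mB mB0) (fun w => absM _ _ _ (BB0 w)) BB0s.
have i2 := increment_integrable s0 mB0 (fun w => absM _ _ _ (B0M w)) B00.
transitivity (\int[P]_w (((B w + B0 w) * D w)%:E - (B0 w * D w)%:E))%E.
  by apply: eq_integral => w _; rewrite -EFinB -mulrBl addrK.
rewrite integralB// (pos _ _ (measurable_funD mB mB0) BB0 BB0s) (pos _ _ mB0 B0M B00).
by rewrite sube0.
Qed.
End increments.

(** * Moments of the scheme at its grid times *)

Section dissipative_recursion.
Context {R : realType}.

(* Scalar form of the Lyapunov estimate: [v = |x|^2], [u = |x + h f(x)|^2]. *)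
Lemma dissipative_power (k : nat) (alpha beta H Cm : R) :
  0 < alpha -> 0 < beta -> 0 < H -> 0 <= Cm ->
  exists2 C : R, 0 <= C & forall u v h, 0 <= u -> 0 <= v -> 0 <= h <= H ->
    u <= v + 2 * h * (- alpha * v + beta) ->
    u ^+ k.+1 + Cm * (u ^+ k * h + h ^+ k.+1) <=
      (1 - alpha / 2 * h) * v ^+ k.+1 + C * h.
Proof.
move=> a0 b0 H0 Cm0.
(* For [v >= V] the constant [beta] costs at most half of the dissipation and
   [u <= (1 - alpha h) v]; for [v < V] one has [u <= W]. [eta] is chosen so that Young's inequality
   turns the [u^k] term into at most [alpha / 2 * h * u^(k+1)]. *)
pose V := 2 * beta / alpha.
have V0 : 0 < V by rewrite divr_gt0// mulr_gt0.
pose W := V + 2 * beta * H.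
have W0 : 0 < W by rewrite addr_gt0// !mulr_gt0.
pose eta := alpha / 2 / (Cm + 1).
have Cm1 : 0 < Cm + 1 by lra.
have e0 : 0 < eta by rewrite !divr_gt0.
pose C1 := Cm * (eta ^- k + H ^+ k).
have C10 : 0 <= C1.
  by rewrite /C1; nonneg.
have Cme : Cm * eta <= alpha / 2.
  rewrite /eta mulrA ler_pdivrMr// mulrC ler_pM2l ?divr_gt0//; lra.
pose C2 := k.+1%:R * (2 * beta) * W ^+ k + (alpha / 2) * W ^+ k.+1
    + alpha / 2 * V ^+ k.+1.
have C20 : 0 <= C2.
  by rewrite /C2; nonneg.
exists (C1 + C2); first by rewrite addr_ge0.
move=> u v h u0 v0 /andP[h0 hH] uv.
have uk0 : 0 <= u ^+ k.+1 by exact: exprn_ge0.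
have young : Cm * (u ^+ k * h + h ^+ k.+1) <= alpha / 2 * h * u ^+ k.+1 + C1 * h.
  have y1 : u ^+ k * 1 <= eta * u ^+ k.+1 + eta ^- k * 1 ^+ k.+1 by exact: young_pow.
  rewrite mulr1 expr1n mulr1 in y1.
  have hk : h ^+ k <= H ^+ k by apply: lerXn2r; rewrite ?nnegrE ?(le_trans h0).
  have y2 : u ^+ k + h ^+ k <= eta * u ^+ k.+1 + (eta ^- k + H ^+ k) by lra.
  have -> : Cm * (u ^+ k * h + h ^+ k.+1) = h * (Cm * (u ^+ k + h ^+ k)) by rewrite exprS; ring.
  have -> : alpha / 2 * h * u ^+ k.+1 + C1 * h = h * (alpha / 2 * u ^+ k.+1 + C1) by ring.
  apply: ler_wpM2l => //; apply: le_trans (ler_wpM2l Cm0 y2) _.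
  by rewrite mulrDr /C1 lerD2r mulrA; apply: ler_wpM2r.
(* The [alpha / 2] on the left pays for the Young term. For large [v] it is available because [(1 -
   alpha h) (1 + alpha h / 2) <= 1 - alpha h / 2]. *)
suff main : u ^+ k.+1 * (1 + alpha / 2 * h) <= (1 - alpha / 2 * h) * v ^+ k.+1 + C2 * h.
  apply: le_trans (lerD (lexx _) young) _; rewrite mulrDl; move: main; lra.
have vk0 : 0 <= v ^+ k.+1 by exact: exprn_ge0.
have [vV|vV] := ltP v V; last first.
  have vpos : 0 < v by exact: lt_le_trans V0 vV.
  have bv : 2 * beta <= alpha * v by move: vV; rewrite /V ler_pdivrMr// [v * _]mulrC.
  have uv' : u <= (1 - alpha * h) * v by nra.
  have ah1 : 0 <= 1 - alpha * h by rewrite -(pmulr_lge0 _ vpos) (le_trans u0).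
  have ukv : u ^+ k.+1 <= (1 - alpha * h) * v ^+ k.+1.
    apply: (@le_trans _ _ (((1 - alpha * h) * v) ^+ k.+1)).
      by apply: lerXn2r => //; rewrite nnegrE mulr_ge0.
    rewrite exprMn ler_wpM2r// exprS ler_piMr// exprn_ile1//.
    by rewrite lerBlDr lerDl mulr_ge0// ltW.
  have C2h : 0 <= C2 * h by rewrite mulr_ge0.
  apply: (@le_trans _ _ ((1 - alpha * h) * v ^+ k.+1 * (1 + alpha / 2 * h))).
    by rewrite ler_wpM2r// addr_ge0// mulr_ge0// divr_ge0// ltW.
  have : (1 - alpha * h) * v ^+ k.+1 * (1 + alpha / 2 * h) <= (1 - alpha / 2 * h) * v ^+ k.+1.
    rewrite mulrAC; apply: ler_wpM2r => //; have : 0 <= alpha * h by rewrite mulr_ge0// ltW.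
    nra.
  lra.
have bh0 : 0 <= 2 * beta * h by rewrite !mulr_ge0// ltW.
have uvb : u <= v + 2 * beta * h.
  have avh : 0 <= alpha * v * h by nonneg.
  nra.
have vbW : v + 2 * beta * h <= W.
  apply: lerD; first exact: ltW.
  by apply: ler_wpM2l => //; rewrite mulr_ge0// ltW.
have uW : u <= W := le_trans uvb vbW.
have p1 : u ^+ k.+1 <= v ^+ k.+1 + k.+1%:R * (2 * beta) * W ^+ k * h.
  apply: (@le_trans _ _ ((v + 2 * beta * h) ^+ k.+1)).
    by apply: lerXn2r; rewrite ?nnegrE ?addr_ge0.
  apply: le_trans (powD_le_linear k v0 bh0) _; rewrite lerD2l.
  have -> : k.+1%:R * (2 * beta) * W ^+ k * h = k.+1%:R * (2 * beta * h) * W ^+ k by ring.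
  apply: ler_wpM2l; first by rewrite mulr_ge0.
  by apply: lerXn2r => //; rewrite nnegrE; nonneg.
have p2 : u ^+ k.+1 <= W ^+ k.+1 by apply: lerXn2r => //; rewrite nnegrE; nonneg.
have p3 : v ^+ k.+1 <= V ^+ k.+1 by apply: lerXn2r; rewrite ?nnegrE; nonneg.
have ah0 : 0 <= alpha / 2 * h by rewrite mulr_ge0// divr_ge0// ltW.
have q2 := ler_wpM2l ah0 p2; have q3 := ler_wpM2l ah0 p3.
rewrite /C2; move: p1 q2 q3.
set A := k.+1%:R * (2 * beta) * W ^+ k; set WK := W ^+ k.+1; set VK := V ^+ k.+1.
set UK := u ^+ k.+1; set vK := v ^+ k.+1; nra.
Qed.

(** A discrete integrating factor: [(1 - kap h) exp (kap h) <= 1] takes care of the old value, and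
    the source [C h] is dominated by an increment of [exp (kap t)], which telescopes even along a
    random grid. *)
Lemma expR_weight_step (kap C H t h y : R) : 0 < kap -> 0 <= C -> 0 <= h <= H -> 0 <= y ->
  expR (kap * (t + h)) * ((1 - kap * h) * y + C * h) <=
  expR (kap * t) * y + C * expR (kap * H) / kap * (expR (kap * (t + h)) - expR (kap * t)).
Proof.
move=> k0 C0 /andP[h0 hH] y0; rewrite [kap * (t + h)]mulrDr expRD; set E := expR (kap * t).
have E0 : 0 < E by exact: expR_gt0.
set e := expR (kap * h); have e0 : 0 < e by exact: expR_gt0.
have e1 : 1 + kap * h <= e by exact: expR_ge1Dx.
have em1 : (1 - kap * h) * e <= 1.
  have : 1 - kap * h <= e^-1 by rewrite -expRN -mulrN; exact: expR_ge1Dx.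
  by move=> /(ler_wpM2r (ltW e0)); rewrite mulVf ?gt_eqF.
have eH : e <= expR (kap * H) by rewrite ler_expR ler_pM2l.
have -> : E * e * ((1 - kap * h) * y + C * h) =
    E * (((1 - kap * h) * e) * y) + E * (C * (e * h)) by ring.
have -> : C * expR (kap * H) / kap * (E * e - E) =
   E * (C * (expR (kap * H) / kap * (e - 1))) by field; rewrite gt_eqF.
apply: lerD; first by rewrite ler_pM2l// ler_piMl.
rewrite ler_pM2l// ler_wpM2l//.
apply: (@le_trans _ _ (expR (kap * H) * h)); first by rewrite ler_wpM2r.
rewrite -mulrA ler_pM2l ?expR_gt0// ler_pdivlMl//; lra.
Qed.

End dissipative_recursion.

(* Time ranges over all of [R], so that paths are continuous functions on [R];
   only increments after time [0] have a prescribed law. *)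
Record extended_brownian {R : realType} d (T : measurableType d)
    (P : probability T R) (m : nat) (Ft : R -> set (set T))
    (W : R -> T -> 'rV[R]_m) : Prop := {
  eb_sigma : forall t, sigma_algebra setT (Ft t) ;
  eb_measurable : forall t, Ft t `<=` measurable ;
  eb_nondecreasing : forall s t, s <= t -> Ft s `<=` Ft t ;
  eb_adapted : forall i t, measurable_wrt (Ft t) (fun w => W t w ord0 i) ;
  eb_continuous : forall i w, continuous (fun t => W t w ord0 i) ;
  eb_increment : forall i (s t : R), 0 <= s -> s < t ->
    forall (A : set T) (V : set R), Ft s A -> measurable V ->
    (P (A `&` [set w | V (W t w ord0 i - W s w ord0 i)%R]) =
     P A * normal_prob 0 (Num.sqrt (t - s)) V)%E }.

(** * Grid times as stopping times *)

Section chain.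
Context {R : realType} d (T : measurableType d) (P : probability T R) {m : nat}.
Variables (Ft : R -> set (set T)) (W : R -> T -> 'rV[R]_m).
Hypothesis bm : extended_brownian P Ft W.
Variables (f : 'rV[R]_m -> 'rV[R]_m) (hd : 'rV[R]_m -> R) (x0 : 'rV[R]_m).
Hypothesis fc : continuous f.
Hypothesis hd_gt0 : forall x, 0 < hd x.
Hypothesis mhd : measurable_fun [set: borelV R m] (hd : borelV R m -> R).

Let FtS := eb_sigma bm.
Let FtM := @eb_measurable _ _ _ _ _ _ _ bm.
Let Ftle := @eb_nondecreasing _ _ _ _ _ _ _ bm.
Let Wa := @eb_adapted _ _ _ _ _ _ _ bm.
Let Wc := @eb_continuous _ _ _ _ _ _ _ bm.

Local Notation tn n w := (em_time f hd x0 (W ^~ w) n).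
Local Notation xn n w := (em_value f hd x0 (W ^~ w) n).

Lemma em_timeS (b : R -> 'rV[R]_m) n :
  em_time f hd x0 b n.+1 = em_time f hd x0 b n + hd (em_value f hd x0 b n).
Proof. by rewrite /em_time /em_value /=; case: (em _ _ _ _ n). Qed.

Lemma em_valueS (b : R -> 'rV[R]_m) n : em_value f hd x0 b n.+1 =
  em_value f hd x0 b n + hd (em_value f hd x0 b n) *: f (em_value f hd x0 b n)
  + (b (em_time f hd x0 b n.+1) - b (em_time f hd x0 b n)).
Proof. by rewrite em_timeS /em_time /em_value /=; case: (em _ _ _ _ n). Qed.

Lemma em_time_lt (b : R -> 'rV[R]_m) n :
  em_time f hd x0 b n < em_time f hd x0 b n.+1.
Proof. by rewrite em_timeS ltrDl hd_gt0. Qed.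

Lemma em_time_nd (b : R -> 'rV[R]_m) n k : (n <= k)%N ->
  em_time f hd x0 b n <= em_time f hd x0 b k.
Proof.
move=> /subnK <-; elim: (k - n)%N => [//|j IH]; rewrite addSn.
exact: le_trans IH (ltW (em_time_lt _ _)).
Qed.

Lemma em_time_ge0 (b : R -> 'rV[R]_m) n : 0 <= em_time f hd x0 b n.
Proof. exact: (@em_time_nd b 0 n). Qed.

(** The step is a function of the state, so [t_{n+1}] is known at [t_n] (third clause). By
    [stopping_ge] it is again a stopping time, and continuity of the paths makes the noise at both
    grid times measurable for its past. The three clauses feed each other in the induction. *)
Lemma chain_measurable n :
  [/\ stopping Ft (fun w => tn n w),
      measurable_wrt (stopped_sets Ft (fun w => tn n w)) (fun w => xn n w : borelV R m) &
      measurable_wrt (stopped_sets Ft (fun w => tn n w)) (fun w => tn n.+1 w)].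
Proof.
have next k : stopping Ft (fun w => tn k w) ->
    measurable_wrt (stopped_sets Ft (fun w => tn k w)) (fun w => xn k w : borelV R m) ->
    measurable_wrt (stopped_sets Ft (fun w => tn k w)) (fun w => tn k.+1 w).
  move=> st mx; have -> : (fun w => tn k.+1 w) = (fun w => tn k w + hd (xn k w)).
    by apply/funext => w; rewrite em_timeS.
  apply: measurable_funD; first exact: (stopping_measurable_wrt FtS (@Ftle) st).
  exact: (measurableT_comp mhd mx).
suff [st mx] : stopping Ft (fun w => tn n w) /\
   measurable_wrt (stopped_sets Ft (fun w => tn n w)) (fun w => xn n w : borelV R m).
  by split => //; exact: next.
elim: n => [|n [st mx]].
  split; last exact: measurable_cst.
  move=> s; have [s0|s0] := boolP (0 <= s).
    rewrite (_ : mkset _ = setT); last by apply/seteqP; split => // w _ /=; exact: s0.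
    by have [F0 FD _] := FtS s; rewrite -[setT]setD0; exact: FD.
  rewrite (_ : mkset _ = set0); first by have [] := FtS s.
  by apply/seteqP; split => // w /= ws; move: s0; rewrite (_ : 0 <= s).
have mt := next n st mx.
have tle w : tn n w <= tn n.+1 w by exact/ltW/em_time_lt.
have st' : stopping Ft (fun w => tn n.+1 w) := stopping_ge FtS st tle mt.
split => //.
have sub := stopped_sets_le FtS st' tle.
have -> : (fun w => xn n.+1 w) = (fun w => xn n w + hd (xn n w) *: f (xn n w)
  + (W (tn n.+1 w) w - W (tn n w) w)) by apply/funext => w; rewrite em_valueS.
apply: measurable_addv.
  apply: (measurable_wrt_sub sub); apply: measurable_addv => //.
  apply: measurable_scalev; last exact: measurable_compv.
  exact: (measurableT_comp mhd mx).
apply: measurable_subv; apply/measurable_fun_coordP => i.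
  exact: (stopped_process_measurable FtS (@Ftle) (@Wa i) (@Wc i) st').
apply: (measurable_wrt_sub sub).
exact: (stopped_process_measurable FtS (@Ftle) (@Wa i) (@Wc i) st).
Qed.

Lemma chain_stopping n : stopping Ft (fun w => tn n w).
Proof. by have [] := chain_measurable n. Qed.

Lemma chain_value_measurable_wrt n :
  measurable_wrt (stopped_sets Ft (fun w => tn n w)) (fun w => xn n w : borelV R m).
Proof. by have [] := chain_measurable n. Qed.

Lemma chain_time_measurable_wrt n :
  measurable_wrt (stopped_sets Ft (fun w => tn n w)) (fun w => tn n w).
Proof. exact: (stopping_measurable_wrt FtS (@Ftle) (chain_stopping n)). Qed.

Lemma chain_next_measurable_wrt n :
  measurable_wrt (stopped_sets Ft (fun w => tn n w)) (fun w => tn n.+1 w).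
Proof. by have [] := chain_measurable n. Qed.

Lemma chain_measurable_fun d' (T' : measurableType d') n (g : T -> T') :
  measurable_wrt (stopped_sets Ft (fun w => tn n w)) g -> measurable_fun setT g.
Proof.
exact: (measurable_wrt_measurable (stopped_sets_measurable (@FtM) (chain_stopping n))).
Qed.

Lemma chain_value_measurable n : measurable_fun setT (fun w => xn n w : borelV R m).
Proof. exact: chain_measurable_fun (@chain_value_measurable_wrt n). Qed.

Lemma chain_time_measurable n : measurable_fun setT (fun w => tn n w).
Proof. exact: chain_measurable_fun (@chain_time_measurable_wrt n). Qed.

End chain.

(** * Expectations of nonnegative functions *)

Section expectation_tools.
Context {R : realType} d (T : measurableType d) (P : {measure set T -> \bar R}).
Implicit Types f g U V : T -> R.

Lemma measurable_leb f (c : R) : measurable_fun setT f ->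
  measurable_fun setT (fun w => (f w <= c)%R%:R : R).
Proof.
move=> mf; rewrite (_ : (fun _ => _) = (\1_[set` `]-oo, c]%R] : R -> R) \o f).
  by apply: measurableT_comp => //; apply: measurable_indic; exact: measurable_itv.
apply/funext => w /=; rewrite indicE; congr (nat_of_bool _)%:R.
by apply/idP/idP; rewrite ?inE /= in_itv/=.
Qed.

Lemma le_expectation f g : measurable_fun setT f -> measurable_fun setT g ->
  (forall w, 0 <= f w) -> (forall w, f w <= g w) ->
  (\int[P]_w (f w)%:E <= \int[P]_w (g w)%:E)%E.
Proof.
move=> mf mg f0 fg; apply: ge0_le_integral => //.
- by move=> w _; rewrite lee_fin.
- exact: measurable_EFin_comp.
- exact: measurable_EFin_comp.
- by move=> w _; rewrite lee_fin.
Qed.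

Lemma expectationD f g : measurable_fun setT f -> measurable_fun setT g ->
  (forall w, 0 <= f w) -> (forall w, 0 <= g w) ->
  (\int[P]_w (f w + g w)%:E = \int[P]_w (f w)%:E + \int[P]_w (g w)%:E)%E.
Proof.
move=> mf mg f0 g0; under eq_integral do rewrite EFinD.
rewrite ge0_integralD//.
- by move=> w _; rewrite lee_fin.
- exact: measurable_EFin_comp.
- by move=> w _; rewrite lee_fin.
- exact: measurable_EFin_comp.
Qed.

Lemma expectationZ (c : R) f : measurable_fun setT f -> (forall w, 0 <= f w) ->
  0 <= c -> (\int[P]_w (c * f w)%:E = c%:E * \int[P]_w (f w)%:E)%E.
Proof.
move=> mf f0 c0; under eq_integral do rewrite EFinM.
rewrite ge0_integralZl//.
- exact: measurable_EFin_comp.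
- by move=> w _; rewrite lee_fin.
Qed.

Lemma expectation_ge0 f : (forall w, 0 <= f w) -> (0 <= \int[P]_w (f w)%:E)%E.
Proof. by move=> f0; apply: integral_ge0 => w _; rewrite lee_fin. Qed.

Lemma expectation_sum n (f : 'I_n -> T -> R) :
  (forall i, measurable_fun setT (f i)) -> (forall i w, 0 <= f i w) ->
  (\int[P]_w (\sum_i f i w)%:E = \sum_i \int[P]_w (f i w)%:E)%E.
Proof.
move=> mf f0; under eq_integral do rewrite -sumEFin.
rewrite ge0_integral_sum//.
- by move=> i; exact: measurable_EFin_comp.
- by move=> i w _; rewrite lee_fin.
Qed.

(** The positive and negative parts of [V] have equal finite integrals. They are added to the sides
    of [U] and [f], so that only nonnegative functions are compared and the integrals of [f] and [U]
    may be infinite. *)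
Lemma integral_le_mean0 f U V : measurable_fun setT f -> measurable_fun setT U ->
  (forall w, 0 <= f w) -> (forall w, 0 <= U w) ->
  P.-integrable setT (fun w => (V w)%:E) -> (\int[P]_w (V w)%:E = 0)%E ->
  (forall w, f w <= U w + V w) ->
  (\int[P]_w (f w)%:E <= \int[P]_w (U w)%:E)%E.
Proof.
move=> mf mU f0 U0 iV V0 fUV.
have mV : measurable_fun setT V by apply/measurable_EFinP; exact: measurable_int iV.
have mVp : measurable_fun setT (fun w => Num.max (V w) 0) by exact: measurable_maxr.
have mVn : measurable_fun setT (fun w => Num.max (- V w) 0).
  by apply: measurable_maxr => //; exact: measurableT_comp.
have p0 (x : R) : 0 <= Num.max x 0 by rewrite le_max lexx orbT.
have fp : (\int[P]_w (Num.max (V w) 0)%:E)%E \is a fin_num.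
  have := integrable_pos_fin_num measurableT iV; congr (_ \is a fin_num).
  by apply: eq_integral => w _; rewrite funeposE -EFin_max.
have E : (\int[P]_w (Num.max (V w) 0)%:E = \int[P]_w (Num.max (- V w) 0)%:E)%E.
  have fn : (\int[P]_w (Num.max (- V w) 0)%:E)%E \is a fin_num.
    have := integrable_neg_fin_num measurableT iV; congr (_ \is a fin_num).
    by apply: eq_integral => w _; rewrite funenegE -EFinN -EFin_max.
  have : (\int[P]_w (Num.max (V w) 0)%:E - \int[P]_w (Num.max (- V w) 0)%:E = 0)%E.
    rewrite -V0 [RHS]integralE; congr (_ - _)%E.
      by apply: eq_integral => w _; rewrite funeposE -EFin_max.
    by apply: eq_integral => w _; rewrite funenegE -EFinN -EFin_max.
  rewrite -(fineK fp) -(fineK fn) -EFinB => -[/eqP].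
  by rewrite subr_eq0 => /eqP ->.
rewrite -(@leeD2rE _ (\int[P]_w (Num.max (V w) 0)%:E))//.
rewrite [X in (_ + X <= _)%E]E -!expectationD//.
apply: le_expectation => //.
- exact: measurable_funD.
- exact: measurable_funD.
- by move=> w; rewrite addr_ge0.
move=> w; have := fUV w; rewrite !maxEle oppr_le0.
by case: ifPn; case: ifPn; lra.
Qed.

Lemma le_expectation_trunc f g (c : \bar R) : measurable_fun setT f ->
  measurable_fun setT g -> (forall w, 0 <= f w) ->
  (forall M : nat, \int[P]_w (f w * (g w <= M%:R)%R%:R)%:E <= c)%E ->
  (\int[P]_w (f w)%:E <= c)%E.
Proof.
move=> mf mg f0 fc.
have lim : (\int[P]_w (f w * (g w <= M%:R)%R%:R)%:E)%E @[M --> \oo] -->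
    (\int[P]_w (f w)%:E)%E.
  have -> : (\int[P]_w (f w)%:E)%E =
      (\int[P]_w (limn (fun M => (f w * (g w <= M%:R)%R%:R)%:E)))%E.
    apply: eq_integral => w _; apply/esym/cvg_lim => //.
    apply: cvg_near_cst; exists (Num.truncn (g w)).+1 => // M /= hM.
    have -> : g w <= M%:R; last by rewrite mulr1.
    by apply: le_trans (ltW (truncnS_gt _)) _; rewrite ler_nat.
  apply: cvg_monotone_convergence => //.
  - by move=> M; apply: measurable_EFin_comp; apply: measurable_funM => //; exact: measurable_leb.
  - by move=> M w _; rewrite lee_fin mulr_ge0.
  - move=> w _ M M' MM'; rewrite lee_fin ler_wpM2l// ler_nat.
    have [gM|//] := boolP (g w <= M%:R).
    by rewrite (le_trans gM)// ler_nat.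
rewrite -(cvg_lim _ lim)//; apply: lime_le; first by apply/cvg_ex; eexists; exact: lim.
exact: nearW.
Qed.

End expectation_tools.

Section normF_powers.
Context {R : realType} {m : nat}.

Lemma sum_pow_le n (y : 'I_m -> R) : (forall i, 0 <= y i) ->
  (\sum_i y i) ^+ n.+1 <= m%:R ^+ n.+1 * \sum_i y i ^+ n.+1.
Proof.
case: m y => [|m'] y y0; first by rewrite !big_ord0 expr0n mulr0.
have [j _ jmax] := @Order.TotalTheory.arg_maxP _ R _ ord0 xpredT y isT.
have yj : \sum_i y i <= m'.+1%:R * y j.
  apply: (@le_trans _ _ (\sum_(i < m'.+1) y j)); first by apply: ler_sum => i _; exact: jmax.
  by rewrite sumr_const card_ord mulr_natl.
apply: (@le_trans _ _ ((m'.+1%:R * y j) ^+ n.+1)).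
  by apply: lerXn2r => //; rewrite nnegrE; [exact: sumr_ge0|rewrite mulr_ge0].
rewrite exprMn ler_wpM2l ?exprn_ge0// (bigD1 j)//= lerDl.
by apply: sumr_ge0 => i _; rewrite exprn_ge0.
Qed.

(** [pow_taylor2] with [a = |phi|^2] and [y = 2 <phi, xi> + |xi|^2]. The part linear in [xi] is kept
    exactly, because it has mean zero for a Brownian increment; the remainder is written by
    coordinates, where one-dimensional moments apply. *)
Lemma normF_pow_taylor (k : nat) : exists2 C : R, 0 <= C &
  forall phi xi : 'rV[R]_m,
    normF (phi + xi) ^+ (2 * k.+1) <= (normF phi ^+ 2) ^+ k.+1
    + \sum_i (2 * k.+1%:R * (normF phi ^+ 2) ^+ k * phi ord0 i) * xi ord0 i
    + C * \sum_i ((normF phi ^+ 2) ^+ k * xi ord0 i ^+ 2 + xi ord0 i ^+ (2 * k.+1)).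
Proof.
have [C C0 HC] := @pow_taylor2 R k.
exists (k.+1%:R + C + C * m%:R ^+ k.+1); first by nonneg.
move=> phi xi; set a := normF phi ^+ 2; set b := normF xi ^+ 2.
have a0 : 0 <= a by exact: sqr_ge0.
have b0 : 0 <= b by exact: sqr_ge0.
pose y := 2 * dotv phi xi + b.
have ayE : normF (phi + xi) ^+ 2 = a + y.
  rewrite normF_sqr dotvDl !dotvDr -!normF_sqr (dotvC xi phi) /y /a /b; ring.
have dot2 : dotv phi xi ^+ 2 <= a * b.
  rewrite -exprMn -real_normK ?num_real//.
  by apply: lerXn2r; rewrite ?nnegrE ?mulr_ge0 ?normF_ge0// normr_dotv_le.
have := HC a b y a0 b0.
rewrite -ayE sqr_ge0 => /(_ isT).
have -> : y ^+ 2 <= 8 * a * b + 2 * b ^+ 2.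
  have := sqr_ge0 (2 * dotv phi xi - b).
  have -> : y ^+ 2 = 2 * (2 * dotv phi xi) ^+ 2 + 2 * b ^+ 2 - (2 * dotv phi xi - b) ^+ 2.
    by rewrite /y; ring.
  rewrite exprMn; lra.
have -> : y <= a + 2 * b.
  have := dotv_le phi xi; have := sqr_ge0 (normF phi - normF xi); rewrite /y /a /b; nra.
move=> /(_ isT isT) h; rewrite exprM; apply: (le_trans h).
have bE : b = \sum_i xi ord0 i ^+ 2.
  by rewrite /b normF_sqr; apply: eq_bigr => i _; rewrite expr2.
have bk : b ^+ k.+1 <= m%:R ^+ k.+1 * \sum_i xi ord0 i ^+ (2 * k.+1).
  rewrite bE; apply: le_trans (sum_pow_le _ (fun i => sqr_ge0 _)) _.
  by under eq_bigr do rewrite -exprM.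
have -> : \sum_i (a ^+ k * xi ord0 i ^+ 2 + xi ord0 i ^+ (2 * k.+1)) =
    a ^+ k * b + \sum_i xi ord0 i ^+ (2 * k.+1).
  by rewrite big_split/= -mulr_sumr bE.
have -> : \sum_i 2 * k.+1%:R * a ^+ k * phi ord0 i * xi ord0 i =
    k.+1%:R * a ^+ k * (2 * dotv phi xi).
  under eq_bigr do rewrite -mulrA; rewrite -mulr_sumr -/(dotv phi xi); ring.
set S := \sum_i xi ord0 i ^+ (2 * k.+1) in bk *.
have S0 : 0 <= S.
  by apply: sumr_ge0 => i _; rewrite exprM exprn_ge0// sqr_ge0.
have akb : 0 <= a ^+ k * b by nonneg.
have -> : k.+1%:R * a ^+ k * y = k.+1%:R * a ^+ k * (2 * dotv phi xi) + k.+1%:R * (a ^+ k * b).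
  by rewrite /y; ring.
rewrite -!addrA lerD2l lerD2l.
have Cb := ler_wpM2l C0 bk; rewrite mulrA in Cb.
have Cm : 0 <= C * m%:R ^+ k.+1 by nonneg.
have t1 : 0 <= k.+1%:R * S by nonneg.
have t2 : 0 <= C * S by nonneg.
have t3 : 0 <= C * m%:R ^+ k.+1 * (a ^+ k * b) by nonneg.
move: Cb t1 t2 t3; set X := C * m%:R ^+ k.+1.
set Y := a ^+ k * b; set B := b ^+ k.+1; lra.
Qed.

End normF_powers.

(** * One step of the moment recursion *)

Section moment_step.
Context {R : realType} d (T : measurableType d) (P : probability T R) {m : nat}.
Variables (Ft : R -> set (set T)) (W : R -> T -> 'rV[R]_m).
Hypothesis bm : extended_brownian P Ft W.
Variables (f : 'rV[R]_m -> 'rV[R]_m) (hd : 'rV[R]_m -> R) (x0 : 'rV[R]_m).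
Hypothesis fc : continuous f.
Hypothesis hd_gt0 : forall x, 0 < hd x.
Hypothesis mhd : measurable_fun [set: borelV R m] (hd : borelV R m -> R).
Local Notation tn n w := (em_time f hd x0 (W ^~ w) n).
Local Notation xn n w := (em_value f hd x0 (W ^~ w) n).
Let FtS := eb_sigma bm.
Let FtM := @eb_measurable _ _ _ _ _ _ _ bm.
Let Ftle := @eb_nondecreasing _ _ _ _ _ _ _ bm.
Let Wa := @eb_adapted _ _ _ _ _ _ _ bm.
Let Wc := @eb_continuous _ _ _ _ _ _ _ bm.
Let Wi := @eb_increment _ _ _ _ _ _ _ bm.
Let phi n w : 'rV[R]_m := xn n w + hd (xn n w) *: f (xn n w).
Let xi n w : 'rV[R]_m := W (tn n.+1 w) w - W (tn n w) w.
Let Gn n := stopped_sets Ft (fun w => tn n w).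

Let mxn n : measurable_wrt (Gn n) (fun w => xn n w : borelV R m).
Proof. exact: (@chain_value_measurable_wrt _ _ _ _ _ _ _ bm _ _ x0 fc hd_gt0 mhd n). Qed.

Let mphi n : measurable_wrt (Gn n) (fun w => phi n w : borelV R m).
Proof.
apply: measurable_addv; first exact: mxn.
apply: measurable_scalev; first exact: (measurableT_comp mhd (@mxn n)).
exact: (measurable_compv fc (@mxn n)).
Qed.

Let mT d' (T' : measurableType d') n (g : T -> T') :
  measurable_wrt (Gn n) g -> measurable_fun setT g.
Proof. exact: (chain_measurable_fun bm fc hd_gt0 mhd). Qed.

Let mxnT n : measurable_fun setT (fun w => xn n w : borelV R m).
Proof. exact: mT (@mxn n). Qed.

Let mtnT n : measurable_fun setT (fun w => tn n w).
Proof. exact: (chain_time_measurable bm x0 fc hd_gt0 mhd n). Qed.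

Let mxi n i : measurable_fun setT (fun w => W (tn n.+1 w) w ord0 i - W (tn n w) w ord0 i).
Proof.
apply: measurable_funB; apply: (measurable_evaluation (@FtM) (@Wa i) (@Wc i)); exact: mtnT.
Qed.

(** The discrete substitute for Ito's formula: the linear term of the Taylor bound integrates to
    zero and even powers of the increment become powers of the step. The bounds on the support of
    [B] make the coefficient of the linear term bounded, hence that term integrable. *)
Lemma chain_step_moment (k : nat) (C : R) : 0 <= C ->
  (forall phi xi : 'rV[R]_m,
    normF (phi + xi) ^+ (2 * k.+1) <= (normF phi ^+ 2) ^+ k.+1
    + \sum_i (2 * k.+1%:R * (normF phi ^+ 2) ^+ k * phi ord0 i) * xi ord0 i
    + C * \sum_i ((normF phi ^+ 2) ^+ k * xi ord0 i ^+ 2 + xi ord0 i ^+ (2 * k.+1))) ->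
  forall n s (B : T -> R) (M A : R), 0 <= s -> measurable_wrt (Gn n) B ->
    (forall w, 0 <= B w <= M) ->
    (forall w, B w != 0 -> tn n.+1 w <= s /\ normF (phi n w) ^+ 2 <= A) ->
  (\int[P]_w (B w * normF (xn n.+1 w) ^+ (2 * k.+1))%:E <=
   \int[P]_w (B w * ((normF (phi n w) ^+ 2) ^+ k.+1 +
      C * (m%:R * (moment_cst 1 + moment_cst k.+1)) *
      ((normF (phi n w) ^+ 2) ^+ k * hd (xn n w) + hd (xn n w) ^+ k.+1)))%:E)%E.
Proof.
move=> C0 HC.
move=> n s B M A s0 mB BM BA.
pose a w := normF (phi n w) ^+ 2.
pose ze i w := W (tn n.+1 w) w ord0 i - W (tn n w) w ord0 i.
have B0 w : 0 <= B w by have /andP[] := BM w.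
have a0 w : 0 <= a w by exact: sqr_ge0.
have ma : measurable_wrt (Gn n) a.
  by apply: measurable_funX; apply: measurable_normF; exact: mphi.
have Bs w : B w != 0 -> tn n.+1 w <= s by move=> /BA[].
have M0 : 0 <= M by have /andP[+ +] := BM point; exact: le_trans.
have tle w : tn n w <= tn n.+1 w by exact/ltW/em_time_lt.
have t0 w : 0 <= tn n w by exact: em_time_ge0.
have st := chain_stopping bm x0 fc hd_gt0 mhd n.
have mt1 := @chain_next_measurable_wrt _ _ _ _ _ _ _ bm _ _ x0 fc hd_gt0 mhd n.
have dt w : tn n.+1 w - tn n w = hd (xn n w) by rewrite em_timeS addrC addKr.
pose b i w : R := B w * (2 * k.+1%:R * a w ^+ k * phi n w ord0 i).
have mb i : measurable_wrt (Gn n) (b i).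
  apply: measurable_funM => //; apply: measurable_funM.
    by apply: measurable_funM => //; exact: measurable_funX.
  by apply: measurable_coord; exact: mphi.
have bs i w : b i w != 0 -> tn n.+1 w <= s.
  by rewrite /b mulf_eq0 negb_or => /andP[/Bs].
have bb i w : `|b i w| <= M * (2 * k.+1%:R * `|A| ^+ k * (1 + `|A|)).
  have [Bw0|Bw0] := eqVneq (B w) 0.
    by rewrite /b Bw0 mul0r normr0; nonneg.
  have aA : a w <= `|A| by apply: le_trans (ler_norm _); have [] := BA w Bw0.
  rewrite /b !normrM (ger0_norm (B0 w)) (ger0_norm (exprn_ge0 k (a0 w))).
  rewrite !(@ger0_norm _ _%:R)//.
  apply: ler_pM => //; [by nonneg|by have /andP[] := BM w|].
  apply: ler_pM => //; first by nonneg.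
    by apply: ler_wpM2l; [nonneg|apply: lerXn2r; rewrite ?nnegrE].
  apply: le_trans (coord_le_normF _ _) _.
  apply: le_trans (lerD (lexx _) aA); rewrite /a.
  have := sqr_ge0 (normF (phi n w) - 1); have := normF_ge0 (phi n w); nra.
have mzeT i : measurable_fun setT (ze i) := @mxi n i.
have maT := mT ma; have mBT := mT mB.
have mhT : measurable_fun setT (fun w => hd (xn n w)) by exact: (measurableT_comp mhd (@mxnT n)).
have h0 w : 0 <= hd (xn n w) by exact: ltW.
pose U w := B w * a w ^+ k.+1 + C * \sum_i (B w * a w ^+ k * ze i w ^+ (2 * 1) + B w * ze i w ^+ (2 * k.+1)).
have ze0 i w j : 0 <= ze i w ^+ (2 * j) by rewrite exprM exprn_ge0// sqr_ge0.
have mSi i : measurable_fun setT (fun w => B w * a w ^+ k * ze i w ^+ (2 * 1) + B w * ze i w ^+ (2 * k.+1)).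
  apply: measurable_funD; apply: measurable_funM => //; try exact: measurable_funX.
  by apply: measurable_funM => //; exact: measurable_funX.
have Ba0 w : 0 <= B w * a w ^+ k by rewrite mulr_ge0// exprn_ge0.
have Si0 i w : 0 <= B w * a w ^+ k * ze i w ^+ (2 * 1) + B w * ze i w ^+ (2 * k.+1).
  by apply: addr_ge0; apply: mulr_ge0.
have mBak : measurable_fun setT (fun w => B w * a w ^+ k.+1).
  by apply: measurable_funM => //; exact: measurable_funX.
have Bak0 w : 0 <= B w * a w ^+ k.+1 by rewrite mulr_ge0// exprn_ge0.
apply: (@le_trans _ _ (\int[P]_w (U w)%:E)%E).
  apply: (@integral_le_mean0 _ _ _ _ _ _ (fun w => \sum_i b i w * ze i w)).
  - apply: measurable_funM => //; apply: measurable_funX; exact: measurable_normF.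
  - apply: measurable_funD => //; apply: measurable_funM => //; exact: measurable_sum.
  - by move=> w; rewrite mulr_ge0// exprn_ge0// normF_ge0.
  - by move=> w; rewrite addr_ge0// mulr_ge0// sumr_ge0.
  - have := @integrable_sum _ _ _ P _ measurableT _ (index_enum 'I_m) xpredT (fun i w => (b i w * ze i w)%:E).
    under eq_fun do rewrite sumEFin; apply => i _.
    exact: (increment_integrable FtS (@FtM) (@Ftle) (@Wa i) (@Wc i) (@Wi i) t0 st tle mt1 s0 (mb i) (bb i) (bs i)).
  - under eq_integral do rewrite -sumEFin.
    rewrite integral_sum//; last first.
      move=> i.
      exact: (increment_integrable FtS (@FtM) (@Ftle) (@Wa i) (@Wc i) (@Wi i) t0 st tle mt1 s0 (mb i) (bb i) (bs i)).
    apply: big1 => i _.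
    exact: (increment_mean0 FtS (@FtM) (@Ftle) (@Wa i) (@Wc i) (@Wi i) t0 st tle mt1 s0 (mb i) (bb i) (bs i)).
  - move=> w; have -> : xn n.+1 w = phi n w + xi n w by rewrite em_valueS.
    apply: le_trans (ler_wpM2l (B0 w) (HC _ _)) _; rewrite le_eqVlt; apply/orP; left; apply/eqP.
    have xiE i : xi n w ord0 i = ze i w by rewrite /xi /ze !mxE.
    under eq_bigr do rewrite xiE; under [in X in B w * (_ + X)]eq_bigr do rewrite xiE.
    rewrite mulrDr mulrDr /U -/(a w) addrAC; congr (_ + _); first congr (_ + _).
      rewrite mulrCA; congr (_ * _); rewrite mulr_sumr; apply: eq_bigr => i _.
      by rewrite mulrDr mulrA.
    by rewrite mulr_sumr; apply: eq_bigr => i _; rewrite /b -!mulrA.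
pose c := moment_cst 1 + moment_cst k.+1 : R.
have c0 : 0 <= c by rewrite addr_ge0// moment_cst_ge0.
pose V w := a w ^+ k * hd (xn n w) + hd (xn n w) ^+ k.+1.
have V0 w : 0 <= V w by rewrite /V; nonneg.
have mV : measurable_fun setT V.
  apply: measurable_funD; last exact: measurable_funX.
  by apply: measurable_funM => //; exact: measurable_funX.
have mBV : measurable_fun setT (fun w => B w * V w) by exact: measurable_funM.
have BV0 w : 0 <= B w * V w by rewrite mulr_ge0.
have bound i : (\int[P]_w (B w * a w ^+ k * ze i w ^+ (2 * 1) + B w * ze i w ^+ (2 * k.+1))%:E <=
    c%:E * \int[P]_w (B w * V w)%:E)%E.
  have mBa : measurable_wrt (Gn n) (fun w => B w * a w ^+ k).
    by apply: measurable_funM => //; exact: measurable_funX.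
  have Ba w : 0 <= B w * a w ^+ k <= M * `|A| ^+ k.
    rewrite Ba0 /=.
    have [Bw0|Bw0] := eqVneq (B w) 0; first by rewrite Bw0 mul0r; nonneg.
    apply: ler_pM => //; [exact: exprn_ge0|by have /andP[] := BM w|].
    have aA : a w <= `|A| by apply: le_trans (ler_norm _); have [] := BA w Bw0.
    by apply: lerXn2r; rewrite ?nnegrE.
  have Bas w : B w * a w ^+ k != 0 -> tn n.+1 w <= s.
    by rewrite mulf_eq0 negb_or => /andP[/Bs].
  have mBaT : measurable_fun setT (fun w => B w * a w ^+ k).
    by apply: measurable_funM => //; exact: measurable_funX.
  rewrite expectationD; [|by apply: measurable_funM => //; exact: measurable_funX
    |by apply: measurable_funM => //; exact: measurable_funX
    |by move=> w; apply: mulr_ge0|by move=> w; apply: mulr_ge0].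
  have e1 := increment_moment_le FtS (@FtM) (@Ftle) (@Wa i) (@Wc i) (@Wi i) t0 st tle mt1
    (ltn0Sn 0) s0 mBa Ba Bas.
  have e2 := increment_moment_le FtS (@FtM) (@Ftle) (@Wa i) (@Wc i) (@Wi i) t0 st tle mt1
    (ltn0Sn k) s0 mB BM Bs.
  apply: le_trans (leeD e1 e2) _.
  have dtE j : (fun w => (tn n.+1 w - tn n w) ^+ j) = (fun w => hd (xn n w) ^+ j).
    by apply/funext => w; rewrite dt.
  have md j : measurable_fun setT (fun w => moment_cst j * (tn n.+1 w - tn n w) ^+ j).
    by apply: measurable_funM => //; rewrite dtE; exact: measurable_funX.
  have d0 j w : 0 <= moment_cst j * (tn n.+1 w - tn n w) ^+ j.
    by rewrite dt; apply: mulr_ge0; [exact: moment_cst_ge0|exact: exprn_ge0].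
  rewrite -expectationZ// -expectationD; [|exact: measurable_funM|exact: measurable_funM
    |by move=> w; apply: mulr_ge0|by move=> w; apply: mulr_ge0].
  apply: le_expectation.
  - by apply: measurable_funD; exact: measurable_funM.
  - by apply: measurable_funM.
  - by move=> w; apply: addr_ge0; apply: mulr_ge0.
  move=> w; rewrite dt expr1 /c /V.
  have m1 := @moment_cst_ge0 R 1; have m2 := @moment_cst_ge0 R k.+1.
  have q1 : 0 <= B w * hd (xn n w) ^+ k.+1 by rewrite mulr_ge0// exprn_ge0.
  have q2 : 0 <= B w * a w ^+ k * hd (xn n w) by rewrite !mulr_ge0// exprn_ge0.
  have -> : (moment_cst 1 + moment_cst k.+1) * (B w * (a w ^+ k * hd (xn n w) + hd (xn n w) ^+ k.+1))
   = B w * a w ^+ k * (moment_cst 1 * hd (xn n w)) + B w * (moment_cst k.+1 * hd (xn n w) ^+ k.+1)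
   + (moment_cst 1 * (B w * hd (xn n w) ^+ k.+1)
   + moment_cst k.+1 * (B w * a w ^+ k * hd (xn n w))) :> R by ring.
  by rewrite lerDl addr_ge0// mulr_ge0.
have mS : measurable_fun setT (fun w => \sum_i (B w * a w ^+ k * ze i w ^+ (2 * 1) + B w * ze i w ^+ (2 * k.+1))).
  exact: measurable_sum.
have S0 w : 0 <= \sum_i (B w * a w ^+ k * ze i w ^+ (2 * 1) + B w * ze i w ^+ (2 * k.+1)).
  exact: sumr_ge0.
rewrite expectationD; [|exact: mBak|exact: measurable_funM|exact: Bak0
  |by move=> w; exact: mulr_ge0].
rewrite expectationZ//.
rewrite expectation_sum//.
apply: (@le_trans _ _ (\int[P]_w (B w * a w ^+ k.+1)%:E +
    C%:E * \sum_(i < m) (c%:E * \int[P]_w (B w * V w)%:E))%E).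
  apply: leeD2l; apply: lee_wpmul2l; first by rewrite lee_fin.
  by apply: lee_sum => i _; exact: bound.
have -> : (\sum_(i < m) (c%:E * \int[P]_w (B w * V w)%:E) =
    (m%:R * c)%:E * \int[P]_w (B w * V w)%:E)%E.
  rewrite -ge0_sume_distrl; last by move=> i _; rewrite lee_fin.
  by rewrite sumEFin sumr_const card_ord mulr_natl.
rewrite muleA -EFinM -expectationZ//; last by nonneg.
rewrite -expectationD; [|exact: mBak|exact: measurable_funM|exact: Bak0
  |by move=> w; apply: mulr_ge0 => //; nonneg].
rewrite le_eqVlt; apply/orP; left; apply/eqP; apply: eq_integral => w _.
by congr EFin; rewrite [RHS]mulrDr; congr (_ + _); rewrite [RHS]mulrCA.
Qed.

End moment_step.

(** * The scheme at a fixed time *)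

Section em_index.
Context {R : realType} {m : nat}.
Variables (f : 'rV[R]_m -> 'rV[R]_m) (hd : 'rV[R]_m -> R) (x0 : 'rV[R]_m).
Hypothesis hd_gt0 : forall x, 0 < hd x.
Variable b : R -> 'rV[R]_m.
Local Notation tn := (em_time f hd x0 b).

Lemma em_time_le_index n k : (tn n < tn k) = (n < k)%N.
Proof.
have [kn|nk] := leqP k n; first by apply/negbTE; rewrite -leNgt; exact: em_time_nd.
exact: lt_le_trans (em_time_lt _ _ hd_gt0 _ _) (em_time_nd _ _ hd_gt0 _ nk).
Qed.

Lemma em_index_unique n s : tn n <= s < tn n.+1 -> em_index f hd x0 b s = n.
Proof.
move=> /andP[ns sn]; apply: xget_unique.
  split=> // k ks; rewrite leNgt em_time_le_index -leqNgt -ltnS -em_time_le_index.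
  exact: le_lt_trans sn.
move=> k [ks kmax]; apply/eqP; rewrite eqn_leq -[(k <= n)%N]ltnS -em_time_le_index.
by rewrite (le_lt_trans ks sn)/= leqNgt -em_time_le_index -leNgt kmax.
Qed.

Lemma em_indexP s : (exists k, s < tn k) -> 0 <= s ->
  let n := em_index f hd x0 b s in tn n <= s < tn n.+1.
Proof.
move=> sk s0 /=; case: (ex_minnP sk) => -[|n] sn nmin.
  by move: s0; rewrite leNgt; case/negP.
suff ns : tn n <= s by rewrite (@em_index_unique n) ns.
by rewrite leNgt; apply/negP => /nmin; rewrite ltnn.
Qed.

(** [n = 0] is excluded because [0] is also the default value of [em_index]: its preimage may
    contain times outside the first step. *)
Lemma em_index_preimage n s : (0 < n)%N ->
  em_index f hd x0 b s = n <-> tn n <= s < tn n.+1.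
Proof.
move=> n0; split; last exact: em_index_unique.
rewrite /em_index; case: xgetP => [k _ [ks kmax] <-|_ n0']; last by rewrite -n0' in n0.
rewrite ks ltNge; apply/negP => /kmax; apply/negP; rewrite -ltNge; exact: em_time_lt.
Qed.

End em_index.

(** * Summation of the weighted moments *)

Section chain_moments.
Context {R : realType} d (T : measurableType d) (P : probability T R) {m : nat}.
Variables (Ft : R -> set (set T)) (W : R -> T -> 'rV[R]_m).
Hypothesis bm : extended_brownian P Ft W.
Variables (f : 'rV[R]_m -> 'rV[R]_m) (x0 : 'rV[R]_m).
Hypothesis fc : continuous f.
Variables (alpha beta H : R).
Hypotheses (alpha_gt0 : 0 < alpha) (beta_gt0 : 0 < beta) (H_gt0 : 0 < H).

(** What the moment estimates use of a timestep function, with constants free of [delta].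
    [step_lower] forbids vanishing steps at bounded states, hence accumulation of the grid there;
    [step_dissipative] is the growth condition multiplied by [2 * hd x] and completed to a
    square. *)
Record step_function (hd : 'rV[R]_m -> R) : Prop := {
  step_gt0 : forall x, 0 < hd x ;
  step_measurable : measurable_fun [set: borelV R m] (hd : borelV R m -> R) ;
  step_le : forall x, hd x <= H ;
  step_lower : forall M : R, exists2 c : R, 0 < c & forall x, normF x <= M -> c <= hd x ;
  step_dissipative : forall x, normF (x + hd x *: f x) ^+ 2 <=
    normF x ^+ 2 + 2 * hd x * (- alpha * normF x ^+ 2 + beta) }.

Section fixed_step.
Variable hd : 'rV[R]_m -> R.
Hypothesis hdP : step_function hd.
Let hd_gt0 := step_gt0 hdP.
Let mhd := step_measurable hdP.
Local Notation tn n w := (em_time f hd x0 (W ^~ w) n).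
Local Notation xn n w := (em_value f hd x0 (W ^~ w) n).

Let mtn n : measurable_fun setT (fun w => tn n w).
Proof. exact: (chain_time_measurable bm x0 fc hd_gt0 mhd n). Qed.

Let mxn n : measurable_fun setT (fun w => xn n w : borelV R m).
Proof. exact: (chain_value_measurable bm x0 fc hd_gt0 mhd n). Qed.

Let before (s : R) n w : R := (tn n w <= s)%R%:R.

Let mbefore s n : measurable_fun setT (before s n).
Proof. exact: measurable_leb. Qed.

Let before0 s n w : 0 <= before s n w. Proof. by rewrite ler0n. Qed.

(** The indicator that [s] lies in step [n], as a real factor. It is determined at [t_n], and it
    vanishes for every [n] on a path whose grid never passes [s], so that sums over [n] are
    meaningful before non-explosion is known. *)
Definition at_index (s : R) n w : R := (tn n w <= s < tn n.+1 w)%R%:R.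

Lemma at_indexE s n w : at_index s n w = before s n w - before s n.+1 w.
Proof.
rewrite /at_index /before ltNge; have [sn|_] := boolP (tn n.+1 w <= s).
  by rewrite (le_trans _ sn) ?subrr// em_time_nd.
by rewrite andbT subr0.
Qed.

Lemma at_index_ge0 s n w : 0 <= at_index s n w. Proof. by rewrite ler0n. Qed.

Lemma measurable_at_index s n : measurable_fun setT (at_index s n).
Proof.
rewrite (_ : at_index s n = (fun w => before s n w - before s n.+1 w)).
  exact: measurable_funB.
by apply/funext => w; rewrite at_indexE.
Qed.

Section recursion.
Variables (k : nat) (C Cd : R).
Hypothesis C0 : 0 <= C.
Hypothesis HC : forall phi xi : 'rV[R]_m,
  normF (phi + xi) ^+ (2 * k.+1) <= (normF phi ^+ 2) ^+ k.+1
  + \sum_i (2 * k.+1%:R * (normF phi ^+ 2) ^+ k * phi ord0 i) * xi ord0 i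
  + C * \sum_i ((normF phi ^+ 2) ^+ k * xi ord0 i ^+ 2 + xi ord0 i ^+ (2 * k.+1)).
Let Cm := C * (m%:R * (moment_cst 1 + moment_cst k.+1)).
Hypothesis Cd0 : 0 <= Cd.
Hypothesis HCd : forall u v h, 0 <= u -> 0 <= v -> 0 <= h <= H ->
    u <= v + 2 * h * (- alpha * v + beta) ->
    u ^+ k.+1 + Cm * (u ^+ k * h + h ^+ k.+1) <=
      (1 - alpha / 2 * h) * v ^+ k.+1 + Cd * h.

Let kap := alpha / 2.
Let kap0 : 0 < kap. Proof. by rewrite divr_gt0. Qed.
Let C3 := Cd * expR (kap * H) / kap.
Let C30 : 0 <= C3. Proof. by rewrite /C3; nonneg. Qed.
Let V n w := normF (xn n w) ^+ (2 * k.+1).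
Let V0 n w : 0 <= V n w. Proof. exact/exprn_ge0/normF_ge0. Qed.
Let mV n : measurable_fun setT (V n).
Proof. by apply: measurable_funX; exact: measurable_normF. Qed.
Let e n w := expR (kap * tn n w).
Let e0 n w : 0 <= e n w. Proof. exact: expR_ge0. Qed.
Let me n : measurable_fun setT (e n).
Proof. by apply: measurableT_comp => //; exact: measurable_funM. Qed.
Let ele n w : e n w <= e n.+1 w.
Proof. by rewrite ler_expR ler_pM2l// em_time_nd. Qed.

(** Both the event [t_{n+1} <= s] and the weight at [t_{n+1}] are known at [t_n], hence admissible
    in the test function of [chain_step_moment]. A cut-off of [|x_n|] provides the bound on its
    support and is removed by monotone convergence. *)
Let one_step s n : 0 <= s ->
  (\int[P]_w (before s n.+1 w * (e n.+1 w * V n.+1 w))%:E <=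
   \int[P]_w (before s n.+1 w * (e n w * V n w) +
     C3 * (before s n.+1 w * (e n.+1 w - e n w)))%:E)%E.
Proof.
move=> s0.
have mnorm : measurable_fun setT (fun w => normF (xn n w)) by exact: measurable_normF.
have mr : measurable_fun setT (fun w => before s n.+1 w * (e n w * V n w) +
     C3 * (before s n.+1 w * (e n.+1 w - e n w))).
  apply: measurable_funD; first by apply: measurable_funM => //; exact: measurable_funM.
  apply: measurable_funM => //; apply: measurable_funM => //; exact: measurable_funB.
have r0 w : 0 <= before s n.+1 w * (e n w * V n w) +
     C3 * (before s n.+1 w * (e n.+1 w - e n w)).
  apply: addr_ge0; first by do 2 apply: mulr_ge0 => //.
  by apply: mulr_ge0 => //; apply: mulr_ge0 => //; rewrite subr_ge0.
apply: (@le_expectation_trunc _ _ _ _ _ (fun w => normF (xn n w))) => //.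
- by apply: measurable_funM => //; exact: measurable_funM.
- by move=> w; do 2 apply: mulr_ge0 => //.
move=> M.
pose B w := before s n.+1 w * e n.+1 w * (normF (xn n w) <= M%:R)%R%:R.
have B0 w : 0 <= B w by rewrite !mulr_ge0.
pose ph w := xn n w + hd (xn n w) *: f (xn n w).
have st := chain_stopping bm x0 fc hd_gt0 mhd n.
have mt1 := @chain_next_measurable_wrt _ _ _ _ _ _ _ bm _ _ x0 fc hd_gt0 mhd n.
have mx1 := @chain_value_measurable_wrt _ _ _ _ _ _ _ bm _ _ x0 fc hd_gt0 mhd n.
have mB : measurable_wrt (stopped_sets Ft (fun w => tn n w)) B.
  apply: measurable_funM; last by apply: measurable_leb; exact: measurable_normF.
  apply: measurable_funM; first exact: measurable_leb.
  by apply: measurableT_comp => //; exact: measurable_funM.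
have BM w : 0 <= B w <= expR (kap * s).
  rewrite B0 /B /before; case: (boolP (tn n.+1 w <= s)) => [ts|_]; last first.
    by rewrite !mul0r expR_ge0.
  rewrite mul1r; apply: (@le_trans _ _ (e n.+1 w)).
    by rewrite ler_piMr// lern1 leq_b1.
  by rewrite ler_expR ler_pM2l.
have BA w : B w != 0 -> tn n.+1 w <= s /\ normF (ph w) ^+ 2 <= M%:R ^+ 2 + 2 * H * beta.
  rewrite /B /before; case: (boolP (tn n.+1 w <= s)) => [ts|_]; last by rewrite !mul0r eqxx.
  case: (boolP (_ <= M%:R)) => [xM _|_]; last by rewrite mulr0 eqxx.
  split=> //; apply: le_trans (step_dissipative hdP _) _.
  have x2 : normF (xn n w) ^+ 2 <= M%:R ^+ 2.
    by apply: lerXn2r => //; rewrite nnegrE ?normF_ge0.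
  have h1 := step_le hdP (xn n w); have h2 := ltW (hd_gt0 (xn n w)).
  have a1 : 0 <= alpha * normF (xn n w) ^+ 2 * hd (xn n w).
    by apply: mulr_ge0 => //; apply: mulr_ge0; [exact: ltW|exact: sqr_ge0].
  have b1 : beta * hd (xn n w) <= beta * H by rewrite ler_pM2l.
  lra.
have := chain_step_moment bm fc hd_gt0 mhd C0 HC s0 mB BM BA.
rewrite -/Cm => h.
apply: (@le_trans _ _ (\int[P]_w (B w * V n.+1 w)%:E)%E).
  rewrite le_eqVlt; apply/orP; left; apply/eqP; apply: eq_integral => w _.
  by congr EFin; rewrite /B; ring.
apply: (le_trans h).
have mph : measurable_fun setT (fun w => ph w : borelV R m).
  apply: measurable_addv => //; apply: measurable_scalev; last exact: measurable_compv.
  exact: (measurableT_comp mhd (@mxn n)).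
have mhx : measurable_fun setT (fun w => hd (xn n w)) by exact: (measurableT_comp mhd (@mxn n)).
have ma : measurable_fun setT (fun w => normF (ph w) ^+ 2).
  by apply: measurable_funX; exact: measurable_normF.
have Cm0 : 0 <= Cm by rewrite !mulr_ge0// addr_ge0// moment_cst_ge0.
apply: le_expectation => //.
- apply: measurable_funM; first by apply: (chain_measurable_fun bm fc hd_gt0 mhd mB).
  apply: measurable_funD; first exact: measurable_funX.
  apply: measurable_funM => //; apply: measurable_funD; last exact: measurable_funX.
  by apply: measurable_funM => //; exact: measurable_funX.
- move=> w; apply: mulr_ge0 => //; have hx := ltW (hd_gt0 (xn n w)).
  have a0 : 0 <= normF (ph w) ^+ 2 by exact: sqr_ge0.
  by apply: addr_ge0; [exact: exprn_ge0|nonneg].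
move=> w.
have hx : 0 <= hd (xn n w) <= H by rewrite (ltW (hd_gt0 _)) (step_le hdP).
have key := HCd (sqr_ge0 (normF (ph w))) (sqr_ge0 (normF (xn n w))) hx (step_dissipative hdP _).
apply: le_trans (ler_wpM2l (B0 w) key) _.
have wt := @expR_weight_step _ kap Cd H (tn n w) (hd (xn n w)) (V n w) kap0 Cd0 hx (V0 n w).
rewrite -em_timeS -/(e n w) -/(e n.+1 w) -/C3 in wt.
have -> : B w * ((1 - alpha / 2 * hd (xn n w)) * normF (xn n w) ^+ 2 ^+ k.+1 + Cd * hd (xn n w)) =
  (normF (xn n w) <= M%:R)%R%:R * (before s n.+1 w * (e n.+1 w * ((1 - kap * hd (xn n w)) * V n w + Cd * hd (xn n w)))).
  by rewrite /B /V exprM /kap; ring.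
have wt' := ler_wpM2l (before0 s n.+1 w) wt; rewrite [leRHS]mulrDr in wt'.
move: wt'; have -> : before s n.+1 w * (C3 * (e n.+1 w - e n w)) = C3 * (before s n.+1 w * (e n.+1 w - e n w)) by ring.
move=> wt'; apply: le_trans (ler_wpM2l _ wt') _; first by rewrite ler0n.
by rewrite ler_piMl// lern1 leq_b1.
Qed.

(** A path with [t_n <= s] either reaches [t_{n+1}] by time [s] or has [s] in step [n]. The share of
    the second kind is set aside in the sum, the first is carried on by [one_step]; the total grows
    only by the telescoping sources. *)
Lemma chain_moment_sum s N : 0 <= s ->
  (\int[P]_w (before s N w * (e N w * V N w))%:E +
   \sum_(n < N) \int[P]_w (at_index s n w * (e n w * V n w))%:E <=
   (normF x0 ^+ (2 * k.+1) + C3 * expR (kap * s))%:E)%E.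
Proof.
move=> s0.
have meV j n : measurable_fun setT (fun w => before s j w * (e n w * V n w)).
  by apply: measurable_funM => //; exact: measurable_funM.
have eV0 j n w : 0 <= before s j w * (e n w * V n w).
  by do 2 apply: mulr_ge0 => //.
have meA n : measurable_fun setT (fun w => at_index s n w * (e n w * V n w)).
  by apply: measurable_funM; [exact: measurable_at_index|exact: measurable_funM].
have eA0 n w : 0 <= at_index s n w * (e n w * V n w).
  by apply: mulr_ge0; [exact: at_index_ge0|exact: mulr_ge0].
pose r n w := C3 * (before s n.+1 w * (e n.+1 w - e n w)).
have r0 n w : 0 <= r n w.
  by apply: mulr_ge0 => //; apply: mulr_ge0 => //; rewrite subr_ge0.
have mr n : measurable_fun setT (r n).
  by apply: measurable_funM => //; apply: measurable_funM => //; exact: measurable_funB.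
have step N' : (\int[P]_w (before s N' w * (e N' w * V N' w))%:E +
   \sum_(n < N') \int[P]_w (at_index s n w * (e n w * V n w))%:E <=
   \int[P]_w (normF x0 ^+ (2 * k.+1) + \sum_(n < N') r n w)%:E)%E.
  elim: N' => [|n IH].
    rewrite big_ord0 adde0; apply: le_expectation => //.
    - by apply: measurable_funD => //; exact: measurable_sum.
    - move=> w; rewrite big_ord0 addr0 /before /e /V /em_time /em_value/= s0 mul1r.
      by rewrite mulr0 expR0 mul1r.
  rewrite big_ord_recr/=.
  apply: (@le_trans _ _ ((\int[P]_w (before s n w * (e n w * V n w))%:E + \int[P]_w (r n w)%:E) +
     \sum_(i < n) \int[P]_w (at_index s i w * (e i w * V i w))%:E)%E).
    rewrite addeCA [leRHS]addeC; apply: leeD2l.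
    apply: (@le_trans _ _ (\int[P]_w (before s n.+1 w * (e n w * V n w))%:E + \int[P]_w (r n w)%:E +
      \int[P]_w (at_index s n w * (e n w * V n w))%:E)%E).
      by apply: leeD2r; rewrite -expectationD//; exact: one_step.
    rewrite addeAC; apply: leeD2r; rewrite -expectationD//.
    apply: le_expectation => //; first exact: measurable_funD.
      by move=> w; apply: addr_ge0.
    by move=> w; rewrite -mulrDl at_indexE addrC subrK.
  rewrite addeAC; apply: le_trans (leeD2r _ IH) _; rewrite -expectationD//.
  - apply: le_expectation => //.
    + by apply: measurable_funD => //; apply: measurable_funD => //; exact: measurable_sum.
    + by apply: measurable_funD => //; exact: measurable_sum.
    + by move=> w; rewrite !addr_ge0// ?exprn_ge0 ?normF_ge0// sumr_ge0.
    + by move=> w; rewrite big_ord_recr/= addrA.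
  - by apply: measurable_funD => //; exact: measurable_sum.
  - by move=> w; rewrite !addr_ge0// ?exprn_ge0 ?normF_ge0// sumr_ge0.
apply: le_trans (step N) _.
apply: (@le_trans _ _ (\int[P]_w (normF x0 ^+ (2 * k.+1) + C3 * expR (kap * s))%:E)%E).
  apply: le_expectation => //.
  - by apply: measurable_funD => //; exact: measurable_sum.
  - by move=> w; rewrite !addr_ge0// ?exprn_ge0 ?normF_ge0// sumr_ge0.
  move=> w; rewrite lerD2l -mulr_sumr ler_wpM2l//.
  (* Increments of the weight are counted only up to [s], so their sum is at most the weight at
     [min (t_N, s)]. *)
  suff : \sum_(i < N) before s i.+1 w * (e i.+1 w - e i w) <= expR (kap * Num.min (tn N w) s).
    by move=> /le_trans; apply; rewrite ler_expR ler_pM2l// ge_min lexx orbT.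
  elim: N => [|n IH]; first by rewrite big_ord0 expR_ge0.
  rewrite big_ord_recr/= /before; case: (boolP (tn n.+1 w <= s)) => [ts|].
    rewrite min_l// mul1r -/(e n.+1 w) -lerBrDr opprB addrC subrK.
    apply: le_trans IH _; rewrite /e ler_expR ler_pM2l// ge_min lexx//.
  rewrite -ltNge => /ltW ts; rewrite mul0r addr0 (min_r ts); apply: le_trans IH _.
  by rewrite ler_expR ler_pM2l// ge_min lexx orbT.
by rewrite integral_cst// [X in (_ * X)%E]probability_setT mule1.
Qed.

End recursion.
End fixed_step.
End chain_moments.

(** * Non-explosion and the random index *)

Section index.
Context {R : realType} d (T : measurableType d) (P : probability T R) {m : nat}.
Variables (Ft : R -> set (set T)) (W : R -> T -> 'rV[R]_m).
Hypothesis bm : extended_brownian P Ft W.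
Variables (f : 'rV[R]_m -> 'rV[R]_m) (x0 : 'rV[R]_m).
Hypothesis fc : continuous f.
Variables (alpha beta H : R).
Hypotheses (alpha_gt0 : 0 < alpha) (beta_gt0 : 0 < beta) (H_gt0 : 0 < H).

Section fixed_step.
Variable hd : 'rV[R]_m -> R.
Hypothesis hdP : step_function f alpha beta H hd.
Let hd_gt0 := step_gt0 hdP.
Let mhd := step_measurable hdP.
Local Notation tn n w := (em_time f hd x0 (W ^~ w) n).
Local Notation xn n w := (em_value f hd x0 (W ^~ w) n).
Local Notation idx s w := (em_index f hd x0 (W ^~ w) s).
Local Notation atx := (at_index W f x0 hd).

Let mtn n : measurable_fun setT (fun w => tn n w).
Proof. exact: (chain_time_measurable bm x0 fc hd_gt0 mhd n). Qed.

Let mxn n : measurable_fun setT (fun w => xn n w : borelV R m).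
Proof. exact: (chain_value_measurable bm x0 fc hd_gt0 mhd n). Qed.

(** Bounded grid times converge, so the steps tend to zero; by [step_lower] the state then leaves
    every ball. *)
Lemma explosion_value_cvg (b : R -> 'rV[R]_m) (s : R) :
  (forall n, em_time f hd x0 b n <= s) ->
  (normF (em_value f hd x0 b n) ^+ 2)%:E @[n --> \oo] --> +oo%E.
Proof.
move=> ts; pose t := em_time f hd x0 b.
have ct : cvgn t.
  apply: nondecreasing_is_cvgn; last by exists s => _ [n _ <-]; exact: ts.
  by move=> i j ij; exact: em_time_nd.
have ct0 : t n.+1 - t n @[n --> \oo] --> (0 : R).
  have ct1 : t n.+1 @[n --> \oo] --> limn t by rewrite (cvg_shiftS t).
  by rewrite -(subrr (limn t)); exact: (cvgB ct1 ct).
apply/cvgeryP/cvgryPge => A.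
have [c c0 hc] := step_lower hdP (Num.sqrt `|A|).
move/cvgrPdist_lt : ct0 => /(_ _ c0); apply: filterS => n.
rewrite sub0r normrN /t em_timeS addrC addKr ger0_norm; last exact: ltW.
move=> hdc; have [//|/ltW xA] := leP A (normF (em_value f hd x0 b n) ^+ 2).
suff /hc : normF (em_value f hd x0 b n) <= Num.sqrt `|A| by rewrite leNgt hdc.
rewrite -(@ler_pXn2r _ 2) ?nnegrE ?normF_ge0 ?sqrtr_ge0// [leRHS]sqr_sqrtr//.
by rewrite (le_trans xA)// ler_norm.
Qed.

(** Integer horizons [j] and the second moment ([k = 0]) suffice. If the grid stays below [j], the
    indicator in [g] is constantly one and [g] tends to infinity, whereas its lower limit is
    integrable and thus almost surely finite. *)
Lemma nonexplosion : {ae P, forall w, forall s : R, exists n, s < tn n w}.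
Proof.
suff key (j : nat) : {ae P, forall w, exists n, j%:R < tn n w}.
  have := ae_foralln key; apply: filterS => w hw s.
  have [n hn] := hw (Num.truncn s).+1; exists n; apply: lt_trans hn.
  exact: truncnS_gt.
have [C C0 HC] := @normF_pow_taylor R m 0.
have Cm0 : 0 <= C * (m%:R * (moment_cst 1 + moment_cst 1)).
  by rewrite !mulr_ge0// addr_ge0// moment_cst_ge0.
have [Cd Cd0 HCd] := dissipative_power 0 alpha_gt0 beta_gt0 H_gt0 Cm0.
have j0 : (0 : R) <= j%:R by [].
have bound N := chain_moment_sum bm x0 fc alpha_gt0 beta_gt0 hdP C0 HC Cd0 HCd N j0.
pose g n w : R := (tn n w <= j%:R)%R%:R * normF (xn n w) ^+ 2.
have g0 n w : 0 <= g n w by rewrite mulr_ge0// sqr_ge0.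
have mg n : measurable_fun setT (g n).
  apply: measurable_funM; first exact: measurable_leb.
  by apply: measurable_funX; exact: measurable_normF.
pose D := normF x0 ^+ (2 * 1) + Cd * expR (alpha / 2 * H) / (alpha / 2) * expR (alpha / 2 * j%:R).
have gD n : (\int[P]_w (g n w)%:E <= D%:E)%E.
  apply: le_trans (bound n); apply: (@le_trans _ _ (\int[P]_w ((tn n w <= j%:R)%R%:R *
     (expR (alpha / 2 * tn n w) * normF (xn n w) ^+ (2 * 1)))%:E)%E); last first.
    rewrite leeDl//; apply: sume_ge0 => i _; apply: expectation_ge0 => w.
    by rewrite mulr_ge0 ?at_index_ge0// mulr_ge0 ?expR_ge0// exprn_ge0// normF_ge0.
  apply: le_expectation => //.
    apply: measurable_funM; first exact: measurable_leb.
    apply: measurable_funM; last by apply: measurable_funX; exact: measurable_normF.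
    by apply: measurableT_comp => //; exact: measurable_funM.
  move=> w; rewrite /g ler_wpM2l// ler_peMl ?sqr_ge0//.
  rewrite -expR0 ler_expR mulr_ge0 ?em_time_ge0//.
  by rewrite divr_ge0// ltW.
have mgE n : measurable_fun setT (fun w => (g n w)%:E) by exact: measurable_EFin_comp.
have fat : (\int[P]_w limn_einf (fun n => (g n w)%:E) <= D%:E)%E.
  apply: le_trans (fatou P measurableT mgE _) _.
    by move=> n w _; rewrite lee_fin.
  have -> : D%:E = limn_einf (fun _ : nat => D%:E).
    by have [-> _] := cvg_limn_einf_sup (@cvg_cst _ D%:E nat \oo _).
  exact: limn_einf_le.
have lim0 w : (0 <= limn_einf (fun n => (g n w)%:E))%E.
  have -> : (0 = limn_einf (fun _ : nat => 0 : \bar R))%E.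
    by have [-> _] := cvg_limn_einf_sup (@cvg_cst _ (0 : \bar R)%E nat \oo _).
  by apply: limn_einf_le => n; rewrite lee_fin.
have ilim : P.-integrable setT (fun w => limn_einf (fun n => (g n w)%:E)).
  apply/integrableP; split.
    apply: (emeasurable_fun_cvg (fun n w => einfs (fun k => (g k w)%:E) n)).
      by move=> n; exact: (measurable_fun_einfs mgE n).
    by move=> w _; rewrite limn_einf_lim; exact: is_cvg_einfs.
  under eq_integral do rewrite gee0_abs//.
  by apply: le_lt_trans fat _; rewrite ltry.
have := integrable_ae measurableT ilim; apply: filterS => w /(_ I) fin.
apply: contrapT => /forallNP ex.
have ts n : tn n w <= j%:R by rewrite leNgt; apply/negP; exact: ex.
have := explosion_value_cvg ts.
have -> : (fun n => (normF (xn n w) ^+ 2)%:E) = (fun n => (g n w)%:E).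
  by apply/funext => n; rewrite /g ts mul1r.
by move/cvg_limn_einf_sup => [E _]; rewrite E in fin.
Qed.

Lemma measurable_fun_at_index d' (T' : measurableType d')
    (q : nat -> T * R -> T') : (forall n, measurable_fun setT (q n)) ->
  measurable_fun setT (fun z : T * R => q (idx z.2 z.1) z).
Proof.
move=> mq; apply: (@measurable_fun_index _ _ _ _ _ (fun z : T * R => idx z.2 z.1)) => //.
have mpos n : (0 < n)%N -> measurable ((fun z : T * R => idx z.2 z.1) @^-1` [set n]).
  move=> n0; have mt k : measurable_fun setT (fun z : T * R => z.2 - tn k z.1).
    by apply: measurable_funB => //; exact: (measurableT_comp (@mtn k)).
  have -> : (fun z : T * R => idx z.2 z.1) @^-1` [set n] =
      (fun z : T * R => z.2 - tn n z.1) @^-1` `[0, +oo[ `&`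
      (fun z : T * R => z.2 - tn n.+1 z.1) @^-1` `]-oo, 0[.
    apply/seteqP; split => z /=; rewrite !in_itv/= andbT subr_ge0 subr_lt0.
      by move/(em_index_preimage _ _ hd_gt0 _ _ n0)/andP.
    by move=> /andP; exact: em_index_unique.
  apply: measurableI; rewrite -[X in measurable X]setTI; apply: mt => //; exact: measurable_itv.
case=> [|n]; last exact: mpos.
(* Index [0] also collects the default cases, so its preimage is obtained as the complement of all
   others. *)
rewrite (_ : _ @^-1` _ = ~` \bigcup_n ((fun z : T * R => idx z.2 z.1) @^-1` [set n.+1])).
  by apply: measurableC; apply: bigcupT_measurable => n; exact: mpos.
apply/seteqP; split => [z /= z0 [n _ /=]|z zn /=]; first by rewrite z0.
by case E : (idx z.2 z.1) => [//|n]; exfalso; apply: zn; exists n.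
Qed.

Lemma measurable_fun_at_index1 d' (T' : measurableType d') s
    (q : nat -> T -> T') : (forall n, measurable_fun setT (q n)) ->
  measurable_fun setT (fun w => q (idx s w) w).
Proof.
move=> mq; have := @measurable_fun_at_index _ T' (fun n z => q n z.1).
have mp : measurable_fun setT (fun w : T => (w, s)).
  by apply: measurable_fun_pair => //; exact: measurable_cst.
move=> h; apply: (measurableT_comp (h _) mp) => n.
exact: (measurableT_comp (mq n)).
Qed.

Lemma at_index_eq s w n : 0 <= s -> (exists k, s < tn k w) ->
  atx s n w = (idx s w == n)%:R.
Proof.
move=> s0 sk; rewrite /at_index; congr (nat_of_bool _)%:R.
apply/idP/eqP => [/em_index_unique ->//|<-]; exact: em_indexP.
Qed.

(** Translates sums over deterministic [n] into the random index: almost surely the grid passes [s],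
    exactly one [at_index] is nonzero, and the partial sums increase to the value at the index. *)
Lemma index_expectation_le (q : nat -> T -> R) (s C : R) : 0 <= s ->
  (forall n, measurable_fun setT (q n)) -> (forall n w, 0 <= q n w) ->
  (forall N, \sum_(n < N) \int[P]_w (atx s n w * q n w)%:E <= C%:E)%E ->
  (\int[P]_w (q (idx s w) w)%:E <= C%:E)%E.
Proof.
move=> s0 mq q0 HC.
pose F N w : R := \sum_(n < N) atx s n w * q n w.
have mterm n : measurable_fun setT (fun w => atx s n w * q n w).
  by apply: measurable_funM => //; exact: (measurable_at_index bm x0 fc hdP).
have term0 n w : 0 <= atx s n w * q n w by rewrite mulr_ge0// at_index_ge0.
have mF N : measurable_fun setT (F N) by exact: measurable_sum.
have lim : (\int[P]_w (F N w)%:E)%E @[N --> \oo] --> (\int[P]_w limn (fun N => (F N w)%:E))%E.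
  apply: cvg_monotone_convergence => //.
  - by move=> N; exact: measurable_EFin_comp.
  - by move=> N w _; rewrite lee_fin sumr_ge0.
  - move=> w _ N N' NN'; rewrite lee_fin /F.
    rewrite -(subnKC NN') big_split_ord/= lerDl; exact: sumr_ge0.
apply: (@le_trans _ _ (\int[P]_w limn (fun N => (F N w)%:E))%E); last first.
  rewrite -(cvg_lim _ lim)//; apply: lime_le; first by apply/cvg_ex; eexists; exact: lim.
  by apply: nearW => N; rewrite expectation_sum.
have cF w : cvgn (fun N => (F N w)%:E).
  apply: ereal_nondecreasing_is_cvgn => N N' NN'; rewrite lee_fin /F.
  rewrite -(subnKC NN') big_split_ord/= lerDl; exact: sumr_ge0.
apply: ae_ge0_le_integral => //.
- by move=> w _; rewrite lee_fin.
- exact/measurable_EFin_comp/measurable_fun_at_index1.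
- move=> w _; apply: lime_ge => //; apply: nearW => N.
  by rewrite lee_fin sumr_ge0.
- apply: (emeasurable_fun_cvg (fun N w => (F N w)%:E)) => //.
  by move=> N; exact: measurable_EFin_comp.
have := nonexplosion; apply: filterS => w /(_ s) sk _.
have FE N : (idx s w < N)%N -> F N w = q (idx s w) w.
  move=> iN; rewrite /F (bigD1 (Ordinal iN))//= big1 ?addr0.
    by rewrite at_index_eq// eqxx mul1r.
  move=> n nN; rewrite at_index_eq//; case: eqP => [E|]; last by rewrite mul0r.
  by move: nN; rewrite -val_eqE/= -E eqxx.
have -> : limn (fun N => (F N w)%:E) = (q (idx s w) w)%:E.
  apply/cvg_lim => //; apply: cvg_near_cst; exists (idx s w).+1 => // N /= hN.
  by rewrite FE.
by [].
Qed.

End fixed_step.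
End index.

(** * Moments at a fixed time *)

Section index_moments.
Context {R : realType} d (T : measurableType d) (P : probability T R) {m : nat}.
Variables (Ft : R -> set (set T)) (W : R -> T -> 'rV[R]_m).
Hypothesis bm : extended_brownian P Ft W.
Variables (f : 'rV[R]_m -> 'rV[R]_m) (x0 : 'rV[R]_m).
Hypothesis fc : continuous f.
Variables (alpha beta H : R).
Hypotheses (alpha_gt0 : 0 < alpha) (beta_gt0 : 0 < beta) (H_gt0 : 0 < H).
Let FtS := eb_sigma bm.
Let FtM := @eb_measurable _ _ _ _ _ _ _ bm.
Let Ftle := @eb_nondecreasing _ _ _ _ _ _ _ bm.
Let Wa := @eb_adapted _ _ _ _ _ _ _ bm.
Let Wc := @eb_continuous _ _ _ _ _ _ _ bm.
Let Wi := @eb_increment _ _ _ _ _ _ _ bm.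

Section fixed_step.
Variable hd : 'rV[R]_m -> R.
Hypothesis hdP : step_function f alpha beta H hd.
Let hd_gt0 := step_gt0 hdP.
Let mhd := step_measurable hdP.
Local Notation tn n w := (em_time f hd x0 (W ^~ w) n).
Local Notation idx s w := (em_index f hd x0 (W ^~ w) s).
Local Notation atx := (at_index W f x0 hd).

Local Notation dWn n s w := (W s w - W (tn n w) w).

Let mtn n : measurable_fun setT (fun w => tn n w).
Proof. exact: (chain_time_measurable bm x0 fc hd_gt0 mhd n). Qed.

Let mat s n : measurable_wrt (stopped_sets Ft (fun w => tn n w)) (atx s n).
Proof.
have mt := @chain_time_measurable_wrt _ _ _ _ _ _ _ bm _ _ x0 fc hd_gt0 mhd n.
have mt1 := @chain_next_measurable_wrt _ _ _ _ _ _ _ bm _ _ x0 fc hd_gt0 mhd n.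
rewrite (_ : atx s n = (fun w => (tn n w <= s)%R%:R - (tn n.+1 w <= s)%R%:R)).
  by apply: measurable_funB; exact: measurable_leb.
by apply/funext => w; rewrite (at_indexE _ _ hdP).
Qed.

Let sum_at_index s N : (\sum_(n < N) \int[P]_w (atx s n w)%:E <= 1)%E.
Proof.
have mat' n : measurable_fun setT (atx s n).
  exact: (measurable_at_index bm x0 fc hdP).
rewrite -expectation_sum//.
apply: (@le_trans _ _ (\int[P]_w (1 : R)%:E)%E); last first.
  by rewrite integral_cst// [X in (_ * X)%E]probability_setT mule1.
apply: le_expectation => //; first exact: measurable_sum.
  by move=> w; apply: sumr_ge0 => n _; exact: at_index_ge0.
move=> w; suff -> : \sum_(i < N) atx s i w = (tn 0 w <= s)%R%:R - (tn N w <= s)%R%:R.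
  by apply: (@le_trans _ _ (tn 0 w <= s)%R%:R); rewrite ?lerBlDr ?lerDl// lern1 leq_b1.
elim: N => [|N IH]; first by rewrite big_ord0 subrr.
by rewrite big_ord_recr/= IH (at_indexE _ _ hdP) subrKA.
Qed.

(** [s] may precede [t_n]. The maximum is at least [t_n], known at [t_n], and equal to [s] on the
    event that [s] lies in step [n]; the increment up to [s] thereby becomes one between stopping
    times. *)
Let stop_s s n (w : T) : R := Num.max (tn n w) s.

Let mstop s n : measurable_wrt (stopped_sets Ft (fun w => tn n w)) (stop_s s n).
Proof.
apply: measurable_maxr => //.
exact: (@chain_time_measurable_wrt _ _ _ _ _ _ _ bm _ _ x0 fc hd_gt0 mhd n).
Qed.

Let stop_sP s n w : atx s n w != 0 -> stop_s s n w = s.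
Proof.
rewrite /at_index /stop_s; case: (boolP (_ <= s < _)) => [/andP[ts _] _|_]; last by rewrite eqxx.
exact: max_r.
Qed.

Let stop_s_ge s n w : tn n w <= stop_s s n w. Proof. by rewrite le_max lexx. Qed.

(** Selecting the step that contains [s] does not bias the increment, because the condition
    [s < t_{n+1}] is known at [t_n]. The elapsed time is at most one step, hence the factor
    [Hd ^+ k], and the events [at_index] have total probability at most one. *)
Lemma index_increment_moment (k : nat) (Hd s : R) (i : 'I_m) : (0 < k)%N -> 0 <= s ->
  (forall x, hd x <= Hd) ->
  (\int[P]_w ((dWn (idx s w) s w) ord0 i ^+ (2 * k))%:E <= (moment_cst k * Hd ^+ k)%:E)%E.
Proof.
move=> k0 s0 hHd.
have c0 := @moment_cst_ge0 R k.
have Hd0 : 0 <= Hd by exact: le_trans (ltW (hd_gt0 0)) (hHd 0).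
have mW (r : T -> R) : measurable_fun setT r -> measurable_fun setT (fun w => (W (r w) w) ord0 i).
  by move=> mr; exact: (measurable_evaluation (@FtM) (@Wa i) (@Wc i) mr).
have mdW n : measurable_fun setT (fun w => (dWn n s w) ord0 i).
  rewrite (_ : (fun _ => _) = (fun w => W s w ord0 i - W (tn n w) w ord0 i)).
    by apply: measurable_funB; [exact: (mW (cst s) (measurable_cst _))|exact: mW].
  by apply/funext => w; rewrite !mxE.
apply: (index_expectation_le bm fc alpha_gt0 beta_gt0 H_gt0 hdP
   (q := fun n w => (dWn n s w) ord0 i ^+ (2 * k))) => //.
- by move=> n; exact: measurable_funX.
- by move=> n w; rewrite exprM exprn_ge0// sqr_ge0.
move=> N; apply: (@le_trans _ _ (\sum_(n < N) ((moment_cst k * Hd ^+ k)%:E * \int[P]_w (atx s n w)%:E))%E).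
  apply: lee_sum => n _.
  have at01 w : 0 <= atx s n w <= 1 by rewrite at_index_ge0/= lern1 leq_b1.
  have ats w : atx s n w != 0 -> stop_s s n w <= s by move/stop_sP ->.
  have mom := increment_moment_le FtS (@FtM) (@Ftle) (@Wa i) (@Wc i) (@Wi i)
    (fun w => em_time_ge0 f x0 hd_gt0 (W ^~ w) n) (chain_stopping bm x0 fc hd_gt0 mhd n)
    (stop_s_ge s n) (@mstop s n) k0 s0 (@mat s n) at01 ats.
  apply: (@le_trans _ _ (\int[P]_w (atx s n w * (W (stop_s s n w) w ord0 i - W (tn n w) w ord0 i) ^+ (2 * k))%:E)%E).
    rewrite le_eqVlt; apply/orP; left; apply/eqP; apply: eq_integral => w _; congr EFin.
    have [->|/stop_sP ->] := eqVneq (atx s n w) 0; first by rewrite !mul0r.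
    by rewrite !mxE.
  apply: (le_trans mom); rewrite -expectationZ; last 3 first.
  - exact: (measurable_at_index bm x0 fc hdP).
  - by move=> w; exact: at_index_ge0.
  - by nonneg.
  have mdt : measurable_fun setT (fun w => stop_s s n w - tn n w).
    by apply: measurable_funB => //; exact: measurable_maxr.
  have mat' : measurable_fun setT (atx s n) by exact: (measurable_at_index bm x0 fc hdP).
  apply: le_expectation.
  - by apply: measurable_funM => //; apply: measurable_funM => //; exact: measurable_funX.
  - exact: measurable_funM.
  - move=> w; apply: mulr_ge0; first exact: at_index_ge0.
    by apply: mulr_ge0 => //; apply: exprn_ge0; rewrite subr_ge0.
  move=> w; rewrite mulrC; have [->|a0] := eqVneq (atx s n w) 0; first by rewrite !mulr0.
  apply: ler_wpM2r; first exact: at_index_ge0.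
  apply: ler_wpM2l => //; apply: lerXn2r; rewrite ?nnegrE ?subr_ge0//.
  rewrite (stop_sP a0) lerBlDr.
  move: a0; rewrite /at_index; case: (boolP (_ <= s < _)) => [/andP[_ st] _|_]; last by rewrite eqxx.
  by apply: (le_trans (ltW st)); rewrite em_timeS addrC lerD2r.
rewrite -ge0_sume_distrr; last by move=> n _; apply: expectation_ge0 => w; exact: at_index_ge0.
apply: le_trans (lee_wpmul2l _ (sum_at_index s N)) _; last by rewrite mule1.
by rewrite lee_fin; nonneg.
Qed.

(** Neither [A] nor the number of steps is bounded, so the mean is first computed for the sums [ZN],
    cut off at [N] steps and at [|A| <= N]. They are dominated by [|Z|], which is integrable by
    assumption. *)
Lemma index_mean0 (A : nat -> T -> 'rV[R]_m) (s : R) : 0 <= s ->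
  (forall n, measurable_wrt (stopped_sets Ft (fun w => tn n w)) (A n : T -> borelV R m)) ->
  P.-integrable setT (fun w => (dotv (A (idx s w) w) (dWn (idx s w) s w))%:E) ->
  (\int[P]_w (dotv (A (idx s w) w) (dWn (idx s w) s w))%:E = 0)%E.
Proof.
move=> s0 mA iZ.
pose Z w := dotv (A (idx s w) w) (dWn (idx s w) s w).
pose b N n i w : R := atx s n w * (normF (A n w) <= N%:R)%R%:R * A n w ord0 i.
pose ZN N w := \sum_(n < N) \sum_i b N n i w * (W (stop_s s n w) w ord0 i - W (tn n w) w ord0 i).
have mb N n i : measurable_wrt (stopped_sets Ft (fun w => tn n w)) (b N n i).
  apply: measurable_funM; last by apply: measurable_coord; exact: mA.
  apply: measurable_funM; first exact: mat.
  by apply: measurable_leb; apply: measurable_normF; exact: mA.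
have bb N n i w : `|b N n i w| <= N%:R.
  rewrite /b !normrM; case: (boolP (normF (A n w) <= N%:R)) => [AN|_]; last first.
    by rewrite normr0 mulr0 mul0r.
  rewrite normr1 mulr1; apply: (@le_trans _ _ (1 * normF (A n w))); last by rewrite mul1r.
  apply: ler_pM => //; last exact: coord_le_normF.
  by rewrite ger0_norm ?at_index_ge0// lern1 leq_b1.
have bs N n i w : b N n i w != 0 -> stop_s s n w <= s.
  by rewrite /b !mulf_eq0 !negb_or -andbA => /and3P[/stop_sP ->].
have int1 N n i : P.-integrable setT (fun w => (b N n i w * (W (stop_s s n w) w ord0 i - W (tn n w) w ord0 i))%:E).
  exact: (increment_integrable FtS (@FtM) (@Ftle) (@Wa i) (@Wc i) (@Wi i)
    (fun w => em_time_ge0 f x0 hd_gt0 (W ^~ w) n) (chain_stopping bm x0 fc hd_gt0 mhd n)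
    (stop_s_ge s n) (@mstop s n) s0 (@mb N n i) (bb N n i) (bs N n i)).
have mean1 N n i : (\int[P]_w (b N n i w * (W (stop_s s n w) w ord0 i - W (tn n w) w ord0 i))%:E = 0)%E.
  exact: (increment_mean0 FtS (@FtM) (@Ftle) (@Wa i) (@Wc i) (@Wi i)
    (fun w => em_time_ge0 f x0 hd_gt0 (W ^~ w) n) (chain_stopping bm x0 fc hd_gt0 mhd n)
    (stop_s_ge s n) (@mstop s n) s0 (@mb N n i) (bb N n i) (bs N n i)).
have int2 N n : P.-integrable setT (fun w => (\sum_i b N n i w * (W (stop_s s n w) w ord0 i - W (tn n w) w ord0 i))%:E).
  have := @integrable_sum _ _ _ P _ measurableT _ (index_enum 'I_m) xpredT
    (fun i w => (b N n i w * (W (stop_s s n w) w ord0 i - W (tn n w) w ord0 i))%:E).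
  by under eq_fun do rewrite sumEFin; apply => i _; exact: int1.
have meanZ N : (\int[P]_w (ZN N w)%:E = 0)%E.
  rewrite /ZN; under eq_integral do rewrite -sumEFin.
  rewrite integral_sum//; apply: big1 => n _; under eq_integral do rewrite -sumEFin.
  by rewrite integral_sum//; apply: big1 => i _; exact: mean1.
have mZN N : measurable_fun setT (fun w => (ZN N w)%:E).
  apply: measurable_EFin_comp; apply: measurable_sum => n; apply/measurable_EFinP.
  exact: measurable_int (int2 N n).
have ZNE w N : (exists k, s < tn k w) -> ZN N w =
    if ((idx s w < N)%N && (normF (A (idx s w) w) <= N%:R)) then Z w else 0.
  move=> sk; have term n : \sum_i b N n i w * (W (stop_s s n w) w ord0 i - W (tn n w) w ord0 i) =
      if (idx s w == n) && (normF (A n w) <= N%:R) then Z w else 0.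
    have atE : atx s n w = (idx s w == n)%:R.
      exact: (at_index_eq hdP _ s0 sk).
    case: eqP => [E|E]/=; last first.
      by apply: big1 => i _; rewrite /b atE; case: eqP => // _; rewrite !mul0r.
    have sE : stop_s s n w = s by apply: stop_sP; rewrite atE E eqxx oner_eq0.
    case: ifPn => AN; last first.
      by apply: big1 => i _; rewrite /b (negbTE AN) mulr0 !mul0r.
    rewrite /Z E /dotv; apply: eq_bigr => i _.
    by rewrite /b atE E eqxx AN sE !mxE !mul1r.
  rewrite /ZN; under eq_bigr do rewrite term.
  case: (ltnP (idx s w) N) => [iN|Ni]/=; last first.
    apply: big1 => n _; case: eqP => //= E.
    by have := ltn_ord n; rewrite -E ltnNge Ni.
  rewrite (bigD1 (Ordinal iN))//= eqxx/= big1 ?addr0// => n nN.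
  case: eqP => //= E; by move: nN; rewrite -val_eqE/= -E eqxx.
have limZ : {ae P, forall w, setT w -> (ZN N w)%:E @[N --> \oo] --> (Z w)%:E}.
  have := nonexplosion bm x0 fc alpha_gt0 beta_gt0 H_gt0 hdP; apply: filterS => w /(_ s) sk _.
  apply: cvg_near_cst; near=> N; rewrite ZNE//.
  have -> : (idx s w < N)%N by near: N; exact: nbhs_infty_gt.
  suff -> : normF (A (idx s w) w) <= N%:R by [].
  near: N; exact: nbhs_infty_ger.
have domZ : {ae P, forall w N, setT w -> (`|(ZN N w)%:E| <= `|Z w|%:E)%E}.
  have := nonexplosion bm x0 fc alpha_gt0 beta_gt0 H_gt0 hdP; apply: filterS => w /(_ s) sk N _.
  by rewrite lee_fin ZNE//; case: ifP => // _; rewrite normr0.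
have iabs : P.-integrable setT (fun w => (`|Z w|)%:E) by exact: integrable_abse iZ.
have [_ _ cv] := dominated_convergence measurableT mZN (measurable_int _ iZ) limZ iabs domZ.
have : (fun N => \int[P]_w (ZN N w)%:E)%E @ \oo --> (0 : \bar R)%E.
  by rewrite (_ : (fun N => _) = fun=> 0%E); [exact: cvg_cst|apply/funext => N; rewrite meanZ].
by move=> c0; apply: (cvg_unique _ cv c0).
Unshelve. all: by end_near. Qed.

End fixed_step.

(** The weight is undone at the cost of [exp (kap * H)], since [t_n > s - H] in the step that
    contains [s]. Against the source of size [exp (kap * s)] this leaves no growth in time. [C] is
    chosen before [hd], which gives uniformity in [delta]. *)
Lemma chain_moment_index k : exists2 C : R, 0 <= C &
  forall hd, step_function f alpha beta H hd -> forall s, 0 <= s ->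
  (\int[P]_w (normF (em_value f hd x0 (W ^~ w) (em_index f hd x0 (W ^~ w) s)) ^+ (2 * k.+1))%:E
    <= C%:E)%E.
Proof.
have [C C0 HC] := @normF_pow_taylor R m k.
have Cm0 : 0 <= C * (m%:R * (moment_cst 1 + moment_cst k.+1)).
  by rewrite !mulr_ge0// addr_ge0// moment_cst_ge0.
have [Cd Cd0 HCd] := dissipative_power k alpha_gt0 beta_gt0 H_gt0 Cm0.
pose kap := alpha / 2; have kap0 : 0 < kap by rewrite divr_gt0.
pose C3 := Cd * expR (kap * H) / kap.
have C30 : 0 <= C3 by rewrite /C3; nonneg.
have x0k : 0 <= normF x0 ^+ (2 * k.+1) by exact/exprn_ge0/normF_ge0.
exists (expR (kap * H) * (normF x0 ^+ (2 * k.+1) + C3)).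
  by apply: mulr_ge0; [exact: expR_ge0|exact: addr_ge0].
move=> hd hdP s s0; have hd_gt0 := step_gt0 hdP; have mhd := step_measurable hdP.
pose V n w := normF (em_value f hd x0 (W ^~ w) n) ^+ (2 * k.+1).
have V0 n w : 0 <= V n w by exact/exprn_ge0/normF_ge0.
have mV n : measurable_fun setT (V n).
  apply: measurable_funX; apply: measurable_normF.
  exact: (chain_value_measurable bm x0 fc hd_gt0 mhd n).
apply: (index_expectation_le bm fc alpha_gt0 beta_gt0 H_gt0 hdP (q := V)) => //.
move=> N.
have bound := chain_moment_sum bm x0 fc alpha_gt0 beta_gt0 hdP C0 HC Cd0 HCd N s0.
rewrite -/kap -/C3 in bound.
pose e n w := expR (kap * em_time f hd x0 (W ^~ w) n).
have me n : measurable_fun setT (e n).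
  apply: measurableT_comp => //; apply: measurable_funM => //.
  exact: (chain_time_measurable bm x0 fc hd_gt0 mhd n).
have mat n : measurable_fun setT (at_index W f x0 hd s n).
  exact: (measurable_at_index bm x0 fc hdP).
apply: (@le_trans _ _ (\sum_(n < N) ((expR (kap * (H - s)))%:E *
    \int[P]_w (at_index W f x0 hd s n w * (e n w * V n w))%:E))%E).
  apply: lee_sum => n _; rewrite -expectationZ.
  - apply: le_expectation.
    + exact: measurable_funM.
    + by apply: measurable_funM => //; apply: measurable_funM => //; exact: measurable_funM.
    + by move=> w; rewrite mulr_ge0 ?at_index_ge0.
    move=> w; rewrite mulrCA /at_index; case: (boolP (_ <= s < _)) => [/andP[_ st]|_].
      rewrite !mul1r mulrA ler_peMl// /e -expRD -mulrDr -expR0 ler_expR mulr_ge0 ?(ltW kap0)//.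
      have := step_le hdP (em_value f hd x0 (W ^~ w) n); rewrite em_timeS in st; lra.
    by rewrite !mul0r.
  - by apply: measurable_funM => //; exact: measurable_funM.
  - by move=> w; rewrite mulr_ge0 ?at_index_ge0// mulr_ge0// expR_ge0.
  - exact: expR_ge0.
have I0 n : (0 <= \int[P]_w (at_index W f x0 hd s n w * (e n w * V n w))%:E)%E.
  by apply: expectation_ge0 => w; rewrite mulr_ge0 ?at_index_ge0// mulr_ge0// expR_ge0.
rewrite -ge0_sume_distrr//.
apply: (@le_trans _ _ ((expR (kap * (H - s)))%:E * (normF x0 ^+ (2 * k.+1) + C3 * expR (kap * s))%:E)%E).
  apply: lee_wpmul2l; first by rewrite lee_fin expR_ge0.
  apply: le_trans bound; rewrite leeDr//; apply: expectation_ge0 => w.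
  by apply: mulr_ge0 => //; apply: mulr_ge0; [exact: expR_ge0|exact: V0].
rewrite -EFinM lee_fin mulrBr expRD -mulrA ler_wpM2l ?expR_ge0// mulrDr.
apply: lerD; first by rewrite ler_piMl// -expR0 ler_expR oppr_le0 mulr_ge0// ltW.
by rewrite mulrCA -expRD addNr expR0 mulr1.
Qed.

End index_moments.

(** * The error along one path *)

Section differential_inequality.
Context {R : realType}.
Local Notation mu := (@lebesgue_measure R).

Lemma continuous_itv_integrable (g : R -> R) (a b : R) : continuous g ->
  mu.-integrable `[a, b] (EFin \o g).
Proof.
move=> cg; apply: continuous_compact_integrable; first exact: segment_compact.
exact: continuous_subspaceT.
Qed.

Lemma is_derive_primitive (g : R -> R) (a s : R) : continuous g -> a < s ->
  is_derive s 1 (fun x => Rintegral mu `[a, x] g) (g s).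
Proof.
move=> cg as_; have s1 : s < s + 1 by rewrite ltrDl.
have [ds dE] := continuous_FTC1_closed s1 (continuous_itv_integrable _ _ cg) as_ (cg s).
by apply: DeriveDef; [exact: ds|rewrite -derive1E; exact: dE].
Qed.

(** [u] minus the primitive of [gp - gm] is nonincreasing. The two integrals stay on separate sides,
    as nonnegative extended reals, ready for Tonelli's theorem. *)
Lemma differential_inequality (u du gp gm : R -> R) (a b : R) : a <= b ->
  continuous u -> continuous gp -> continuous gm ->
  (forall s, 0 <= gp s) -> (forall s, 0 <= gm s) ->
  (forall s, a < s < b -> is_derive s 1 u (du s)) ->
  (forall s, a < s < b -> du s <= gp s - gm s) ->
  ((u b)%:E + \int[mu]_(s in `[a, b]) (gm s)%:E <=
   (u a)%:E + \int[mu]_(s in `[a, b]) (gp s)%:E)%E.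
Proof.
move=> ab cu cp cm p0 m0 Du Dle.
pose g s := gp s - gm s.
have cg : continuous g by move=> s; apply: cvgB; [exact: cp|exact: cm].
pose G x := Rintegral mu `[a, x] g.
have ip := continuous_itv_integrable a b cp; have im := continuous_itv_integrable a b cm.
have DG (s : R) : a < s < b -> is_derive s 1 (u - G) (du s - g s).
  move=> sab; have /andP[as_ _] := sab.
  by apply: is_deriveB; [exact: Du|exact: is_derive_primitive].
have cG : {within `[a, b], continuous G}.
  by have := parameterized_integral_continuous ab (continuous_itv_integrable a b cg).
have noninc : (u - G) b <= (u - G) a.
  apply: (@ler0_derive1_le_cc _ (u - G) a b) => //.
  - by move=> s; rewrite in_itv/= => sab; have [] := DG s sab.
  - move=> s; rewrite in_itv/= => sab; rewrite derive1E; have [_ ->] := DG s sab.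
    by rewrite subr_le0; exact: Dle.
  - move=> s; apply: cvgB; last exact: cG.
    by apply: continuous_subspaceT.
  - by rewrite in_itv/= lexx ab.
  - by rewrite in_itv/= lexx ab.
have Ga : G a = 0 by rewrite /G set_itv1 Rintegral_set1.
have GE : G b = Rintegral mu `[a, b] gp - Rintegral mu `[a, b] gm.
  by rewrite /G RintegralB.
have fin h : continuous h -> (\int[mu]_(s in `[a, b]) (h s)%:E)%E = (Rintegral mu `[a, b] h)%:E.
  move=> ch; rewrite /Rintegral fineK//.
  exact: integrable_fin_num (continuous_itv_integrable a b ch).
rewrite (fin _ cm) (fin _ cp) -!EFinD lee_fin.
move: noninc; rewrite -[(u - G) b]/(u b - G b) -[(u - G) a]/(u a - G a) Ga GE.
move: (Rintegral mu _ gp) (Rintegral mu _ gm) => p q; lra.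
Qed.

Lemma is_derive_weighted_power {m : nat} (e : R -> 'rV[R]_m) (de : 'rV[R]_m) (c s : R) k :
  (forall i, is_derive s 1 (fun s => e s ord0 i) (de ord0 i)) ->
  is_derive s 1 (fun s => expR (c * s) * (normF (e s) ^+ 2) ^+ k.+1)
    (expR (c * s) * (c * (normF (e s) ^+ 2) ^+ k.+1 +
       2 * k.+1%:R * (normF (e s) ^+ 2) ^+ k * dotv (e s) de)).
Proof.
move=> dei.
have dv : is_derive s 1 (fun s => normF (e s) ^+ 2) (2 * dotv (e s) de).
  have -> : (fun s => normF (e s) ^+ 2) = \sum_i (fun s => e s ord0 i) ^+ 2.
    apply/funext => r; rewrite normF_sqr fct_sumE; apply: eq_bigr => i _.
    by rewrite -expr2.
  have -> : 2 * dotv (e s) de = \sum_i (2 * e s ord0 i ^+ 1) *: de ord0 i.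
    rewrite /dotv mulr_sumr; apply: eq_bigr => i _.
    by rewrite expr1 /GRing.scale/= mulrA.
  by apply: is_derive_sum => i; apply: is_deriveX.
have dc : is_derive s 1 (fun s => expR (c * s)) (c * expR (c * s)).
  have dcs : is_derive s 1 (fun s => c * s) c.
    have -> : (fun s : R => c * s) = c *: (id : R -> R) by apply/funext.
    by rewrite -[X in is_derive _ _ _ X]mulr1; apply: is_deriveZ.
  have := @is_derive1_comp _ expR (fun s => c * s) s _ _ (is_derive_expR _) dcs.
  by rewrite mulrC.
have -> : (fun s => expR (c * s) * (normF (e s) ^+ 2) ^+ k.+1) =
  (fun s => expR (c * s)) * ((fun s => normF (e s) ^+ 2) ^+ k.+1).
  by apply/funext => r; rewrite mulrfctE exprfctE.
set v := fun s => normF (e s) ^+ 2.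
have dvk : is_derive s 1 (v ^+ k.+1) ((k.+1%:R * v s ^+ k) *: (2 * dotv (e s) de)).
  exact: is_deriveX.
have dM := is_deriveM dc dvk; apply: (is_derive_eq dM).
rewrite exprfctE /GRing.scale/= -/(v s); ring.
Qed.

End differential_inequality.

Section powers.
Context {R : realType} {m : nat}.

Lemma power_dotv_le k (eta : R) (e r : 'rV[R]_m) : 0 < eta ->
  (normF e ^+ 2) ^+ k * dotv e r <=
  eta * (normF e ^+ 2) ^+ k.+1 + eta ^- (2 * k).+1 * normF r ^+ (2 * k.+1).
Proof.
move=> eta0; have := young_pow (2 * k).+1 eta0 (normF_ge0 e) (normF_ge0 r).
rewrite -!exprM !mulnS !add2n; apply: le_trans.
by rewrite exprSr -mulrA; apply: ler_wpM2l; [exact/exprn_ge0/normF_ge0|exact: dotv_le].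
Qed.

Lemma normF_pow_continuous n (e : R -> 'rV[R]_m) : continuous e ->
  continuous (fun s => normF (e s) ^+ n).
Proof.
move=> ec s; apply: (@continuous_comp _ _ _ (fun s => normF (e s)) (fun x => x ^+ n)).
  apply: (@continuous_comp _ _ _ e (@normF R 1 m)); first exact: ec.
  exact: normF_continuous.
exact: exprn_continuous.
Qed.

Lemma expR_linear_continuous (c : R) : continuous (fun s => expR (c * s)).
Proof.
move=> s; apply: (@continuous_comp _ _ _ (fun s => c * s) expR); last exact: continuous_expR.
exact: mulrl_continuous.
Qed.

Lemma weighted_power_continuous (c : R) k (e : R -> 'rV[R]_m) : continuous e ->
  continuous (fun s => expR (c * s) * (normF (e s) ^+ 2) ^+ k).
Proof.
move=> ec s; apply: cvgM; first exact: expR_linear_continuous.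
have -> : (fun s => (normF (e s) ^+ 2) ^+ k) = (fun s => normF (e s) ^+ (2 * k)).
  by apply/funext => r; rewrite exprM.
rewrite -exprM; exact: normF_pow_continuous.
Qed.

End powers.

(** * Energy inequality for the error *)

Section path.
Context {R : realType} {m : nat}.
Local Notation leb := (@lebesgue_measure R).
Variables (f : 'rV[R]_m -> 'rV[R]_m) (hd : 'rV[R]_m -> R) (x0 : 'rV[R]_m).
Hypothesis fc : continuous f.
Hypothesis hd_gt0 : forall x, 0 < hd x.
Variables (b X : R -> 'rV[R]_m).
Hypothesis bc : continuous b.
Hypothesis Xc : continuous X.
Hypothesis XE : forall t, 0 <= t -> X t = x0 + integralV t (fun s => f (X s)) + (b t - b 0).
Local Notation tn := (em_time f hd x0 b).
Local Notation xn := (em_value f hd x0 b).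
Local Notation idx := (em_index f hd x0 b).

(** The [n]-th piece of the interpolant, prolonged to all times: for fixed [n] it is continuous in
    [s], and the random index is substituted only afterwards. *)
Definition step_interpolant n (s : R) : 'rV[R]_m :=
  xn n + (s - tn n) *: f (xn n) + (b s - b (tn n)).

Definition step_error n (s : R) : 'rV[R]_m := step_interpolant n s - X s.

Lemma step_interpolant_continuous n : continuous (step_interpolant n).
Proof.
move=> s; apply: cvgD; last by apply: cvgB; [exact: bc|exact: cvg_cst].
apply: cvgD; first exact: cvg_cst.
apply: cvgZr_tmp; apply: cvgB; [exact: cvg_id|exact: cvg_cst].
Qed.

Lemma step_error_continuous n : continuous (step_error n).
Proof.
by move=> s; apply: cvgB; [exact: step_interpolant_continuous|exact: Xc].
Qed.

Lemma step_error0 : step_error 0 0 = 0.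
Proof.
rewrite /step_error /step_interpolant /em_time /em_value/= subrr scale0r addr0 subrr addr0 XE//.
rewrite subrr addr0 (_ : integralV _ _ = 0) ?addr0 ?subrr//.
by apply/rowP => i; rewrite !mxE set_itv1 Rintegral_set1.
Qed.

Lemma step_error_node n : step_error n (tn n) = xn n - X (tn n).
Proof. by rewrite /step_error /step_interpolant !subrr scale0r !addr0. Qed.

Lemma step_error_next n : step_error n.+1 (tn n.+1) = step_error n (tn n.+1).
Proof.
have h : tn n.+1 - tn n = hd (xn n) by rewrite em_timeS addrC addKr.
by rewrite /step_error /step_interpolant !subrr scale0r !addr0 em_valueS h.
Qed.

Lemma is_derive_step_error n (s : R) i : 0 < s ->
  is_derive s 1 (fun s => step_error n s ord0 i)
    (f (xn n) ord0 i - f (X s) ord0 i).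
Proof.
move=> s0; pose g r := f (X r) ord0 i.
have gc : continuous g.
  move=> r; apply: (@continuous_comp _ _ _ (f \o X) (fun u : 'rV[R]_m => u ord0 i)).
    by apply: continuous_comp; [exact: Xc|exact: fc].
  exact: coord_continuous.
pose k := xn n ord0 i - tn n * f (xn n) ord0 i - b (tn n) ord0 i - x0 ord0 i + b 0 ord0 i.
pose F r := k + r * f (xn n) ord0 i - Rintegral leb `[0, r] g.
have dF : is_derive s 1 F (f (xn n) ord0 i - f (X s) ord0 i).
  apply: is_deriveB; last exact: is_derive_primitive.
  have -> : (fun r => k + r * f (xn n) ord0 i) = cst k + (f (xn n) ord0 i) *: (id : R -> R).
    by apply/funext => r; rewrite /GRing.add/= /GRing.scale/= mulrC.
  rewrite -[X in is_derive _ _ _ X]add0r -[X in is_derive _ _ _ (0 + X)]mulr1.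
  by apply: is_deriveD.
apply: (near_eq_is_derive _ dF).
(* The integral equation holds at nonnegative times only, hence on a neighbourhood of [s] because
   [0 < s]. *)
near=> r; have r0 : 0 <= r by apply: ltW; near: r; exact: lt_nbhsr.
rewrite /step_error /step_interpolant (XE r0) !mxE /F /k /g; ring.
Unshelve. all: by end_near. Qed.

Lemma measurable_fun_em_index (q : nat -> R -> R) :
  (forall n, measurable_fun setT (q n)) -> measurable_fun setT (fun s => q (idx s) s).
Proof.
move=> mq; apply: (@measurable_fun_index _ _ _ _ _ idx) => //.
have mpos n : (0 < n)%N -> measurable (idx @^-1` [set n]).
  move=> n0; have -> : idx @^-1` [set n] = `[tn n, tn n.+1[%classic.
    apply/seteqP; split => s /=; rewrite in_itv/=.
      by move/(em_index_preimage _ _ hd_gt0 _ _ n0).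
    exact: em_index_unique.
  exact: measurable_itv.
case=> [|n]; last exact: mpos.
rewrite (_ : _ @^-1` _ = ~` \bigcup_n (idx @^-1` [set n.+1])).
  by apply: measurableC; apply: bigcupT_measurable => n; exact: mpos.
apply/seteqP; split => [s s0 [n _ /=]|s sn /=]; first by rewrite s0.
by case E : (idx s) => [//|n]; exfalso; apply: sn; exists n.
Qed.

(** The interval is half-open so that the index is [n] on its whole last part, even when [t] is the
    next grid time. *)
Lemma integral_em_index (q : nat -> R -> R) n t : (forall n, continuous (q n)) ->
  (forall n s, 0 <= q n s) -> tn n <= t <= tn n.+1 ->
  (\int[leb]_(s in `[0%R, t[) (q (idx s) s)%:E =
   \int[leb]_(s in `[0%R, tn n[) (q (idx s) s)%:E + \int[leb]_(s in `[tn n, t]) (q n s)%:E)%E.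
Proof.
move=> cq q0 /andP[nt tn1].
have mq : measurable_fun setT (fun s => q (idx s) s).
  by apply: measurable_fun_em_index => j; exact: continuous_measurable_fun.
have t0 : 0 <= tn n by exact: em_time_ge0.
rewrite (_ : `[0, t[%classic = `[0, tn n[%classic `|` `[tn n, t[%classic); last first.
  by apply: itv_bndbnd_setU; rewrite bnd_simp.
rewrite ge0_integral_setU//=.
- congr (_ + _)%E; rewrite -integral_itv_bndo_bndc; last first.
    apply: measurable_funTS; apply: measurable_EFin_comp; exact: continuous_measurable_fun.
  apply: eq_integral => s; rewrite inE/= in_itv/= => /andP[ns st].
  by rewrite (@em_index_unique _ _ _ _ _ hd_gt0 _ n)// ns (lt_le_trans st).
- by apply: measurable_funTS; apply: measurable_EFin_comp.
- by move=> s _; rewrite lee_fin.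
- apply/disj_setPS => s [/=]; rewrite !in_itv/= => /andP[_ sn] /andP[ns _].
  by have := lt_le_trans sn ns; rewrite ltxx.
Qed.

(** Induction over the grid: [differential_inequality] applies inside each step, and consecutive
    pieces of the error agree at the nodes. The error starts from zero, so no initial term
    remains. *)
Lemma energy_inequality (c : R) k (gp gm : nat -> R -> R) :
  (forall n, continuous (gp n)) -> (forall n, continuous (gm n)) ->
  (forall n s, 0 <= gp n s) -> (forall n s, 0 <= gm n s) ->
  (forall n s, tn n < s < tn n.+1 ->
    expR (c * s) * (c * (normF (step_error n s) ^+ 2) ^+ k.+1 +
       2 * k.+1%:R * (normF (step_error n s) ^+ 2) ^+ k *
       dotv (step_error n s) (f (xn n) - f (X s))) <= gp n s - gm n s) ->
  forall t, 0 <= t -> (exists n, t < tn n) ->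
  ((expR (c * t) * (normF (em_interpolant f hd x0 b t - X t) ^+ 2) ^+ k.+1)%:E +
    \int[leb]_(s in `[0%R, t[) (gm (idx s) s)%:E <=
    \int[leb]_(s in `[0%R, t[) (gp (idx s) s)%:E)%E.
Proof.
move=> cp cm p0 m0 Hd.
pose U n s := expR (c * s) * (normF (step_error n s) ^+ 2) ^+ k.+1.
have cU n : continuous (U n).
  by apply: weighted_power_continuous; exact: step_error_continuous.
have step n t : tn n <= t <= tn n.+1 ->
    ((U n (tn n))%:E + \int[leb]_(s in `[0%R, tn n[) (gm (idx s) s)%:E <=
      \int[leb]_(s in `[0%R, tn n[) (gp (idx s) s)%:E)%E ->
    ((U n t)%:E + \int[leb]_(s in `[0%R, t[) (gm (idx s) s)%:E <=
      \int[leb]_(s in `[0%R, t[) (gp (idx s) s)%:E)%E.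
  move=> nt IH; rewrite (integral_em_index cm m0 nt) (integral_em_index cp p0 nt).
  have /andP[nt1 tn1] := nt.
  apply: le_trans (leeD2r _ IH).
  rewrite addeCA [leRHS]addeAC; rewrite [leRHS]addeC; apply: leeD2l.
  apply: (@differential_inequality _ (U n) (fun s =>
     expR (c * s) * (c * (normF (step_error n s) ^+ 2) ^+ k.+1 +
       2 * k.+1%:R * (normF (step_error n s) ^+ 2) ^+ k *
       dotv (step_error n s) (f (xn n) - f (X s)))) (gp n) (gm n)) => //.
    move=> s /andP[ns st]; apply: is_derive_weighted_power => i; rewrite !mxE.
    by apply: is_derive_step_error; apply: le_lt_trans ns; exact: em_time_ge0.
  by move=> s /andP[ns st]; apply: Hd; rewrite ns (lt_le_trans st).
have nodes n : ((U n (tn n))%:E + \int[leb]_(s in `[0%R, tn n[) (gm (idx s) s)%:E <=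
      \int[leb]_(s in `[0%R, tn n[) (gp (idx s) s)%:E)%E.
  elim: n => [|n IH].
    rewrite /U /em_time/= step_error0 normF0 !expr0n/= mulr0.
    by rewrite set_itvco0 !integral_set0 adde0.
  have -> : U n.+1 (tn n.+1) = U n (tn n.+1) by rewrite /U step_error_next.
  by apply: step => //; rewrite lexx andbT ltW// em_time_lt.
move=> t t0 tk; have /andP[nt tn1] := em_indexP hd_gt0 tk t0.
by apply: (step (idx t)) => //; rewrite nt ltW.
Qed.

(* The weight [expR (- s / delta)] absorbs the term that Young's inequality
   creates; as the step is at most [delta * H] long, it costs a factor [expR H]. *)
Lemma step_error_variation (delta H t : R) k : 0 < delta ->
  (forall x, hd x <= delta * H) -> 0 <= t -> (exists n, t < tn n) ->
  ((normF (step_error (idx t) t - step_error (idx t) (tn (idx t))) ^+ (2 * k.+1))%:E <=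
   (expR H * (2 * k.+1%:R * (2 * k.+1%:R * delta) ^+ (2 * k).+1))%:E *
   \int[leb]_(s in `[(Num.max 0 (t - delta * H))%R, t])
      (normF (f (xn (idx s)) - f (X s)) ^+ (2 * k.+1))%:E)%E.
Proof.
move=> delta0 hdH t0 tk; have /andP[] := em_indexP hd_gt0 tk t0.
move: (idx t) => n nt tn1.
set K := 2 * k.+1%:R; have K0 : 0 < K :> R by rewrite mulr_gt0.
set A := K * (K * delta) ^+ (2 * k).+1.
have A0 : 0 <= A by rewrite /A; nonneg.
pose c := - delta^-1; pose y s := step_error n s - step_error n (tn n).
pose rho s := f (xn n) - f (X s).
have crho : continuous rho.
  move=> s; apply: cvgB; first exact: cvg_cst.
  by apply: continuous_comp; [exact: Xc|exact: fc].
pose gp s := A * expR (c * tn n) * normF (rho s) ^+ (2 * k.+1).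
have cy : continuous y.
  move=> s; apply: cvgB; last exact: cvg_cst.
  exact: step_error_continuous.
have cgp : continuous gp.
  by move=> s; apply: cvgM; [exact: cvg_cst|exact: normF_pow_continuous].
have gp0 s : 0 <= gp s.
  by rewrite /gp mulr_ge0 ?exprn_ge0 ?normF_ge0// mulr_ge0// expR_ge0.
have := @differential_inequality _ (fun s => expR (c * s) * (normF (y s) ^+ 2) ^+ k.+1)
  (fun s => expR (c * s) * (c * (normF (y s) ^+ 2) ^+ k.+1 +
       K * (normF (y s) ^+ 2) ^+ k * dotv (y s) (rho s))) gp (cst 0) (tn n) t nt
  (@weighted_power_continuous _ _ c k.+1 y cy) cgp (@cst_continuous _ _ (0 : R)) gp0 (fun=> lexx 0).
have dery s : tn n < s < t -> is_derive s 1 (fun s => expR (c * s) * (normF (y s) ^+ 2) ^+ k.+1)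
   (expR (c * s) * (c * (normF (y s) ^+ 2) ^+ k.+1 +
       K * (normF (y s) ^+ 2) ^+ k * dotv (y s) (rho s))).
  move=> /andP[ns st]; apply: is_derive_weighted_power => i.
  have -> : (fun s => y s ord0 i) = (fun s => step_error n s ord0 i) - cst (step_error n (tn n) ord0 i).
    apply/funext => r; have E (u v : 'rV[R]_m) : (u - v) ord0 i = u ord0 i - v ord0 i by rewrite !mxE.
    exact: E.
  rewrite /rho !mxE -[X in is_derive _ _ _ X]subr0; apply: is_deriveB.
  by apply: is_derive_step_error; apply: le_lt_trans ns; exact: em_time_ge0.
move=> /(_ dery); clear dery.
have bound s : tn n < s < t -> expR (c * s) * (c * (normF (y s) ^+ 2) ^+ k.+1 +
       K * (normF (y s) ^+ 2) ^+ k * dotv (y s) (rho s)) <= gp s - cst 0 s.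
  move=> /andP[ns st].
  (* With this [eta] the Young term is exactly [delta^-1 |y|^(2k+2)], which the decay of the weight
     cancels. *)
  have eta0 : 0 < (K * delta)^-1 by rewrite invr_gt0 mulr_gt0.
  have h := power_dotv_le k (y s) (rho s) eta0.
  apply: (@le_trans _ _ (expR (c * s) * (A * normF (rho s) ^+ (2 * k.+1)))).
    apply: ler_wpM2l; first exact: expR_ge0.
    have h2 := ler_wpM2l (ltW K0) h; rewrite mulrDr in h2.
    have E1 : K * ((K * delta)^-1 * (normF (y s) ^+ 2) ^+ k.+1) = - c * (normF (y s) ^+ 2) ^+ k.+1.
      by rewrite invfM !mulrA divff ?gt_eqF// mul1r /c opprK.
    rewrite E1 -exprVn invrK !mulrA -/A in h2.
    by move: h2; move: (dotv _ _) => D; lra.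
  rewrite [cst 0 s]/= subr0 [leRHS]mulrAC [leLHS]mulrC; apply: ler_wpM2l.
    by rewrite mulr_ge0// exprn_ge0// normF_ge0.
  by rewrite ler_expR /c !mulNr lerN2 ler_pM2l ?invr_gt0// ltW.
move=> /(_ bound); clear bound.
have -> : y (tn n) = 0 by rewrite /y subrr.
rewrite normF0 !expr0n/= mulr0 add0e integral0 adde0 => main.
apply: (@le_trans _ _ ((expR (delta^-1 * t))%:E *
   \int[leb]_(s in `[tn n, t]) (gp s)%:E)%E).
  apply: (@le_trans _ _ ((expR (delta^-1 * t))%:E *
     (expR (c * t) * (normF (y t) ^+ 2) ^+ k.+1)%:E)%E); last first.
    by apply: lee_wpmul2l => //; rewrite lee_fin expR_ge0.
  by rewrite -EFinM mulrA -expRD /c mulNr subrr expR0 mul1r exprM.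
have mrho (D : set R) : measurable_fun D (fun s => (normF (rho s) ^+ (2 * k.+1))%:E).
  apply: measurable_funTS; apply: measurable_EFin_comp.
  by apply: continuous_measurable_fun; exact: normF_pow_continuous.
have rho0 s : (0 <= (normF (rho s) ^+ (2 * k.+1))%:E)%E.
  by rewrite lee_fin exprn_ge0// normF_ge0.
have -> : (\int[leb]_(s in `[tn n, t]) (gp s)%:E =
    (A * expR (c * tn n))%:E * \int[leb]_(s in `[tn n, t]) (normF (rho s) ^+ (2 * k.+1))%:E)%E.
  rewrite /gp; under eq_integral do rewrite EFinM.
  rewrite ge0_integralZl//; first exact: mrho.
  by rewrite lee_fin mulr_ge0// expR_ge0.
rewrite muleA -EFinM.
apply: (@le_trans _ _ ((expR H * A)%:E * \int[leb]_(s in `[tn n, t]) (normF (rho s) ^+ (2 * k.+1))%:E)%E).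
  apply: lee_wpmul2r; first by apply: integral_ge0.
  rewrite lee_fin mulrCA -expRD mulrC ler_wpM2r// ler_expR /c mulNr -mulrBr.
  rewrite mulrC ler_pdivrMr// lerBlDr (le_trans (ltW tn1))// em_timeS addrC lerD2r mulrC.
  exact: hdH.
apply: lee_wpmul2l; first by rewrite lee_fin mulr_ge0// expR_ge0.
have mq : measurable_fun setT (fun s => normF (f (xn (idx s)) - f (X s)) ^+ (2 * k.+1)).
  apply: (@measurable_fun_em_index (fun n s => normF (f (xn n) - f (X s)) ^+ (2 * k.+1))) => j.
  apply: continuous_measurable_fun; apply: normF_pow_continuous => s.
  apply: cvgB; first exact: cvg_cst.
  by apply: continuous_comp; [exact: Xc|exact: fc].
have -> : (\int[leb]_(s in `[tn n, t]) (normF (rho s) ^+ (2 * k.+1))%:E =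
    \int[leb]_(s in `[tn n, t]) (normF (f (xn (idx s)) - f (X s)) ^+ (2 * k.+1))%:E)%E.
  apply: eq_integral => s; rewrite inE/= in_itv/= => /andP[ns st].
  by rewrite (@em_index_unique _ _ _ _ _ hd_gt0 _ n)// ns (le_lt_trans st).
(* The random interval from [t_n] to [t] is enlarged to a deterministic window of length at most
   [delta * H], over which expectation and time integral can be exchanged. *)
apply: ge0_subset_integral => //=.
- by apply: measurable_funTS; apply: measurable_EFin_comp.
- by move=> s _; rewrite lee_fin exprn_ge0// normF_ge0.
- move=> s /=; rewrite !in_itv/= => /andP[ns ->]; rewrite andbT (le_trans _ ns)//.
  rewrite ge_max em_time_ge0// lerBlDr (le_trans (ltW tn1))// em_timeS lerD2l; exact: hdH.
Qed.

End path.

Lemma row_continuousP {R : realType} {m : nat} (Y : R -> 'rV[R]_m) :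
  (forall i, continuous (fun t => Y t ord0 i)) <-> continuous Y.
Proof.
split=> [cY t|cY i t]; last first.
  apply: (@continuous_comp _ _ _ Y (fun u : 'rV[R]_m => u ord0 i)); first exact: cY.
  exact: coord_continuous.
apply/cvg_ballP => e e0; near=> r; split=> // i j; rewrite (ord1 i).
move: j; near: r; apply: filter_forall => j.
by have /cvg_ballP := cY j t; apply.
Unshelve. all: by end_near. Qed.

(** * Pointwise dissipation inequality *)

Section dissipation.
Context {R : realType} {m : nat}.
Implicit Types (p q M : R) (a b e el g r u : 'rV[R]_m).

(** The factor [q] raises the exponent of [M] from [n - 1] to [n], so that [n = 0] fits the same
    formula. *)
Lemma pow_diff_le n p q M : 0 <= p <= M -> 0 <= q <= M ->
  `|p ^+ n - q ^+ n| * q <= n%:R * M ^+ n * `|p - q|.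
Proof.
move=> /andP[p0 pM] /andP[q0 qM]; have M0 : 0 <= M by exact: le_trans pM.
elim: n => [|n IH]; first by rewrite !expr0 subrr normr0 !mul0r.
have -> : p ^+ n.+1 - q ^+ n.+1 = p * (p ^+ n - q ^+ n) + (p - q) * q ^+ n.
  by rewrite !exprS; ring.
apply: (@le_trans _ _ (p * (`|p ^+ n - q ^+ n| * q) + `|p - q| * (q ^+ n * q))).
  rewrite mulrA [`|p - q| * _]mulrA -mulrDl; apply: ler_wpM2r => //.
  apply: le_trans (ler_normD _ _) _; rewrite !normrM (ger0_norm p0).
  by rewrite (ger0_norm (exprn_ge0 n q0)).
have -> : n.+1%:R * M ^+ n.+1 * `|p - q| =
    M * (n%:R * M ^+ n * `|p - q|) + `|p - q| * (M ^+ n * M).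
  by rewrite -natr1 exprS; ring.
apply: lerD; first by apply: ler_pM => //; rewrite mulr_ge0.
apply: ler_wpM2l => //; apply: ler_pM => //; first exact: exprn_ge0.
by apply: lerXn2r; rewrite ?nnegrE.
Qed.

Lemma normF_sub_le a b : `|normF a - normF b| <= normF (a - b).
Proof.
rewrite ler_norml; apply/andP; split.
  by rewrite lerNl opprB lerBlDr -(normFN (a - b)) opprB -{1}(subrK a b) normFD.
by rewrite lerBlDr -{1}(subrK b a) normFD.
Qed.

(** Both [|e|] and [|el|] are at most [|e| + |e - el|]. Stating the error without [|el|] allows its
    power to be split later between the dissipation of [|e|] and the small difference. *)
Lemma power_vector_diff k e el u :
  - ((normF e ^+ 2) ^+ k * dotv e u) <=
  - ((normF el ^+ 2) ^+ k * dotv el u) +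
  (2 * k).+1%:R * (normF e + normF (e - el)) ^+ (2 * k) * (normF (e - el) * normF u).
Proof.
rewrite -!exprM; set n := (2 * k)%N; set M := normF e + normF (e - el).
have M0 : 0 <= M by rewrite addr_ge0// normF_ge0.
have eM : normF e <= M by rewrite lerDl normF_ge0.
have elM : normF el <= M by have := normF_sub_le e el; rewrite /M ler_norml => /andP[h _]; lra.
have E : normF el ^+ n * dotv el u - normF e ^+ n * dotv e u =
   - (normF e ^+ n * dotv (e - el) u) - (normF e ^+ n - normF el ^+ n) * dotv el u.
  by rewrite dotvBl; ring.
rewrite -lerBlDl opprK addrC E.
have D0 : 0 <= normF (e - el) * normF u by rewrite mulr_ge0// normF_ge0.
have h1 : - (normF e ^+ n * dotv (e - el) u) <= M ^+ n * (normF (e - el) * normF u).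
  rewrite -mulrN -dotvNr; apply: (@le_trans _ _ (normF e ^+ n * (normF (e - el) * normF u))).
    apply: ler_wpM2l; first exact/exprn_ge0/normF_ge0.
    by rewrite -(normFN u); exact: dotv_le.
  by apply: ler_wpM2r => //; apply: lerXn2r; rewrite ?nnegrE ?normF_ge0.
have h2 : - ((normF e ^+ n - normF el ^+ n) * dotv el u) <=
    n%:R * M ^+ n * (normF (e - el) * normF u).
  apply: le_trans (ler_norm _) _; rewrite normrN normrM.
  apply: (@le_trans _ _ (`|normF e ^+ n - normF el ^+ n| * (normF el * normF u))).
    by apply: ler_wpM2l => //; exact: normr_dotv_le.
  rewrite [leLHS]mulrA [leRHS]mulrA; apply: ler_wpM2r; first exact: normF_ge0.
  apply: le_trans (pow_diff_le n (M := M) _ _) _; rewrite ?normF_ge0//.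
  apply: ler_wpM2l; last exact: normF_sub_le.
  by rewrite mulr_ge0// exprn_ge0.
apply: le_trans (lerD h1 h2) _; rewrite -[n.+1%:R]natr1.
by rewrite le_eqVlt; apply/orP; left; apply/eqP; ring.
Qed.

(** Contractivity supplies [- K * lambda * |e|^(2k+2)] with [K = 2 (k + 1) >= 2]. It covers three
    debts: [lambda / 2] kept on the left, [K * lambda / 4] from Young's inequality for [r], and
    [lambda / 2] from replacing [e] by [el] in the [u] term. With [el = e] and [u = 0] this is also
    the inequality behind order one half. *)
Lemma dissipation k (lambda : R) : 0 < lambda ->
  exists C1 C2 C3 : R, [/\ 0 <= C1, 0 <= C2, 0 <= C3 &
  forall e el g r u, dotv e g <= - lambda * normF e ^+ 2 ->
    lambda / 2 * (normF e ^+ 2) ^+ k.+1 +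
      2 * k.+1%:R * (normF e ^+ 2) ^+ k * dotv e (g + r - u) <=
    C1 * normF r ^+ (2 * k.+1) + C2 * normF (e - el) ^+ (2 * k.+1) +
    C3 * (normF (e - el) * normF u) ^+ k.+1 -
    2 * k.+1%:R * ((normF el ^+ 2) ^+ k * dotv el u)].
Proof.
move=> lam0; set K := 2 * k.+1%:R; have K2 : 2 <= K.
  by rewrite /K ler_peMr// ler1n.
have K0 : 0 < K by lra.
set c := (2 * k).+1%:R : R; have c0 : 0 < c by rewrite ltr0n.
set B := 2 ^+ (2 * k.+1) : R; have B0 : 0 < B by rewrite exprn_gt0.
(* [B] comes from splitting [(|e| + |e - el|)^(2k+2)], and [K * c] is the factor of the replacement
   error: with this [eta] its share of [|e|^(2k+2)] is exactly [lambda / 2]. *)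
pose eta := lambda / 2 / (K * c * B).
have eta0 : 0 < eta by rewrite /eta !divr_gt0// !mulr_gt0.
exists (K * (lambda / 4) ^- (2 * k).+1), (lambda / 2), (K * c * eta ^- k).
split; [by rewrite mulr_ge0// ?(ltW K0)// invr_ge0 exprn_ge0// divr_ge0// ltW|by rewrite divr_ge0// ltW|
  by rewrite !mulr_ge0// ?(ltW K0) ?(ltW c0)// invr_ge0 exprn_ge0// ltW|].
move=> e el g r u eg; set v := normF e ^+ 2.
set D := normF (e - el).
have v0 : 0 <= v by exact: sqr_ge0.
have vk0 : 0 <= v ^+ k by exact: exprn_ge0.
have h1 : v ^+ k * dotv e g <= - lambda * v ^+ k.+1.
  by rewrite exprSr mulrCA; apply: ler_wpM2l.
have h2 := power_dotv_le k e r (divr_gt0 lam0 (ltr0n _ 4)).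
have h3 := power_vector_diff k e el u.
have D0 : 0 <= D by exact: normF_ge0.
have e0 : 0 <= normF e by exact: normF_ge0.
have y0 : 0 <= D * normF u by rewrite mulr_ge0// normF_ge0.
have h4 := young_pow k eta0 (sqr_ge0 (normF e + D)) y0.
have h5 : eta * ((normF e + D) ^+ 2) ^+ k.+1 <= eta * (B * (v ^+ k.+1 + D ^+ (2 * k.+1))).
  by apply: ler_wpM2l; [exact: ltW|rewrite -exprM /v -exprM; exact: powD_le].
have E : K * c * (eta * (B * (v ^+ k.+1 + D ^+ (2 * k.+1)))) =
    lambda / 2 * v ^+ k.+1 + lambda / 2 * D ^+ (2 * k.+1).
  by rewrite /eta; field; rewrite !gt_eqF.
rewrite -/v -/D -exprM in h2 h3 h4 *.
have k1 := ler_wpM2l (ltW K0) h1; have k2 := ler_wpM2l (ltW K0) h2.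
have k3 := ler_wpM2l (ltW K0) h3.
have k4 := ler_wpM2l (mulr_ge0 (ltW K0) (ltW c0)) (le_trans h4 (lerD h5 (lexx _))).
rewrite mulrDr E in k4.
have Kv : 2 * (lambda * v ^+ k.+1) <= K * (lambda * v ^+ k.+1).
  by apply: ler_wpM2r => //; rewrite mulr_ge0 ?exprn_ge0// ltW.
have lv : 0 <= lambda * v ^+ k.+1 by rewrite mulr_ge0 ?exprn_ge0// ltW.
rewrite dotvBr dotvDr.
have -> : K * v ^+ k * (dotv e g + dotv e r - dotv e u) =
  K * (v ^+ k * dotv e g) + K * (v ^+ k * dotv e r) + K * - (v ^+ k * dotv e u) by ring.
rewrite /D -/c -exprM in k3 *.
have k3' : K * (c * (normF e + normF (e - el)) ^+ (2 * k) * (normF (e - el) * normF u)) =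
  K * c * ((normF e + normF (e - el)) ^+ (2 * k) * (normF (e - el) * normF u)) by ring.
rewrite mulrDr k3' in k3; rewrite /D -exprM in k4.
move: k1 k2 k3 k4 Kv lv; rewrite !exprM.
set a1 := K * (v ^+ k * dotv e g); set a2 := K * (v ^+ k * dotv e r).
set a3 := K * - (v ^+ k * dotv e u).
set V := v ^+ k.+1.
set Y := _ * (normF u); set Z := (K * - (_ * dotv el u)).
have -> : K * (normF el ^+ 2 ^+ k * dotv el u) = - Z by rewrite /Z mulrN opprK.
move: ((lambda / 4) ^- _) (eta ^- k) (normF r ^+ 2 ^+ k.+1) (normF (e - el) ^+ 2 ^+ k.+1) (Y ^+ k.+1)
  (_ ^+ k * Y) => i1 i2 r1 d1 y1 q1.
move: a1 a2 a3 Z V => {}a1 {}a2 {}a3 {}Z {}V k1 k2 k3 k4 Kv lv; lra.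
Qed.

Lemma dotv_mulmx_tr a b (M : 'M[R]_m) : dotv (a *m M^T) b = dotv a (b *m M).
Proof.
rewrite /dotv; under eq_bigr do rewrite mxE mulr_suml.
rewrite exchange_big; apply: eq_bigr => i _; rewrite mxE mulr_sumr.
by apply: eq_bigr => j _; rewrite mxE; ring.
Qed.

Lemma mulmx_continuous (Y : R -> 'rV[R]_m) (M : 'M[R]_m) : continuous Y ->
  continuous (fun s => Y s *m M).
Proof.
move=> cY; apply/row_continuousP => j.
rewrite (_ : (fun s => _) = fun s => \sum_i Y s ord0 i * M i j); last first.
  by apply/funext => s; rewrite mxE.
apply: (@continuous_sum _ _ _ (fun i s => Y s ord0 i * M i j)) => i s.
apply: cvgM; last exact: cvg_cst.
by have /row_continuousP h := cY; exact: h.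
Qed.

Lemma trmx_continuous : continuous (@trmx R m m).
Proof.
move=> x B [Q Qx QB]; exists (fun i j => Q j i) => [i j|y Qy].
  by have := Qx j i; rewrite mxE.
by apply: QB => i j; rewrite mxE; exact: Qy.
Qed.

End dissipation.

(** * Families with bounded moments *)

Section bounded_moments.
Context {R : realType} d (T : measurableType d) (P : probability T R).

Lemma ae_le_expectation (f g : T -> R) : measurable_fun setT f -> measurable_fun setT g ->
  (forall w, 0 <= f w) -> (forall w, 0 <= g w) -> {ae P, forall w, f w <= g w} ->
  (\int[P]_w (f w)%:E <= \int[P]_w (g w)%:E)%E.
Proof.
move=> mf mg f0 g0 fg; apply: ae_ge0_le_integral => //.
- by move=> w _; rewrite lee_fin.
- exact: measurable_EFin_comp.
- by move=> w _; rewrite lee_fin.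
- exact: measurable_EFin_comp.
- by apply: filterS fg => w fw _; rewrite lee_fin.
Qed.

Lemma expectation_cst (c : R) : (\int[P]_w c%:E = c%:E)%E.
Proof. by rewrite integral_cst// [X in (_ * X)%E]probability_setT mule1. Qed.

Context {I : Type} (D : set I).
Implicit Types Q : I -> T -> R.

(** All moments are bounded at once, uniformly over the index set. The class is closed under sums,
    products and powers, so polynomial growth factors require no bookkeeping of exponents. *)
Record bounded_moments Q : Prop := {
  bmom_measurable : forall i, D i -> measurable_fun setT (Q i) ;
  bmom_ge0 : forall i w, D i -> 0 <= Q i w ;
  bmom_bound : forall n : nat, exists2 K : R, 0 <= K &
    forall i, D i -> (\int[P]_w (Q i w ^+ n)%:E <= K%:E)%E }.

Lemma bounded_moments_even Q : (forall i, D i -> measurable_fun setT (Q i)) ->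
  (forall i w, D i -> 0 <= Q i w) ->
  (forall k : nat, exists2 K : R, 0 <= K &
    forall i, D i -> (\int[P]_w (Q i w ^+ (2 * k.+1))%:E <= K%:E)%E) ->
  bounded_moments Q.
Proof.
move=> mQ Q0 HQ; split=> // n; have [K K0 HK] := HQ n.
exists (1 + K) => [|i Di]; first by rewrite addr_ge0.
apply: (@le_trans _ _ (\int[P]_w (1 + Q i w ^+ (2 * n.+1))%:E)%E).
  apply: le_expectation.
  - by apply: measurable_funX; exact: mQ.
  - by apply: measurable_funD => //; apply: measurable_funX; exact: mQ.
  - by move=> w; rewrite exprn_ge0// Q0.
  - move=> w; apply: pow_le1D; last exact: Q0.
    by rewrite mulnS (leq_trans (leq_addl 2 _))// leq_add2l leq_pmull.
rewrite expectationD//.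
- by rewrite expectation_cst EFinD leeD2l// HK.
- by apply: measurable_funX; exact: mQ.
- by move=> w; rewrite exprn_ge0// Q0.
Qed.

Lemma bounded_moments_cst (c : I -> R) (C : R) : (forall i, D i -> 0 <= c i <= C) ->
  bounded_moments (fun i _ => c i).
Proof.
move=> cC; split=> [i Di|i w /cC/andP[]//|n]; first exact: measurable_cst.
exists (`|C| ^+ n) => [|i Di]; first exact: exprn_ge0.
have /andP[c0 ciC] := cC _ Di.
rewrite expectation_cst lee_fin lerXn2r ?nnegrE//.
exact: le_trans (ler_norm _).
Qed.

Lemma bounded_moments_le Q Q' : (forall i, D i -> measurable_fun setT (Q i)) ->
  (forall i w, D i -> 0 <= Q i w) -> bounded_moments Q' ->
  (forall i, D i -> {ae P, forall w, Q i w <= Q' i w}) -> bounded_moments Q.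
Proof.
move=> mQ Q0 [mQ' Q'0 HQ'] QQ'; split=> // n; have [K K0 HK] := HQ' n.
exists K => // i Di; apply: le_trans (HK _ Di); apply: ae_le_expectation.
- by apply: measurable_funX; exact: mQ.
- by apply: measurable_funX; exact: mQ'.
- by move=> w; rewrite exprn_ge0// Q0.
- by move=> w; rewrite exprn_ge0// Q'0.
- apply: filterS (QQ' _ Di) => w h.
  by apply: lerXn2r; rewrite ?nnegrE ?Q0 ?Q'0.
Qed.

Lemma bounded_momentsD Q Q' : bounded_moments Q -> bounded_moments Q' ->
  bounded_moments (fun i w => Q i w + Q' i w).
Proof.
move=> [mQ Q0 HQ] [mQ' Q'0 HQ']; split=> [i Di|i w Di|n].
- by apply: measurable_funD; [exact: mQ|exact: mQ'].
- by rewrite addr_ge0 ?Q0 ?Q'0.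
have [K K0 HK] := HQ n; have [K' K'0 HK'] := HQ' n.
have mX Q1 i : D i -> (forall i, D i -> measurable_fun setT (Q1 i)) ->
    measurable_fun setT (fun w => Q1 i w ^+ n).
  by move=> Di mQ1; apply: measurable_funX; exact: mQ1.
have X0 Q1 i w : D i -> (forall i w, D i -> 0 <= Q1 i w) -> 0 <= Q1 i w ^+ n.
  by move=> Di Q10; rewrite exprn_ge0// Q10.
exists (2 ^+ n * (K + K')) => [|i Di]; first by rewrite mulr_ge0 ?addr_ge0 ?exprn_ge0.
have mS : measurable_fun setT (fun w => Q i w ^+ n + Q' i w ^+ n).
  by apply: measurable_funD; exact: mX.
apply: (@le_trans _ _ (\int[P]_w (2 ^+ n * (Q i w ^+ n + Q' i w ^+ n))%:E)%E).
  apply: le_expectation.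
  - by apply: measurable_funX; apply: measurable_funD; [exact: mQ|exact: mQ'].
  - exact: measurable_funM.
  - by move=> w; rewrite exprn_ge0// addr_ge0 ?Q0 ?Q'0.
  - by move=> w; apply: powD_le; [exact: Q0|exact: Q'0].
rewrite expectationZ//.
- rewrite expectationD; [|exact: mX|exact: mX|by move=> w; exact: X0|by move=> w; exact: X0].
  by rewrite EFinM lee_wpmul2l ?lee_fin ?exprn_ge0// EFinD leeD ?HK ?HK'.
- by move=> w; rewrite addr_ge0// X0.
Qed.

Lemma bounded_momentsX Q (j : nat) : bounded_moments Q ->
  bounded_moments (fun i w => Q i w ^+ j).
Proof.
move=> [mQ Q0 HQ]; split=> [i Di|i w Di|n].
- by apply: measurable_funX; exact: mQ.
- by rewrite exprn_ge0// Q0.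
have [K K0 HK] := HQ (j * n)%N; exists K => // i Di.
by under eq_integral do rewrite -exprM; exact: HK.
Qed.

(** [a b <= a^2 + b^2] takes the place of Hoelder's inequality, as every power is controlled. *)
Lemma bounded_momentsM Q Q' : bounded_moments Q -> bounded_moments Q' ->
  bounded_moments (fun i w => Q i w * Q' i w).
Proof.
move=> bQ bQ'.
apply: bounded_moments_le (bounded_momentsD (bounded_momentsX 2 bQ) (bounded_momentsX 2 bQ')) _.
- by move=> i Di; apply: measurable_funM; [exact: (bmom_measurable bQ)|exact: (bmom_measurable bQ')].
- by move=> i w Di; rewrite mulr_ge0 ?(bmom_ge0 bQ) ?(bmom_ge0 bQ').
move=> i Di; apply: aeW => w.
have := bmom_ge0 bQ w Di; have := bmom_ge0 bQ' w Di.
have := sqr_ge0 (Q i w - Q' i w); nra.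
Qed.

Lemma bounded_moments_integrable Q i : bounded_moments Q -> D i ->
  P.-integrable setT (fun w => (Q i w)%:E).
Proof.
move=> [mQ Q0 HQ] Di; apply/integrableP; split; first exact/measurable_EFin_comp/mQ.
have [K K0 HK] := HQ 1; apply: le_lt_trans (ltry K); apply: le_trans (HK i Di).
by rewrite le_eqVlt; apply/orP; left; apply/eqP; apply: eq_integral => w _; rewrite gee0_abs// lee_fin Q0.
Qed.

End bounded_moments.

(** * Energy estimate in mean *)

Section interval_expectation.
Context {R : realType} d (T : measurableType d) (P : probability T R).
Local Notation leb := (@lebesgue_measure R).

Let GR := measurableTypeR R.
Let leb_sfin : {sigma_finite_measure set GR -> \bar R} := @lebesgue_measure R.

(* Fubini is applied over the copy [measurableTypeR R] of [R], on which the
   Lebesgue measure is declared. *)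
Let measurable_retype (G : T * R -> \bar R) :
  measurable_fun setT G -> measurable_fun [set: T * GR] (G : T * GR -> \bar R).
Proof.
move=> mG; have mid : measurable_fun [set: T * GR] ((fun z => (z.1, z.2)) : T * GR -> T * R).
  apply: measurable_fun_pair; first exact: measurable_fst.
  have mi : measurable_fun [set: GR] (idfun : GR -> R) by move=> _ Y mY; rewrite setTI.
  exact: (measurableT_comp mi (@measurable_snd _ _ T GR)).
rewrite (_ : G = G \o (fun z => (z.1, z.2))); last by apply/funext => -[].
exact: (measurableT_comp mG mid).
Qed.

Lemma expectation_interval (F : T * R -> R) (D : set R) : measurable D ->
  measurable_fun setT F -> (forall z, 0 <= F z) ->
  measurable_fun setT (fun w => \int[leb]_(s in D) (F (w, s))%:E)%E /\
  (\int[P]_w \int[leb]_(s in D) (F (w, s))%:E =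
   \int[leb]_(s in D) \int[P]_w (F (w, s))%:E)%E.
Proof.
move=> mD mF F0.
pose G (z : T * R) : \bar R := (F z * \1_D z.2)%:E.
have mG : measurable_fun [set: T * GR] (G : T * GR -> \bar R).
  apply: measurable_retype.
  apply: measurable_EFin_comp; apply: measurable_funM => //.
  by apply: measurableT_comp => //; exact: measurable_indic.
have G0 z : (0 <= G z)%E by rewrite lee_fin mulr_ge0// indicE.
have GE w : (\int[leb]_(s in D) (F (w, s))%:E = \int[leb_sfin]_s G (w, s))%E.
  rewrite integral_mkcond; apply: eq_integral => s _; rewrite /patch /G/= indicE.
  by case: ifP; rewrite ?mulr1 ?mulr0.
split.
  rewrite (_ : (fun w => _) = fubini_F leb_sfin (G : T * GR -> \bar R)).
    exact: (@measurable_fun_fubini_tonelli_F _ _ _ _ _ leb_sfin _ mG G0).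
  by apply/funext => w; rewrite GE.
under eq_integral do rewrite GE.
rewrite [LHS](@fubini_tonelli _ _ _ _ _ P leb_sfin _ mG G0) [RHS]integral_mkcond.
apply: eq_integral => s _; rewrite /patch /G/= indicE; case: ifP => _.
  by apply: eq_integral => w _; rewrite mulr1.
by apply: integral0_eq => w _; rewrite mulr0.
Qed.

Lemma integral_expR_le (c t : R) : 0 < c -> 0 <= t ->
  (\int[leb]_(s in `[0%R, t[) (expR (c * s))%:E <= (expR (c * t) / c)%:E)%E.
Proof.
move=> c0 t0.
have mexp : measurable_fun setT (fun s => (expR (c * s))%:E).
  by apply: measurable_EFin_comp; apply: continuous_measurable_fun; exact: expR_linear_continuous.
rewrite integral_itv_bndo_bndc; last exact: measurable_funTS.
have der (s : R) : is_derive s 1 (fun s => - c^-1 * expR (c * s)) (- expR (c * s)).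
  have dcs : is_derive s 1 (fun s => c * s) c.
    have -> : (fun s : R => c * s) = c *: (id : R -> R) by apply/funext.
    by rewrite -[X in is_derive _ _ _ X]mulr1; apply: is_deriveZ.
  have de := @is_derive1_comp _ expR (fun s => c * s) s _ _ (is_derive_expR _) dcs.
  have -> : (fun s => - c^-1 * expR (c * s)) = (- c^-1) *: (expR \o (fun s => c * s)) by apply/funext.
  have -> : - expR (c * s) = - c^-1 *: (expR (c * s) * c).
    by rewrite /GRing.scale/= mulNr mulrCA mulVf ?gt_eqF// mulr1.
  exact: is_deriveZ.
have cu : continuous (fun s : R => - c^-1 * expR (c * s)).
  by move=> s; apply: cvgM; [exact: cvg_cst|exact: expR_linear_continuous].
have := @differential_inequality _ (fun s => - c^-1 * expR (c * s)) (fun s => - expR (c * s))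
  (cst 0) (fun s => expR (c * s)) 0 t t0 cu (@cst_continuous _ _ (0 : R))
  (@expR_linear_continuous _ c) (fun=> lexx 0) (fun s => expR_ge0 _) (fun s _ => der s).
rewrite integral0 adde0 => h.
have {h} : ((- c^-1 * expR (c * t))%:E + \int[leb]_(s in `[0%R, t]) (expR (c * s))%:E <=
    (- c^-1 * expR (c * 0))%:E)%E.
  by apply: h => s _; rewrite /= sub0r.
rewrite addeC -leeBrDr// => h; apply: le_trans h _; rewrite -EFinN -EFinD lee_fin mulr0 expR0 mulr1.
by rewrite mulNr opprK [c^-1 * _]mulrC gerDr oppr_le0 invr_ge0 ltW.
Qed.

End interval_expectation.

Section mean_energy.
Context {R : realType} d (T : measurableType d) (P : probability T R) {m : nat}.
Local Notation leb := (@lebesgue_measure R).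
Variables (Ft : R -> set (set T)) (W : R -> T -> 'rV[R]_m).
Hypothesis bm : extended_brownian P Ft W.
Variables (f : 'rV[R]_m -> 'rV[R]_m) (x0 : 'rV[R]_m).
Hypothesis fc : continuous f.
Variables (alpha beta H : R).
Hypotheses (alpha_gt0 : 0 < alpha) (beta_gt0 : 0 < beta) (H_gt0 : 0 < H).
Variable X : R -> T -> 'rV[R]_m.
Hypothesis Xa : forall i t, measurable_wrt (Ft t) (fun w => X t w ord0 i).
Hypothesis Xc : forall w, continuous (X ^~ w).
Hypothesis XE : {ae P, forall w, forall t, 0 <= t ->
  X t w = x0 + integralV t (fun s => f (X s w)) + (W t w - W 0 w)}.
Let FtM := @eb_measurable _ _ _ _ _ _ _ bm.
Let Wa := @eb_adapted _ _ _ _ _ _ _ bm.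
Let Wc := @eb_continuous _ _ _ _ _ _ _ bm.

Lemma extended_brownian_continuous w : continuous (W ^~ w).
Proof. by apply/row_continuousP => i; exact: (@Wc i w). Qed.

Let Xc' i w : continuous (fun t => X t w ord0 i).
Proof. by have /row_continuousP := @Xc w; apply. Qed.

Variable hd : 'rV[R]_m -> R.
Hypothesis hdP : step_function f alpha beta H hd.
Let hd_gt0 := step_gt0 hdP.
Let mhd := step_measurable hdP.
Local Notation tn n w := (em_time f hd x0 (W ^~ w) n).
Local Notation xn n w := (em_value f hd x0 (W ^~ w) n).
Local Notation idx s w := (em_index f hd x0 (W ^~ w) s).
Local Notation xh n s w := (step_interpolant f hd x0 (W ^~ w) n s).
Local Notation err n s w := (step_error f hd x0 (W ^~ w) (X ^~ w) n s).
Local Notation mv F := (measurable_fun [set: T] (F : T -> borelV R m)).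

Let mtn n : measurable_fun setT (fun w => tn n w).
Proof. exact: (chain_time_measurable bm x0 fc hd_gt0 mhd n). Qed.

Lemma measurable_chain_value n : mv (fun w => xn n w).
Proof. exact: (chain_value_measurable bm x0 fc hd_gt0 mhd n). Qed.

Lemma measurable_noise s : mv (fun w => W s w).
Proof.
by apply/measurable_fun_coordP => i; exact: (measurable_wrt_measurable (@FtM s) (@Wa i s)).
Qed.

Lemma measurable_noise_node n : mv (fun w => W (tn n w) w).
Proof.
apply/measurable_fun_coordP => i.
exact: (measurable_evaluation (@FtM) (@Wa i) (@Wc i) (mtn n)).
Qed.

Lemma measurable_solution s : mv (fun w => X s w).
Proof.
by apply/measurable_fun_coordP => i; exact: (measurable_wrt_measurable (@FtM s) (@Xa i s)).
Qed.

Lemma measurable_solution_node n : mv (fun w => X (tn n w) w).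
Proof.
apply/measurable_fun_coordP => i.
exact: (measurable_evaluation (@FtM) (@Xa i) (@Xc' i) (mtn n)).
Qed.

Lemma measurable_elapsed n s : measurable_fun setT (fun w => s - tn n w).
Proof. exact: measurable_funB. Qed.

Lemma measurable_interpolant n s : mv (fun w => xh n s w).
Proof.
apply: measurable_addv; last first.
  by apply: measurable_subv; [exact: measurable_noise|exact: measurable_noise_node].
apply: measurable_addv; first exact: measurable_chain_value.
apply: measurable_scalev; first exact: measurable_elapsed.
apply: measurable_compv => //; exact: measurable_chain_value.
Qed.

Lemma interpolant_continuous n w : continuous (fun s => xh n s w).
Proof. exact/step_interpolant_continuous/extended_brownian_continuous. Qed.

Lemma ae_regular : {ae P, forall w, (forall s : R, exists n, s < tn n w) /\
  forall t, 0 <= t -> X t w = x0 + integralV t (fun s => f (X s w)) + (W t w - W 0 w)}.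
Proof.
have := nonexplosion bm x0 fc alpha_gt0 beta_gt0 H_gt0 hdP.
by move=> ne; move: ne XE; apply: filterS2 => w.
Qed.

Lemma index_family_measurable (g : nat -> T -> R -> R) :
  (forall n s, measurable_fun setT (fun w => g n w s)) ->
  (forall n w, continuous (g n w)) ->
  measurable_fun setT (fun z : T * R => g (idx z.2 z.1) z.1 z.2).
Proof.
move=> mg cg.
apply: (measurable_fun_at_index bm x0 fc hdP (q := fun n z => g n z.1 z.2)) => n.
exact: measurable_fun_caratheodory.
Qed.

(* A term without sign but of mean zero is split between [gp] and [gm], so that
   Tonelli's theorem is only applied to nonnegative integrands. *)
Lemma mean_energy_le (c K G t : R) k (gp gm : nat -> T -> R -> R) :
  0 < c -> 0 <= t -> 0 <= K ->
  (forall n s, measurable_fun setT (fun w => gp n w s)) ->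
  (forall n s, measurable_fun setT (fun w => gm n w s)) ->
  (forall n w, continuous (gp n w)) -> (forall n w, continuous (gm n w)) ->
  (forall n w s, 0 <= gp n w s) -> (forall n w s, 0 <= gm n w s) ->
  (forall n w s, tn n w < s < tn n.+1 w ->
    c * (normF (err n s w) ^+ 2) ^+ k.+1 +
    2 * k.+1%:R * (normF (err n s w) ^+ 2) ^+ k *
      dotv (err n s w) (f (xn n w) - f (X s w)) <= gp n w s - gm n w s) ->
  (forall s, 0 <= s -> (\int[P]_w (gp (idx s w) w s)%:E <=
    K%:E + \int[P]_w (gm (idx s w) w s)%:E)%E) ->
  (forall s, 0 <= s -> (\int[P]_w (gm (idx s w) w s)%:E <= G%:E)%E) ->
  (\int[P]_w (normF (em_interpolant f hd x0 (W ^~ w) t - X t w) ^+ (2 * k.+1))%:E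
    <= (K / c)%:E)%E.
Proof.
move=> c0 t0 K0 mp mm cp cm p0 m0 Hd Kp Gm.
pose D : set R := `[0, t[%classic.
have mD : measurable D by exact: measurable_itv.
pose F (g : nat -> T -> R -> R) (z : T * R) := expR (c * z.2) * g (idx z.2 z.1) z.1 z.2.
have mexp : measurable_fun setT (fun s : R => expR (c * s)).
  by apply: continuous_measurable_fun; exact: expR_linear_continuous.
have mF (g : nat -> T -> R -> R) : (forall n s, measurable_fun setT (fun w => g n w s)) ->
    (forall n w, continuous (g n w)) -> measurable_fun setT (F g).
  move=> mg cg; apply: measurable_funM; last exact: index_family_measurable.
  by apply: (measurableT_comp mexp); exact: measurable_snd.
have F0 (g : nat -> T -> R -> R) : (forall n w s, 0 <= g n w s) -> forall z, 0 <= F g z.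
  by move=> g0 z; rewrite mulr_ge0 ?expR_ge0.
have mFp := mF gp mp cp; have mFm := mF gm mm cm.
have Fp0 := F0 gp p0; have Fm0 := F0 gm m0.
have [mIp EIp] := expectation_interval P mD mFp Fp0.
have [mIm EIm] := expectation_interval P mD mFm Fm0.
have I0 (g : nat -> T -> R -> R) w : (forall n w s, 0 <= g n w s) -> (0 <= \int[leb]_(s in D) (F g (w, s))%:E)%E.
  by move=> g0; apply: integral_ge0 => s _; rewrite lee_fin F0.
pose U w := normF (em_interpolant f hd x0 (W ^~ w) t - X t w) ^+ (2 * k.+1).
have U0 w : 0 <= U w by rewrite exprn_ge0// normF_ge0.
have mU : measurable_fun setT U.
  apply: measurable_funX; apply: measurable_normF; apply: measurable_subv; last exact: measurable_solution.
  exact: (measurable_fun_at_index1 bm x0 fc hdP t (q := fun n w => xh n t w : borelV R m) (measurable_interpolant^~ t)).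
have pathwise : {ae P, forall w, ((expR (c * t) * U w)%:E + \int[leb]_(s in D) (F gm (w, s))%:E
    <= \int[leb]_(s in D) (F gp (w, s))%:E)%E}.
  apply: filterS ae_regular => w [ne XEw].
  have := energy_inequality fc hd_gt0 (@extended_brownian_continuous w) (@Xc w) XEw (c := c) (k := k)
    (gp := fun n s => expR (c * s) * gp n w s) (gm := fun n s => expR (c * s) * gm n w s) _ _ _ _ _ t0 (ne t).
  rewrite /U exprM; apply.
  - by move=> n s; apply: cvgM; [exact: expR_linear_continuous|exact: cp].
  - by move=> n s; apply: cvgM; [exact: expR_linear_continuous|exact: cm].
  - by move=> n s; rewrite mulr_ge0 ?expR_ge0.
  - by move=> n s; rewrite mulr_ge0 ?expR_ge0.
  - by move=> n s ns; rewrite -mulrBr; apply: ler_wpM2l; [exact: expR_ge0|exact: Hd].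
have mUe : measurable_fun setT (fun w => (expR (c * t) * U w)%:E).
  by apply: measurable_EFin_comp; exact: measurable_funM.
have Ue0 w : (0 <= (expR (c * t) * U w)%:E)%E by rewrite lee_fin mulr_ge0// expR_ge0.
have step : (\int[P]_w (expR (c * t) * U w)%:E + \int[P]_w \int[leb]_(s in D) (F gm (w, s))%:E
    <= \int[P]_w \int[leb]_(s in D) (F gp (w, s))%:E)%E.
  rewrite -ge0_integralD//; last by move=> w _; exact: I0.
  apply: ae_ge0_le_integral => //.
  - by move=> w _; apply: adde_ge0 => //; exact: I0.
  - exact: emeasurable_funD.
  - by move=> w _; exact: I0.
  - by apply: filterS pathwise => w h _.
have mg (g : nat -> T -> R -> R) s : (forall n s, measurable_fun setT (fun w => g n w s)) ->
    measurable_fun setT (fun w => g (idx s w) w s).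
  move=> mg; exact: (measurable_fun_at_index1 bm x0 fc hdP s (q := fun n w => g n w s) (fun n => mg n s)).
have EF (g : nat -> T -> R -> R) s : (forall n s, measurable_fun setT (fun w => g n w s)) -> (forall n w s, 0 <= g n w s) ->
    (\int[P]_w (F g (w, s))%:E = (expR (c * s))%:E * \int[P]_w (g (idx s w) w s)%:E)%E.
  move=> mg1 g0; rewrite /F/=.
  by rewrite expectationZ ?expR_ge0//; exact: mg.
have mEF (g : nat -> T -> R -> R) : measurable_fun setT (F g) -> (forall z, 0 <= F g z) ->
    measurable_fun setT (fun s => \int[P]_w (F g (w, s))%:E)%E.
  move=> mg1 g0; apply: (@measurable_fun_fubini_tonelli_G _ _ T R R P (fun z => (F g z)%:E)).
    exact: measurable_EFin_comp.
  by move=> z; rewrite lee_fin.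
have KE : (\int[leb]_(s in D) (K * expR (c * s))%:E <= (K * (expR (c * t) / c))%:E)%E.
  under eq_integral do rewrite EFinM.
  rewrite ge0_integralZl//.
  - by rewrite EFinM; apply: lee_wpmul2l; [rewrite lee_fin|exact: integral_expR_le].
  - by apply: measurable_funTS; exact: measurable_EFin_comp.
have bound : (\int[leb]_(s in D) \int[P]_w (F gp (w, s))%:E <=
    (K * (expR (c * t) / c))%:E + \int[leb]_(s in D) \int[P]_w (F gm (w, s))%:E)%E.
  apply: le_trans (leeD2r _ KE); rewrite -ge0_integralD//.
  - apply: ge0_le_integral => //.
    + by move=> s _; apply: expectation_ge0.
    + by apply: measurable_funTS; exact: mEF.
    + apply: emeasurable_funD; last by apply: measurable_funTS; exact: mEF.
      by apply: measurable_funTS; apply: measurable_EFin_comp; exact: measurable_funM.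
    + move=> s; rewrite /D/= in_itv/= => /andP[s0 _].
      rewrite (EF gp)// (EF gm)// [K * _]mulrC EFinM -ge0_muleDr ?lee_fin//.
      * by apply: lee_wpmul2l; [rewrite lee_fin expR_ge0|exact: Kp].
      * by apply: expectation_ge0.
  - by move=> s _; rewrite lee_fin mulr_ge0// expR_ge0.
  - by apply: measurable_funTS; apply: measurable_EFin_comp; exact: measurable_funM.
  - by move=> s _; apply: expectation_ge0.
  - by apply: measurable_funTS; exact: mEF.
have G0 : 0 <= G by rewrite -lee_fin; apply: le_trans (Gm 0 (lexx _)); apply: expectation_ge0.
(* The integral of [gm] occurs on both sides and can be cancelled only when finite. This is what [G]
   is for; it does not enter the final bound. *)
have fin : (\int[leb]_(s in D) \int[P]_w (F gm (w, s))%:E)%E \is a fin_num.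
  rewrite ge0_fin_numE; last by apply: integral_ge0 => s _; exact: expectation_ge0.
  apply: (@le_lt_trans _ _ (\int[leb]_(s in D) (G%:E * (expR (c * s))%:E))%E).
    apply: ge0_le_integral => //.
    - by move=> s _; apply: expectation_ge0.
    - by apply: measurable_funTS; exact: mEF.
    - apply: measurable_funTS; under eq_fun do rewrite -EFinM.
      by apply: measurable_EFin_comp; exact: measurable_funM.
    - move=> s; rewrite /D/= in_itv/= => /andP[s0 _]; rewrite (EF gm)// muleC.
      by apply: lee_wpmul2r; [rewrite lee_fin expR_ge0|exact: Gm].
  rewrite ge0_integralZl//; last by apply: measurable_funTS; exact: measurable_EFin_comp.
  apply: (@le_lt_trans _ _ (G%:E * (expR (c * t) / c)%:E)%E); last by rewrite -EFinM ltry.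
  by apply: lee_wpmul2l; [rewrite lee_fin|exact: integral_expR_le].
rewrite EIm EIp in step; have := le_trans step bound.
rewrite leeD2rE// expectationZ ?expR_ge0// => h.
(* Multiplication by [exp (- c t)] compensates the growth of the weighted source
   [K * exp (c t) / c], which makes the bound uniform in [t]. *)
have := @lee_wpmul2l _ (expR (- (c * t)))%:E _ _ _ h.
rewrite lee_fin expR_ge0 => /(_ isT); rewrite muleA -!EFinM -expRD addNr expR0 mul1e.
by move/le_trans; apply; rewrite lee_fin (mulrCA (expR _) K) (mulrA (expR _)) -expRD addNr expR0 mul1r.
Qed.

End mean_energy.

(** * Calculus of moment orders *)

Section scaled_norms.
Context {R : realType} d (T : measurableType d) (P : probability T R) {m : nat}.
Context {I : Type} (D : set I).
Local Notation mv F := (measurable_fun [set: T] (F : T -> borelV R m)).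
Local Notation BM := (bounded_moments P D).
Implicit Types (F G U : I -> T -> 'rV[R]_m) (c : I -> R).

Definition scaled_norm c F : I -> T -> R := fun i w => normF (F i w) / c i.

(* [F i] is [O(c i)] in [L^p] for every [p], uniformly over the index set [D]. *)
Record moment_order c F : Prop := {
  order_measurable : forall i, D i -> mv (F i) ;
  order_gt0 : forall i, D i -> 0 < c i ;
  order_bounded : BM (scaled_norm c F) }.

Lemma moment_order_le c F Q : (forall i, D i -> mv (F i)) ->
  (forall i, D i -> 0 < c i) -> BM Q ->
  (forall i, D i -> {ae P, forall w, normF (F i w) <= c i * Q i w}) ->
  moment_order c F.
Proof.
move=> mF c0 bQ FQ; split=> //; apply: bounded_moments_le bQ _.
- by move=> i Di; apply: measurable_funM => //; apply: measurable_normF; exact: mF.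
- by move=> i w Di; rewrite divr_ge0 ?normF_ge0// ltW// c0.
- by move=> i Di; apply: filterS (FQ i Di) => w h; rewrite /scaled_norm ler_pdivrMr ?c0// mulrC.
Qed.

Lemma scaled_normE c F i w : moment_order c F -> D i ->
  normF (F i w) = c i * scaled_norm c F i w.
Proof. by move=> [_ c0 _] Di; rewrite /scaled_norm mulrCA divff ?mulr1// gt_eqF// c0. Qed.

Lemma scaled_norm1 F i w : scaled_norm (fun=> 1) F i w = normF (F i w).
Proof. by rewrite /scaled_norm divr1. Qed.

Lemma moment_order_eq c F G : (forall i w, F i w = G i w) ->
  moment_order c F -> moment_order c G.
Proof. by move=> FG; congr (moment_order c _); apply/funext => i; apply/funext => w. Qed.

Lemma moment_order_pow c F n : moment_order c F -> exists2 K : R, 0 <= K &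
  forall i, D i -> (\int[P]_w (normF (F i w) ^+ n)%:E <= (K * c i ^+ n)%:E)%E.
Proof.
move=> oF; have [_ c0 bF] := oF; have [K K0 HK] := bmom_bound bF n.
exists K => // i Di; have cn0 : 0 <= c i ^+ n by rewrite exprn_ge0// ltW// c0.
under eq_integral do rewrite (scaled_normE _ oF Di) exprMn.
rewrite expectationZ//.
- by rewrite mulrC EFinM lee_wpmul2l// ?lee_fin//; exact: HK.
- by apply: measurable_funX; exact: (bmom_measurable bF).
- by move=> w; rewrite exprn_ge0// (bmom_ge0 bF).
Qed.

Lemma moment_order_even c F : (forall i, D i -> mv (F i)) ->
  (forall i, D i -> 0 < c i) ->
  (forall k, exists2 K : R, 0 <= K & forall i, D i ->
    (\int[P]_w (normF (F i w) ^+ (2 * k.+1))%:E <= (K * c i ^+ (2 * k.+1))%:E)%E) ->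
  moment_order c F.
Proof.
move=> mF c0 HF; split=> //; apply: bounded_moments_even.
- by move=> i Di; apply: measurable_funM => //; apply: measurable_normF; exact: mF.
- by move=> i w Di; rewrite divr_ge0 ?normF_ge0// ltW// c0.
move=> k; have [K K0 HK] := HF k; exists K => // i Di.
have cn0 : 0 < c i ^+ (2 * k.+1) by rewrite exprn_gt0// c0.
under eq_integral do rewrite /scaled_norm expr_div_n mulrC.
rewrite expectationZ ?invr_ge0 ?(ltW cn0)//.
- apply: (@le_trans _ _ ((c i ^+ (2 * k.+1))^-1%:E * (K * c i ^+ (2 * k.+1))%:E)%E).
    by apply: lee_wpmul2l; [rewrite lee_fin invr_ge0 ltW|exact: HK].
  by rewrite -EFinM lee_fin mulrCA mulVf ?mulr1// gt_eqF.
- by apply: measurable_funX; apply: measurable_normF; exact: mF.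
- by move=> w; rewrite exprn_ge0// normF_ge0.
Qed.

Lemma moment_order_bounded F : moment_order (fun=> 1) F ->
  BM (fun i w => normF (F i w)).
Proof.
move=> [_ _]; rewrite (_ : scaled_norm _ F = (fun i w => normF (F i w)))//.
by apply/funext => i; apply/funext => w; rewrite scaled_norm1.
Qed.

Lemma moment_order_weaken c c' F : (forall i, D i -> c i <= c' i) ->
  moment_order c F -> moment_order c' F.
Proof.
move=> cc' oF; have [mF c0 bF] := oF.
have c'0 i : D i -> 0 < c' i by move=> Di; apply: lt_le_trans (cc' i Di); exact: c0.
apply: (moment_order_le mF c'0 bF) => i Di; apply: aeW => w.
rewrite (scaled_normE w oF Di); apply: ler_wpM2r; last exact: cc'.
exact: bmom_ge0 bF _ _ Di.
Qed.

Lemma moment_orderD c F G : moment_order c F -> moment_order c G ->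
  moment_order c (fun i w => F i w + G i w).
Proof.
move=> oF oG; have [mF c0 bF] := oF; have [mG _ bG] := oG.
apply: (moment_order_le _ c0 (bounded_momentsD bF bG)) => i Di.
  by apply: measurable_addv; [exact: mF|exact: mG].
apply: aeW => w; rewrite mulrDr -(scaled_normE w oF Di) -(scaled_normE w oG Di).
exact: normFD.
Qed.

Lemma moment_orderN c F : moment_order c F -> moment_order c (fun i w => - F i w).
Proof.
move=> oF; have [mF c0 bF] := oF; apply: (moment_order_le _ c0 bF) => i Di.
  rewrite (_ : (fun w => _) = fun w => 0 - F i w); last by apply/funext => w; rewrite sub0r.
  by apply: measurable_subv; [exact: measurable_cst|exact: mF].
by apply: aeW => w; rewrite normFN (scaled_normE w oF Di).
Qed.

Lemma moment_orderB c F G : moment_order c F -> moment_order c G ->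
  moment_order c (fun i w => F i w - G i w).
Proof. by move=> oF oG; apply: moment_orderD => //; exact: moment_orderN. Qed.

Section coefficients.
Variable f : 'rV[R]_m -> 'rV[R]_m.
Hypothesis f_diff : forall x : 'rV[R]_m, differentiable f x.
Hypothesis fc : continuous f.
Hypothesis Jc : continuous (jacobian f).
Variables (A : R) (N : nat).
Hypothesis A0 : 0 <= A.
(** An integer exponent [N] in place of the real [q] keeps this local Lipschitz factor inside the
    polynomial calculus of [bounded_moments]. *)
Definition growth (x y : 'rV[R]_m) : R := A * (1 + normF x ^+ N + normF y ^+ N).
Hypothesis f_lip : forall x y, normF (f x - f y) <= growth x y * normF (x - y).
Hypothesis J_lip : forall x y,
  normF (jacobian f x - jacobian f y) <= growth x y * normF (x - y).

Lemma growth_ge0 x y : 0 <= growth x y.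
Proof. by rewrite /growth mulr_ge0// !addr_ge0// exprn_ge0// normF_ge0. Qed.

Let BMc (c : R) : 0 <= c -> BM (fun _ _ => c).
Proof. by move=> c0; apply: (@bounded_moments_cst _ _ _ _ _ _ (fun=> c) c) => i _; rewrite c0 lexx. Qed.

Lemma growth_bounded F G : moment_order (fun=> 1) F -> moment_order (fun=> 1) G ->
  BM (fun i w => growth (F i w) (G i w)).
Proof.
move=> /moment_order_bounded bF /moment_order_bounded bG.
apply: bounded_momentsM; first exact: BMc.
apply: bounded_momentsD; last exact: bounded_momentsX.
by apply: bounded_momentsD; [exact: BMc|exact: bounded_momentsX].
Qed.

Lemma moment_order_cst (u : 'rV[R]_m) : moment_order (fun=> 1) (fun _ _ => u).
Proof.
apply: (@moment_order_le _ _ (fun _ _ => normF u)) => //.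
- exact/BMc/normF_ge0.
- by move=> i _; apply: aeW => w; rewrite mul1r.
Qed.

Lemma moment_order_compB c F G : moment_order (fun=> 1) F -> moment_order (fun=> 1) G ->
  moment_order c (fun i w => F i w - G i w) ->
  moment_order c (fun i w => f (F i w) - f (G i w)).
Proof.
move=> oF oG oB; have [mF _ _] := oF; have [mG _ _] := oG; have [_ c0 bB] := oB.
apply: (moment_order_le _ c0 (bounded_momentsM (growth_bounded oF oG) bB)) => i Di.
  by apply: measurable_subv; apply: measurable_compv => //; [exact: mF|exact: mG].
by apply: aeW => w; rewrite mulrCA -(scaled_normE w oB Di).
Qed.

Lemma moment_order_comp F : moment_order (fun=> 1) F ->
  moment_order (fun=> 1) (fun i w => f (F i w)).
Proof.
move=> oF; have [mF _ _] := oF.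
have o0 : moment_order (fun=> 1) (fun i w => F i w - 0).
  by apply: moment_orderB => //; exact: moment_order_cst.
have oD := moment_orderD (moment_order_compB oF (moment_order_cst 0) o0) (moment_order_cst (f 0)).
have [mD c0 bD] := oD; split=> // [i Di|].
  by apply: measurable_compv => //; exact: mF.
move: bD; congr (BM _); apply/funext => i; apply/funext => w.
by rewrite /scaled_norm subrK.
Qed.

Lemma moment_order_jacobian c U F : moment_order c U -> moment_order (fun=> 1) F ->
  moment_order c (fun i w => U i w *m jacobian f (F i w)).
Proof.
move=> oU oF; have [mF _ _] := oF; have [mU c0 bU] := oU.
have bF := moment_order_bounded oF.
have bJ : BM (fun i w => normF (jacobian f 0) + growth (F i w) 0 * normF (F i w)).
  apply: bounded_momentsD; first exact/BMc/normF_ge0.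
  by apply: bounded_momentsM => //; apply: growth_bounded => //; exact: moment_order_cst.
apply: (moment_order_le _ c0 (bounded_momentsM bU bJ)) => i Di.
  by apply: measurable_mulmxv => //; [exact: mU|exact: mF].
apply: aeW => w; rewrite mulrA -(scaled_normE w oU Di).
have -> : U i w *m jacobian f (F i w) =
    U i w *m jacobian f 0 + U i w *m (jacobian f (F i w) - jacobian f 0).
  by rewrite -mulmxDr addrC subrK.
apply: le_trans (normFD _ _) _; rewrite mulrDr; apply: lerD; first exact: normF_mulmx.
apply: le_trans (normF_mulmx _ _) _; apply: ler_wpM2l; first exact: normF_ge0.
by have := J_lip (F i w) 0; rewrite subr0.
Qed.

(** [c <= 1] bounds the moments of [G], hence of the growth factor along the whole segment from [F]
    to [G]. The Jacobian varies there by [O(c)], and the Taylor remainder gains a second factor [c]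
    from the length of the segment. *)
Lemma moment_order_taylor c F G : (forall i, D i -> c i <= 1) ->
  moment_order (fun=> 1) F -> moment_order c (fun i w => G i w - F i w) ->
  moment_order (fun i => c i ^+ 2)
    (fun i w => f (G i w) - f (F i w) - (G i w - F i w) *m jacobian f (F i w)).
Proof.
move=> c1 oF oY; have [mF _ _] := oF; have [mY c0 bY] := oY.
have oY1 : moment_order (fun=> 1) (fun i w => G i w - F i w) by exact: moment_order_weaken oY.
have oG : moment_order (fun=> 1) G.
  have [mG _ bG] := moment_orderD oF oY1; split=> // [i Di|].
    have := mG i Di; congr (measurable_fun _ _); apply/funext => w; by rewrite addrC subrK.
  move: bG; congr (BM _); apply/funext => i; apply/funext => w.
  by rewrite /scaled_norm addrC subrK.
have [mG _ _] := oG.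
pose L i w : R := A * (1 + normF (F i w) ^+ N + (normF (F i w) + normF (G i w - F i w)) ^+ N).
have bL : BM L.
  apply: bounded_momentsM; first exact: BMc.
  apply: bounded_momentsD; last first.
    by apply: bounded_momentsX; apply: bounded_momentsD; exact: moment_order_bounded.
  apply: bounded_momentsD; first exact: BMc.
  by apply: bounded_momentsX; exact: moment_order_bounded.
have c20 i : D i -> 0 < c i ^+ 2 by move=> Di; rewrite exprn_gt0// c0.
apply: (moment_order_le _ c20 (bounded_momentsM bL (bounded_momentsX 2 bY))) => i Di.
  apply: measurable_subv; last by apply: measurable_mulmxv => //; [exact: mY|exact: mF].
  by apply: measurable_subv; apply: measurable_compv => //; [exact: mG|exact: mF].
apply: aeW => w; set x := F i w; set y := G i w - F i w.
have -> : G i w = x + y by rewrite addrC subrK.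
have L0 : 0 <= L i w by exact: bmom_ge0 bL _ _ Di.
have HL (s : R) : 0 <= s <= 1 -> normF (jacobian f (x + s *: y) - jacobian f x) <= L i w * normF y.
  move=> /andP[s0 s1].
  have sy : normF (s *: y) <= normF y by rewrite normFZ ger0_norm// ler_piMl// normF_ge0.
  have h := J_lip (x + s *: y) x.
  have E : x + s *: y - x = s *: y by rewrite addrAC subrr add0r.
  rewrite E in h; apply: (le_trans h).
  apply: ler_pM => //; [exact: growth_ge0|exact: normF_ge0|].
  apply: ler_wpM2l => //; rewrite -/x -/y.
  have hN : normF (x + s *: y) ^+ N <= (normF x + normF y) ^+ N.
    apply: lerXn2r; rewrite ?nnegrE ?addr_ge0 ?normF_ge0//.
    by apply: le_trans (normFD _ _) _; rewrite lerD2l.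
  move: hN; move: (_ ^+ N) (_ ^+ N) (_ ^+ N) => a b e h1; lra.
apply: le_trans (taylor1_normF f_diff HL) _.
have yE : normF y = c i * scaled_norm c (fun i w => G i w - F i w) i w := scaled_normE w oY Di.
by rewrite yE; move: (scaled_norm _ _ _ _) (L i w) => a b; rewrite le_eqVlt; apply/orP; left; apply/eqP; ring.
Qed.

End coefficients.
End scaled_norms.

(** * Order of the error *)

Section error_families.
Context {R : realType} d (T : measurableType d) (P : probability T R) {m : nat}.
Local Notation leb := (@lebesgue_measure R).
Variables (Ft : R -> set (set T)) (W : R -> T -> 'rV[R]_m).
Hypothesis bm : extended_brownian P Ft W.
Variables (f : 'rV[R]_m -> 'rV[R]_m) (x0 : 'rV[R]_m).
Hypothesis f_diff : forall x : 'rV[R]_m, differentiable f x.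
Hypothesis fc : continuous f.
Hypothesis Jc : continuous (jacobian f).
Variables (A : R) (N : nat).
Hypothesis A0 : 0 <= A.
Hypothesis f_lip : forall x y, normF (f x - f y) <= growth A N x y * normF (x - y).
Hypothesis J_lip : forall x y,
  normF (jacobian f x - jacobian f y) <= growth A N x y * normF (x - y).
Variable lambda : R.
Hypothesis lambda_gt0 : 0 < lambda.
Hypothesis f_contractive : forall x y : 'rV[R]_m,
  dotv (x - y) (f x - f y) <= - lambda * normF (x - y) ^+ 2.
Variables (alpha beta H : R).
Hypotheses (alpha_gt0 : 0 < alpha) (beta_gt0 : 0 < beta) (H_gt0 : 0 < H).
Variable hd : R -> 'rV[R]_m -> R.
Hypothesis hdP : forall delta : R, 0 < delta <= 1 -> step_function f alpha beta H (hd delta).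
Hypothesis hdH : forall delta : R, 0 < delta <= 1 -> forall x, hd delta x <= delta * H.
Variable X : R -> T -> 'rV[R]_m.
Hypothesis Xa : forall i t, measurable_wrt (Ft t) (fun w => X t w ord0 i).
Hypothesis Xc : forall w, continuous (X ^~ w).
Hypothesis XE : {ae P, forall w, forall t, 0 <= t ->
  X t w = x0 + integralV t (fun s => f (X s w)) + (W t w - W 0 w)}.
Let FtS := eb_sigma bm.
Let Ftle := @eb_nondecreasing _ _ _ _ _ _ _ bm.
Let Xc' i w : continuous (fun t => X t w ord0 i).
Proof. by have /row_continuousP := @Xc w; apply. Qed.
Local Notation mv F := (measurable_fun [set: T] (F : T -> borelV R m)).

(* The index of a family is a pair [(delta, t)]; [tl] is the last grid time
   before [t], [xl] and [el] are the scheme and the error at [tl], and [dW] is the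
   Brownian increment since [tl]. *)
Let D : set (R * R) := [set i | 0 < i.1 <= 1 /\ 0 <= i.2].
Local Notation MO := (moment_order P D).
Let nd (i : R * R) w : nat := em_index f (hd i.1) x0 (W ^~ w) i.2.
Let tl (i : R * R) w : R := em_time f (hd i.1) x0 (W ^~ w) (nd i w).
Let xl (i : R * R) w : 'rV[R]_m := em_value f (hd i.1) x0 (W ^~ w) (nd i w).
Let xh (i : R * R) w : 'rV[R]_m := em_interpolant f (hd i.1) x0 (W ^~ w) i.2.
Let dW (i : R * R) w : 'rV[R]_m := W i.2 w - W (tl i w) w.
Let e (i : R * R) w : 'rV[R]_m := xh i w - X i.2 w.
Let el (i : R * R) w : 'rV[R]_m := xl i w - X (tl i w) w.
Let u (i : R * R) w : 'rV[R]_m := dW i w *m jacobian f (xl i w).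
(** [f xl - f xh = r - u]: in the linear part of Taylor's formula the increment [xh - xl] splits
    into a drift contribution, which is [O(delta)] and goes to [r], and the noise, which gives
    [u]. *)
Let r (i : R * R) w : 'rV[R]_m := - ((f (xh i w) - f (xl i w) - (xh i w - xl i w) *m jacobian f (xl i w)) +
  (i.2 - tl i w) *: (f (xl i w) *m jacobian f (xl i w))).
Let eps (i : R * R) : R := Num.sqrt i.1.

Let eps_gt0 i : D i -> 0 < eps i.
Proof. by move=> [/andP[i0 _] _]; rewrite sqrtr_gt0. Qed.

Let eps_le1 i : D i -> eps i <= 1.
Proof. by move=> [/andP[_ i1] _]; rewrite -sqrtr1 ler_wsqrtr. Qed.

Let eps_sqr i : D i -> eps i ^+ 2 = i.1.
Proof. by move=> [/andP[i0 _] _]; rewrite sqr_sqrtr// ltW. Qed.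

Let eps_ge i : D i -> i.1 <= eps i.
Proof.
by move=> Di; rewrite -(eps_sqr Di) expr2 ler_piMr// ?eps_le1// ltW// eps_gt0.
Qed.

Let m_index i (q : nat -> T -> 'rV[R]_m) : D i -> (forall n, mv (q n)) ->
  mv (fun w => q (nd i w) w).
Proof.
move=> [i1 _] mq.
exact: (measurable_fun_at_index1 bm x0 fc (hdP i1) i.2 (q := fun n w => q n w : borelV R m) mq).
Qed.

Let m_index1 i (q : nat -> T -> R) : D i -> (forall n, measurable_fun setT (q n)) ->
  measurable_fun setT (fun w => q (nd i w) w).
Proof. by move=> [i1 _] mq; exact: (measurable_fun_at_index1 bm x0 fc (hdP i1) i.2 mq). Qed.

Let mxl i : D i -> mv (xl i).
Proof. by move=> Di; apply: (m_index (q := fun n w => em_value f (hd i.1) x0 (W ^~ w) n) Di) => n; exact: (measurable_chain_value bm x0 fc (hdP (proj1 Di))). Qed.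

Let mxh i : D i -> mv (xh i).
Proof.
move=> Di; apply: (m_index (q := fun n w => step_interpolant f (hd i.1) x0 (W ^~ w) n i.2) Di) => n.
exact: (measurable_interpolant bm x0 fc (hdP (proj1 Di))).
Qed.

Let mdW i : D i -> mv (dW i).
Proof.
move=> Di; apply: measurable_subv; first exact: (measurable_noise bm).
apply: (m_index (q := fun n w => W (em_time f (hd i.1) x0 (W ^~ w) n) w) Di) => n.
exact: (measurable_noise_node bm x0 fc (hdP (proj1 Di))).
Qed.

Let mX i : D i -> mv (X i.2).
Proof. by move=> Di; exact: (measurable_solution bm Xa). Qed.

Let mel i : D i -> mv (el i).
Proof.
move=> Di; apply: measurable_subv; first exact: mxl.
apply: (m_index (q := fun n w => X (em_time f (hd i.1) x0 (W ^~ w) n) w) Di) => n.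
exact: (measurable_solution_node bm x0 fc (@Xa) (@Xc) (hdP (proj1 Di))).
Qed.

Let mdt i : D i -> measurable_fun setT (fun w => i.2 - tl i w).
Proof.
move=> Di; apply: (m_index1 (q := fun n w => i.2 - em_time f (hd i.1) x0 (W ^~ w) n) Di) => n.
exact: (measurable_elapsed bm x0 fc (hdP (proj1 Di))).
Qed.

Let ae_dt i : D i -> {ae P, forall w, 0 <= i.2 - tl i w <= i.1 * H}.
Proof.
move=> Di; have [i1 i2] := Di.
have := ae_regular bm fc alpha_gt0 beta_gt0 H_gt0 XE (hdP i1).
apply: filterS => w [ne _]; have /andP[] := em_indexP (step_gt0 (hdP i1)) (ne i.2) i2.
rewrite em_timeS -/(nd i w) -/(tl i w) => h1 h2; rewrite subr_ge0 h1/= lerBlDl.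
by apply: (le_trans (ltW h2)); rewrite lerD2l; exact: hdH.
Qed.

Let oxl : MO (fun=> 1) xl.
Proof.
apply: moment_order_even => // k.
have [C C0 HC] := chain_moment_index bm x0 fc alpha_gt0 beta_gt0 H_gt0 k.
exists C => // i [i1 i2]; rewrite expr1n mulr1; exact: (HC _ (hdP i1) _ i2).
Qed.

Let odW : MO eps dW.
Proof.
apply: moment_order_even => // k.
exists (m%:R ^+ k.+1 * (m%:R * (moment_cst k.+1 * H ^+ k.+1))).
  by rewrite !mulr_ge0 ?exprn_ge0 ?moment_cst_ge0// ltW.
move=> i Di; have [i1 i2] := Di; have mi := mdW Di.
have cM : 0 <= m%:R ^+ k.+1 :> R by rewrite exprn_ge0.
have p0 j w : 0 <= dW i w ord0 j ^+ (2 * k.+1) by rewrite exprM exprn_ge0// sqr_ge0.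
have mp j : measurable_fun setT (fun w => dW i w ord0 j ^+ (2 * k.+1)).
  by apply: measurable_funX; exact: measurable_coord.
apply: (@le_trans _ _ (\int[P]_w (m%:R ^+ k.+1 * \sum_j dW i w ord0 j ^+ (2 * k.+1))%:E)%E).
  apply: le_expectation.
  - by apply: measurable_funX; exact: measurable_normF.
  - by apply: measurable_funM => //; exact: measurable_sum.
  - by move=> w; rewrite exprn_ge0// normF_ge0.
  - move=> w; rewrite exprM normF_sqr.
    have -> : dotv (dW i w) (dW i w) = \sum_j dW i w ord0 j ^+ 2.
      by apply: eq_bigr => j _; rewrite expr2.
    apply: le_trans (sum_pow_le _ (fun j => sqr_ge0 _)) _.
    by under eq_bigr do rewrite -exprM.
rewrite expectationZ//; [|exact: measurable_sum|by move=> w; exact: sumr_ge0].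
rewrite -mulrA EFinM; apply: lee_wpmul2l; first by rewrite lee_fin.
rewrite expectation_sum//.
apply: (@le_trans _ _ (\sum_(j < m) (moment_cst k.+1 * (i.1 * H) ^+ k.+1)%:E)%E).
  apply: lee_sum => j _.
  exact: (index_increment_moment bm x0 fc alpha_gt0 beta_gt0 H_gt0 (hdP i1) (k := k.+1) (Hd := i.1 * H) (s := i.2) j isT i2 (hdH i1)).
rewrite sumEFin lee_fin sumr_const card_ord [eps i ^+ _]exprM (eps_sqr Di) exprMn.
by rewrite -mulr_natl le_eqVlt; apply/orP; left; apply/eqP; ring.
Qed.

Let bmf : bounded_moments P D (fun i w => normF (f (xl i w))).
Proof. by apply: moment_order_bounded; exact: (moment_order_comp fc A0 f_lip). Qed.

Let bmcst (c : R) : 0 <= c -> bounded_moments P D (fun _ _ => c).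
Proof. by move=> c0; apply: (@bounded_moments_cst _ _ _ _ _ _ (fun=> c) c) => i _; rewrite c0 lexx. Qed.

Let oy : MO eps (fun i w => xh i w - xl i w).
Proof.
have [_ _ bdW] := odW.
apply: (moment_order_le _ _ (bounded_momentsD (bounded_momentsM (bmcst (ltW H_gt0)) bmf) bdW)) => //.
  by move=> i Di; apply: measurable_subv; [exact: mxh|exact: mxl].
move=> i Di; apply: filterS (ae_dt Di) => w /andP[h1 h2].
have -> : xh i w - xl i w = (i.2 - tl i w) *: f (xl i w) + dW i w.
  have G (x a b : 'rV[R]_m) : x + a + b - x = a + b by rewrite addrAC [x + a]addrC addrK.
  exact: G.
apply: le_trans (normFD _ _) _; rewrite mulrDr -(scaled_normE w odW Di) lerD2r.
rewrite normFZ ger0_norm// mulrA; apply: ler_wpM2r; first exact: normF_ge0.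
by apply: (le_trans h2); rewrite ler_pM2r//; exact: eps_ge.
Qed.

Let oy1 : MO (fun=> 1) (fun i w => xh i w - xl i w).
Proof. exact: moment_order_weaken eps_le1 oy. Qed.

Let oxh : MO (fun=> 1) xh.
Proof.
by apply: moment_order_eq (moment_orderD oxl oy1) => i w; rewrite addrC subrK.
Qed.

Let ofy : MO eps (fun i w => f (xl i w) - f (xh i w)).
Proof.
apply: (moment_order_compB fc A0 f_lip) => //.
by apply: moment_order_eq (moment_orderN oy) => i w; rewrite opprB.
Qed.

Let me i : D i -> mv (e i).
Proof. by move=> Di; apply: measurable_subv; [exact: mxh|exact: mX]. Qed.

Section fixed_index.
Variable i : R * R.
Hypothesis Di : D i.
Local Notation hi := (hd i.1).
Local Notation tn n w := (em_time f hi x0 (W ^~ w) n).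
Local Notation xn n w := (em_value f hi x0 (W ^~ w) n).
Local Notation xs n s w := (step_interpolant f hi x0 (W ^~ w) n s).
Local Notation es n s w := (step_error f hi x0 (W ^~ w) (X ^~ w) n s).
Let hiP := hdP (proj1 Di).

Let mxn n : mv (fun w => xn n w).
Proof. exact: (measurable_chain_value bm x0 fc hiP). Qed.
Let mxs n s : mv (fun w => xs n s w).
Proof. exact: (measurable_interpolant bm x0 fc hiP). Qed.
Let cxs n w : continuous (fun s => xs n s w).
Proof. exact: (@interpolant_continuous _ _ _ _ _ _ _ bm f x0 hi n w). Qed.
Let cfxs n w : continuous (fun s => f (xs n s w)).
Proof. by move=> s; apply: continuous_comp; [exact: cxs|exact: fc]. Qed.

Let drift n w s : f (xn n w) - f (X s w) =
  (f (xs n s w) - f (X s w)) + (f (xn n w) - f (xs n s w)).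
Proof. by rewrite [RHS]addrC subrKA. Qed.

Let contract n w s :
  dotv (es n s w) (f (xs n s w) - f (X s w)) <= - lambda * normF (es n s w) ^+ 2.
Proof. exact: f_contractive. Qed.

(** [mean_energy_le] at rate [lambda / 2] with [gm = 0]: at this order the whole defect is estimated
    by its norm, and no term without sign is left. *)
Lemma half_order_moment k (C1 K : R) : 0 <= C1 -> 0 <= K ->
  (forall e g r : 'rV[R]_m, dotv e g <= - lambda * normF e ^+ 2 ->
    lambda / 2 * (normF e ^+ 2) ^+ k.+1 +
      2 * k.+1%:R * (normF e ^+ 2) ^+ k * dotv e (g + r) <=
    C1 * normF r ^+ (2 * k.+1)) ->
  (forall s, 0 <= s ->
    (\int[P]_w (normF (f (xl (i.1, s) w) - f (xh (i.1, s) w)) ^+ (2 * k.+1))%:E <= K%:E)%E) ->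
  (\int[P]_w (normF (e i w) ^+ (2 * k.+1))%:E <= (C1 * K / (lambda / 2))%:E)%E.
Proof.
move=> C10 K0 dis HK; have l2 : 0 < lambda / 2 by rewrite divr_gt0.
pose gp n w s := C1 * normF (f (xn n w) - f (xs n s w)) ^+ (2 * k.+1).
have mF n s : measurable_fun setT (fun w => normF (f (xn n w) - f (xs n s w)) ^+ (2 * k.+1)).
  apply: measurable_funX; apply: measurable_normF.
  by apply: measurable_subv; apply: measurable_compv.
have F0 n w s : 0 <= normF (f (xn n w) - f (xs n s w)) ^+ (2 * k.+1).
  by rewrite exprn_ge0// normF_ge0.
apply: (mean_energy_le bm fc alpha_gt0 beta_gt0 H_gt0 (@Xa) (@Xc) XE hiP
  (G := 0) (gp := gp) (gm := fun _ _ _ => 0) l2 (proj2 Di) (mulr_ge0 C10 K0)).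
- by move=> n s; apply: measurable_funM => //; exact: mF.
- by move=> n s; exact: measurable_cst.
- move=> n w s; apply: cvgM; first exact: cvg_cst.
  apply: (@normF_pow_continuous _ _ _ (fun s => f (xn n w) - f (xs n s w))) => {}s.
  by apply: cvgB; [exact: cvg_cst|exact: cfxs].
- by move=> n w s; exact: cvg_cst.
- by move=> n w s; rewrite mulr_ge0.
- by [].
- by move=> n w s _; rewrite drift subr0; apply: dis; exact: contract.
- move=> s s0; rewrite integral0 adde0 expectationZ//.
  + by rewrite EFinM; apply: lee_wpmul2l; [rewrite lee_fin|exact: HK].
  + exact: (m_index1 (i := (i.1, s)) (q := fun n w => normF (f (xn n w) - f (xs n s w)) ^+ (2 * k.+1))
      (conj (proj1 Di) s0) (mF ^~ s)).
- by move=> s s0; rewrite integral0.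
Qed.

(** The window has length at most [delta * H]. Together with [delta^(2k+1)] from the path estimate
    this gives [delta^(2k+2)], a full order beyond that of the drift difference bounded by [K]. *)
Lemma variation_moment k (K : R) : 0 <= K ->
  (forall s, 0 <= s ->
    (\int[P]_w (normF (f (xl (i.1, s) w) - f (X s w)) ^+ (2 * k.+1))%:E <= K%:E)%E) ->
  (\int[P]_w (normF (e i w - el i w) ^+ (2 * k.+1))%:E <=
   (expR H * (2 * k.+1%:R * (2 * k.+1%:R * i.1) ^+ (2 * k).+1) * (K * (i.1 * H)))%:E)%E.
Proof.
move=> K0 HK; have [/andP[i0 i1] i2] := Di.
set B := expR H * _; have B0 : 0 <= B.
  by rewrite /B !mulr_ge0 ?expR_ge0// exprn_ge0// !mulr_ge0// ltW.
pose g n w s := normF (f (xn n w) - f (X s w)) ^+ (2 * k.+1).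
have mg n s : measurable_fun setT (fun w => g n w s).
  apply: measurable_funX; apply: measurable_normF.
  by apply: measurable_subv; apply: measurable_compv => //; exact: (measurable_solution bm Xa).
have cg n w : continuous (g n w).
  apply: (@normF_pow_continuous _ _ _ (fun s => f (xn n w) - f (X s w))) => s.
  apply: cvgB; first exact: cvg_cst.
  by apply: continuous_comp; [exact: Xc|exact: fc].
have mF := index_family_measurable bm x0 fc hiP mg cg.
set F := (F in measurable_fun _ F) in mF.
have F0 z : 0 <= F z by rewrite exprn_ge0// normF_ge0.
pose J : set R := `[(Num.max 0 (i.2 - i.1 * H))%R, i.2]%classic.
have mJ : measurable J by exact: measurable_itv.
have [mI EI] := expectation_interval P mJ mF F0.
have I0 w : (0 <= \int[leb]_(s in J) (F (w, s))%:E)%E.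
  by apply: integral_ge0 => s _; rewrite lee_fin.
apply: (@le_trans _ _ (\int[P]_w (B%:E * \int[leb]_(s in J) (F (w, s))%:E))%E).
  apply: ae_ge0_le_integral => //.
  - by move=> w _; rewrite lee_fin exprn_ge0// normF_ge0.
  - apply: measurable_EFin_comp; apply: measurable_funX; apply: measurable_normF.
    by apply: measurable_subv; [exact: me|exact: mel].
  - by move=> w _; apply: mule_ge0; [rewrite lee_fin|exact: I0].
  - exact: measurable_funeM.
  - have := ae_regular bm fc alpha_gt0 beta_gt0 H_gt0 XE hiP.
    apply: filterS => w [ne XEw] _.
    have := step_error_variation fc (step_gt0 hiP) (@extended_brownian_continuous _ _ _ _ _ _ _ bm w)
      (@Xc w) XEw (delta := i.1) (H := H) k i0 (hdH (proj1 Di)) i2 (ne i.2).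
    by rewrite step_error_node.
rewrite ge0_integralZl// EI [leRHS]EFinM; apply: lee_wpmul2l; first by rewrite lee_fin.
apply: (@le_trans _ _ (\int[leb]_(s in J) K%:E)%E).
  apply: ge0_le_integral => //.
  - by move=> s _; exact: expectation_ge0.
  - apply: measurable_funTS.
    apply: (@measurable_fun_fubini_tonelli_G _ _ T R R P (fun z => (F z)%:E)).
      exact: measurable_EFin_comp.
    by move=> z; rewrite lee_fin.
  - move=> s; rewrite /J/= in_itv/= ge_max => /andP[/andP[s0 _] _]; exact: HK.
rewrite integral_cst// EFinM; apply: lee_wpmul2l; first by rewrite lee_fin.
rewrite [leLHS](_ : _ = leb J)// /J lebesgue_measure_itv/=; case: ifP => _; last by rewrite lee_fin mulr_ge0// ltW.
rewrite -EFinB lee_fin lerBlDr -lerBlDl.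
by rewrite le_max lexx orbT.
Qed.

Let eln n w : 'rV[R]_m := xn n w - X (tn n w) w.
Let un n w s : 'rV[R]_m := (W s w - W (tn n w) w) *m jacobian f (xn n w).
Let rn n w s : 'rV[R]_m := - ((f (xs n s w) - f (xn n w) - (xs n s w - xn n w) *m jacobian f (xn n w)) +
  (s - tn n w) *: (f (xn n w) *m jacobian f (xn n w))).
Let Zn k n w s : R := (normF (eln n w) ^+ 2) ^+ k * dotv (eln n w) (un n w s).

Let drift2 n w s : f (xn n w) - f (X s w) =
  (f (xs n s w) - f (X s w)) + rn n w s - un n w s.
Proof.
have E : (xs n s w - xn n w) *m jacobian f (xn n w) =
    (s - tn n w) *: (f (xn n w) *m jacobian f (xn n w)) + un n w s.
  rewrite /un scalemxAl -mulmxDl; congr (_ *m _).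
  have G (x a b : 'rV[R]_m) : x + a + b - x = a + b by rewrite addrAC [x + a]addrC addrK.
  exact: G.
rewrite /rn E.
move: (f (xs n s w)) (f (X s w)) (f (xn n w)) (_ *: _) (un n w s) => a b c g h.
by apply/rowP => j; rewrite !mxE; ring.
Qed.

Let meln n : mv (eln n).
Proof.
apply: measurable_subv => //.
exact: (measurable_solution_node bm x0 fc (@Xa) (@Xc) hiP).
Qed.

Let mun n s : mv (fun w => un n w s).
Proof.
apply: measurable_mulmxv => //; apply: measurable_subv; first exact: (measurable_noise bm).
exact: (measurable_noise_node bm x0 fc hiP).
Qed.

Let mrn n s : mv (fun w => rn n w s).
Proof.
rewrite /rn (_ : (fun w => _) = fun w => 0 - ((f (xs n s w) - f (xn n w) - (xs n s w - xn n w) *m jacobian f (xn n w)) +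
  (s - tn n w) *: (f (xn n w) *m jacobian f (xn n w)))); last by apply/funext => w; rewrite sub0r.
have mfxn : mv (fun w => f (xn n w)) by exact: measurable_compv.
apply: measurable_subv; first exact: measurable_cst.
apply: measurable_addv.
  apply: measurable_subv; first by apply: measurable_subv => //; exact: measurable_compv.
  by apply: measurable_mulmxv => //; exact: measurable_subv.
apply: measurable_scalev; first exact: (measurable_elapsed bm x0 fc hiP).
exact: measurable_mulmxv.
Qed.

Let mZn k n s : measurable_fun setT (fun w => Zn k n w s).
Proof.
apply: measurable_funM; last exact: measurable_dotv.
by apply: measurable_funX; apply: measurable_funX; exact: measurable_normF.
Qed.

Let cW w : continuous (W ^~ w).
Proof. exact: (@extended_brownian_continuous _ _ _ _ _ _ _ bm w). Qed.

Let cun n w : continuous (un n w).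
Proof.
by apply: mulmx_continuous => s; apply: cvgB; [exact: cW|exact: cvg_cst].
Qed.

Let crn n w : continuous (rn n w).
Proof.
move=> s; apply: cvgN; apply: cvgD.
  apply: cvgB; first by apply: cvgB; [exact: cfxs|exact: cvg_cst].
  by apply: mulmx_continuous => {}s; apply: cvgB; [exact: cxs|exact: cvg_cst].
by apply: cvgZr_tmp; apply: cvgB; [exact: cvg_id|exact: cvg_cst].
Qed.

Let cZn k n w : continuous (Zn k n w).
Proof.
move=> s; apply: cvgM; first exact: cvg_cst.
apply: (@continuous_sum _ _ _ (fun j s => eln n w ord0 j * un n w s ord0 j)) => j {}s.
apply: cvgM; first exact: cvg_cst.
by have /row_continuousP h := @cun n w; exact: h.
Qed.

(** Transposing the Jacobian writes [- Zn] as the scalar product of the noise increment with a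
    vector [B]. That vector is built from the scheme and the error at the grid time, hence known at
    [t_n], and [index_mean0] applies. This is what freezing the error at the grid time achieves. *)
Let Zn_mean k s : 0 <= s ->
  P.-integrable setT (fun w => (Zn k (nd (i.1, s) w) w s)%:E) ->
  (\int[P]_w (Num.max (- Zn k (nd (i.1, s) w) w s) 0)%:E <=
   \int[P]_w (Num.max (Zn k (nd (i.1, s) w) w s) 0)%:E)%E.
Proof.
move=> s0 iZ; pose Z w := Zn k (nd (i.1, s) w) w s.
have mZ : measurable_fun setT Z.
  exact: (m_index1 (i := (i.1, s)) (q := fun n w => Zn k n w s) (conj (proj1 Di) s0) (mZn k ^~ s)).
pose B n w := (- (normF (eln n w) ^+ 2) ^+ k) *: (eln n w *m (jacobian f (xn n w))^T).
have BE n w : dotv (B n w) (W s w - W (tn n w) w) = - Zn k n w s.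
  by rewrite /B dotvZl dotv_mulmx_tr mulNr.
have st n := chain_stopping bm x0 fc (step_gt0 hiP) (step_measurable hiP) n.
have mBn n : measurable_wrt (stopped_sets Ft (fun w => tn n w)) (B n : T -> borelV R m).
  have mx := @chain_value_measurable_wrt _ _ _ _ _ _ _ bm _ _ x0 fc (step_gt0 hiP) (step_measurable hiP) n.
  have mel' : measurable_wrt (stopped_sets Ft (fun w => tn n w)) (eln n : T -> borelV R m).
    apply: measurable_subv => //; apply/measurable_fun_coordP => j.
    exact: (stopped_process_measurable FtS (@Ftle) (@Xa j) (@Xc' j) (st n)).
  apply: measurable_scalev.
    by apply: measurableT_comp => //; do 2 apply: measurable_funX; exact: measurable_normF.
  apply: (@measurable_mulmxv _ _ _ _ (fun x => (jacobian f x)^T)) => //.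
  move=> x; apply: (@continuous_comp _ _ _ (jacobian f) trmx); first exact: Jc.
  exact: trmx_continuous.
have iN : P.-integrable setT (fun w => (- Z w)%:E).
  exact: (integrableN iZ).
have m0 : (\int[P]_w (- Z w)%:E = 0)%E.
  have := index_mean0 bm fc alpha_gt0 beta_gt0 H_gt0 hiP (A := B) s0 mBn.
  by under eq_fun do rewrite BE; apply.
apply: (@integral_le_mean0 _ _ _ _ _ _ (fun w => - Z w)) => //.
- by apply: measurable_maxr => //; exact: measurableT_comp.
- exact: measurable_maxr.
- by move=> w; rewrite le_max lexx orbT.
- by move=> w; rewrite le_max lexx orbT.
- move=> w; rewrite -/(Z w); case: (leP (Z w) 0) => h.
    by rewrite max_l ?oppr_ge0// add0r.
  rewrite max_r; last by rewrite oppr_le0 ltW.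
  by rewrite subrr.
Qed.

Let Z k (j : R * R) w : R := (normF (el j w) ^+ 2) ^+ k * dotv (el j w) (u j w).

(** The parts of [Zn] are distributed so that [gp - gm] is [pos] minus a multiple of [Zn]. By
    [Zn_mean] their contributions compensate in expectation, and only [pos] is charged to [K]. *)
Lemma full_order_moment k (C1 C2 C3 K G : R) : 0 <= C1 -> 0 <= C2 -> 0 <= C3 -> 0 <= K -> 0 <= G ->
  (forall e el g r u : 'rV[R]_m, dotv e g <= - lambda * normF e ^+ 2 ->
    lambda / 2 * (normF e ^+ 2) ^+ k.+1 +
      2 * k.+1%:R * (normF e ^+ 2) ^+ k * dotv e (g + r - u) <=
    C1 * normF r ^+ (2 * k.+1) + C2 * normF (e - el) ^+ (2 * k.+1) +
    C3 * (normF (e - el) * normF u) ^+ k.+1 -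
    2 * k.+1%:R * ((normF el ^+ 2) ^+ k * dotv el u)) ->
  (forall s, 0 <= s ->
    (\int[P]_w (C1 * normF (r (i.1, s) w) ^+ (2 * k.+1) +
      C2 * normF (e (i.1, s) w - el (i.1, s) w) ^+ (2 * k.+1) +
      C3 * (normF (e (i.1, s) w - el (i.1, s) w) * normF (u (i.1, s) w)) ^+ k.+1)%:E <= K%:E)%E) ->
  (forall s, 0 <= s -> P.-integrable setT (fun w => (Z k (i.1, s) w)%:E) /\
    (\int[P]_w (`|Z k (i.1, s) w|)%:E <= G%:E)%E) ->
  (\int[P]_w (normF (e i w) ^+ (2 * k.+1))%:E <= (K / (lambda / 2))%:E)%E.
Proof.
move=> C10 C20 C30 K0 G0 dis HK HZ; have l2 : 0 < lambda / 2 by rewrite divr_gt0.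
set c2k := 2 * k.+1%:R in dis; have c0 : 0 <= c2k by rewrite mulr_ge0.
pose pos n w s := C1 * normF (rn n w s) ^+ (2 * k.+1) +
  C2 * normF (es n s w - eln n w) ^+ (2 * k.+1) +
  C3 * (normF (es n s w - eln n w) * normF (un n w s)) ^+ k.+1.
have pos0 n w s : 0 <= pos n w s.
  by rewrite !addr_ge0// mulr_ge0// exprn_ge0 ?mulr_ge0 ?normF_ge0.
have mes n s : mv (fun w => es n s w).
  by apply: measurable_subv => //; exact: (measurable_solution bm Xa).
have ces n w : continuous (fun s => es n s w).
  by move=> s; apply: cvgB; [exact: cxs|exact: Xc].
have mpos n s : measurable_fun setT (fun w => pos n w s).
  have mD : measurable_fun setT (fun w => normF (es n s w - eln n w)).
    by apply: measurable_normF; exact: measurable_subv.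
  apply: measurable_funD; first apply: measurable_funD.
  - by apply: measurable_funM => //; apply: measurable_funX; exact: measurable_normF.
  - by apply: measurable_funM => //; exact: measurable_funX.
  - apply: measurable_funM => //; apply: measurable_funX; apply: measurable_funM => //.
    exact: measurable_normF.
have cD n w : continuous (fun s => es n s w - eln n w).
  by move=> s; apply: cvgB; [exact: ces|exact: cvg_cst].
have cpos n w : continuous (pos n w).
  have c1 (F : R -> 'rV[R]_m) : continuous F -> continuous (fun s => normF (F s)).
    by move=> cF; exact: (@normF_pow_continuous _ _ 1).
  move=> s; apply: cvgD; first apply: cvgD.
  - by apply: cvgM; [exact: cvg_cst|apply: normF_pow_continuous; exact: crn].
  - by apply: cvgM; [exact: cvg_cst|apply: (@normF_pow_continuous _ _ _ (fun s => es n s w - eln n w))].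
  - apply: cvgM; first exact: cvg_cst.
    apply: (@continuous_comp _ _ _ (fun s => normF (es n s w - eln n w) * normF (un n w s)) (fun x => x ^+ k.+1)).
      by apply: cvgM; apply: c1; [exact: cD|exact: cun].
    exact: exprn_continuous.
have max0 (x : R) : 0 <= Num.max x 0 by rewrite le_max lexx orbT.
have cmax (F : R -> R) : continuous F -> continuous (fun s => Num.max (F s) 0).
  by move=> cF s; apply: continuous_max; [exact: cF|exact: cvg_cst].
have cZp n w : continuous (fun s => Num.max (Zn k n w s) 0) by apply: cmax; exact: cZn.
have cZm n w : continuous (fun s => Num.max (- Zn k n w s) 0).
  by apply: (@cmax (fun s => - Zn k n w s)) => s; apply: cvgN; exact: cZn.
pose gp n w s := pos n w s + c2k * Num.max (- Zn k n w s) 0.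
pose gm n w s := c2k * Num.max (Zn k n w s) 0.
have mZp n s : measurable_fun setT (fun w => Num.max (Zn k n w s) 0) by exact: measurable_maxr.
have mZm n s : measurable_fun setT (fun w => Num.max (- Zn k n w s) 0).
  by apply: measurable_maxr => //; exact: measurableT_comp.
have mI s (q : nat -> T -> R -> R) : 0 <= s -> (forall n s, measurable_fun setT (fun w => q n w s)) ->
    measurable_fun setT (fun w => q (nd (i.1, s) w) w s).
  by move=> s0 mq; exact: (m_index1 (i := (i.1, s)) (q := fun n w => q n w s) (conj (proj1 Di) s0) (mq ^~ s)).
apply: (mean_energy_le bm fc alpha_gt0 beta_gt0 H_gt0 (@Xa) (@Xc) XE hiP
  (G := c2k * G) (gp := gp) (gm := gm) l2 (proj2 Di) K0).
- by move=> n s; apply: measurable_funD => //; exact: measurable_funM.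
- by move=> n s; exact: measurable_funM.
- move=> n w s; apply: cvgD; first exact: cpos.
  by apply: cvgM; [exact: cvg_cst|exact: cZm].
- by move=> n w s; apply: cvgM; [exact: cvg_cst|exact: cZp].
- by move=> n w s; rewrite addr_ge0// mulr_ge0.
- by move=> n w s; rewrite mulr_ge0.
- move=> n w s _; rewrite drift2; apply: le_trans (dis _ (eln n w) _ _ _ (contract n w s)) _.
  have -> : gp n w s - gm n w s = pos n w s - c2k * Zn k n w s.
    have zE : Num.max (- Zn k n w s) 0 - Num.max (Zn k n w s) 0 = - Zn k n w s.
      case: (leP (Zn k n w s) 0) => h; first by rewrite max_l ?oppr_ge0// subr0.
      by rewrite max_r ?sub0r// oppr_le0 ltW.
    have alg (a b z1 z2 : R) : b - z1 = - z2 -> a + c2k * b - c2k * z1 = a - c2k * z2.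
      move=> h; have -> : z2 = z1 - b by lra.
      ring.
    exact: alg.
  exact: lexx.
- move=> s s0; have [iZ _] := HZ s s0.
  have mp := mI s pos s0 mpos; have mzp := mI s (fun n w s => Num.max (Zn k n w s) 0) s0 mZp.
  have mzm := mI s (fun n w s => Num.max (- Zn k n w s) 0) s0 mZm.
  rewrite expectationD//; [|exact: measurable_funM|by move=> w; rewrite mulr_ge0].
  apply: leeD; first exact: (HK s s0).
  rewrite !expectationZ//; apply: lee_wpmul2l; first by rewrite lee_fin.
  exact: (Zn_mean s0 iZ).
- move=> s s0; have [iZ zG] := HZ s s0.
  have mzp := mI s (fun n w s => Num.max (Zn k n w s) 0) s0 mZp.
  rewrite expectationZ// [leRHS]EFinM; apply: lee_wpmul2l; first by rewrite lee_fin.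
  apply: le_trans zG; apply: le_expectation => //.
    by apply: measurableT_comp => //; exact: (mI s (Zn k) s0 (mZn k)).
  by move=> w; rewrite ge_max normr_ge0 ler_norm.
Qed.

End fixed_index.

Let oe : MO eps e.
Proof.
apply: moment_order_even => // k.
have [C1 [C2 [C3 [C10 C20 C30 dis]]]] := dissipation (m := m) k lambda_gt0.
have [K K0 HK] := moment_order_pow (2 * k.+1) ofy.
have l2 : 0 < lambda / 2 by rewrite divr_gt0.
exists (C1 * K / (lambda / 2)) => [|i Di]; first by rewrite divr_ge0 ?mulr_ge0// ltW.
have eK : 0 <= K * eps i ^+ (2 * k.+1) by rewrite mulr_ge0// exprn_ge0// ltW// eps_gt0.
apply: le_trans (half_order_moment Di (k := k) C10 eK _ _) _.
- move=> a g b ag; have := dis a a g b 0 ag.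
  have d0 (v : 'rV[R]_m) : dotv v 0 = 0 by rewrite -(scale0r (0 : 'rV[R]_m)) dotvZr mul0r.
  by rewrite subr0 subrr normF0 mul0r d0 !mulr0 subr0 !expr0n/= !mulr0 !addr0.
- by move=> s s0; exact: (HK (i.1, s) (conj (proj1 Di) s0)).
by rewrite lee_fin le_eqVlt; apply/orP; left; apply/eqP; ring.
Qed.

(** [X = xh - e], and both families have bounded moments at this stage. *)
Let oX : MO (fun=> 1) (fun i w => X i.2 w).
Proof.
have oe1 : MO (fun=> 1) e by exact: moment_order_weaken eps_le1 oe.
by apply: moment_order_eq (moment_orderB oxh oe1) => i w; rewrite /e opprB addrC subrK.
Qed.

Let orho : MO eps (fun i w => f (xl i w) - f (X i.2 w)).
Proof.
apply: (moment_order_compB fc A0 f_lip) => //.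
by apply: moment_order_eq (moment_orderB oe oy) => i w; rewrite /e opprB addrC subrKA.
Qed.

(** In powers of [eps]: [2 (2k + 1)] from the path estimate, [2 (k + 1)] from the drift difference
    and [2] from the length of the window add up to three times [2 (k + 1)]. *)
Let oD : MO (fun i => eps i ^+ 3) (fun i w => e i w - el i w).
Proof.
apply: moment_order_even => [i Di|i Di|k].
- by apply: measurable_subv; [exact: me|exact: mel].
- by rewrite exprn_gt0// eps_gt0.
have [K K0 HK] := moment_order_pow (2 * k.+1) orho.
exists (expR H * (2 * k.+1%:R * (2 * k.+1%:R) ^+ (2 * k).+1) * (K * H)).
  by rewrite !mulr_ge0 ?expR_ge0// ?exprn_ge0 ?mulr_ge0// ltW.
move=> i Di; have e0 := ltW (eps_gt0 Di).
have eK : 0 <= K * eps i ^+ (2 * k.+1) by rewrite mulr_ge0// exprn_ge0.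
apply: le_trans (variation_moment Di (k := k) eK _) _.
  by move=> s s0; exact: (HK (i.1, s) (conj (proj1 Di) s0)).
rewrite lee_fin -(eps_sqr Di) exprMn -!exprM; move: (eps i) => a.
rewrite le_eqVlt; apply/orP; left; apply/eqP.
have -> : (3 * (2 * k.+1) = 2 * (2 * k).+1 + 2 * k.+1 + 2)%N by ring.
by rewrite !exprD; ring.
Qed.

Let oD1 : MO (fun i => i.1) (fun i w => e i w - el i w).
Proof.
apply: moment_order_weaken oD => i Di; rewrite -(eps_sqr Di).
by apply: ler_wiXn2l => //; [exact/ltW/eps_gt0|exact: eps_le1].
Qed.

Let oel : MO (fun=> 1) el.
Proof.
have oe1 : MO (fun=> 1) e by exact: moment_order_weaken eps_le1 oe.
have i1 i : D i -> i.1 <= 1 by move=> [/andP[]].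
have oD' : MO (fun=> 1) (fun i w => e i w - el i w) by exact: moment_order_weaken i1 oD1.
by apply: moment_order_eq (moment_orderB oe1 oD') => i w; rewrite opprB addrC subrK.
Qed.

Let ou : MO eps u.
Proof. exact: (moment_order_jacobian Jc A0 J_lip odW oxl). Qed.

Let or : MO (fun i => i.1) r.
Proof.
have i0 i : D i -> 0 < i.1 by move=> [/andP[]].
apply: moment_orderN; apply: moment_orderD.
  have := moment_order_taylor f_diff fc Jc A0 J_lip eps_le1 oxl oy.
  by apply: moment_order_weaken => i Di; rewrite (eps_sqr Di).
have oJ : MO (fun=> 1) (fun i w => f (xl i w) *m jacobian f (xl i w)).
  by apply: (moment_order_jacobian Jc A0 J_lip) => //; exact: (moment_order_comp fc A0 f_lip).
have [mJ _ _] := oJ; have bJ := moment_order_bounded oJ.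
apply: (moment_order_le _ i0 (bounded_momentsM (bmcst (ltW H_gt0)) bJ)) => i Di.
  by apply: measurable_scalev; [exact: mdt|exact: mJ].
apply: filterS (ae_dt Di) => w /andP[h1 h2].
by rewrite normFZ ger0_norm// mulrA; apply: ler_wpM2r => //; exact: normF_ge0.
Qed.
Lemma error_order : MO (fun i => i.1) e.
Proof.
have i0 i : D i -> 0 < i.1 by move=> [/andP[]].
apply: moment_order_even => // k.
have [C1 [C2 [C3 [C10 C20 C30 dis]]]] := dissipation (m := m) k lambda_gt0.
have l2 : 0 < lambda / 2 by rewrite divr_gt0.
have [_ _ br] := or; have [_ _ bD1] := oD1; have [_ _ bD] := oD; have [_ _ bu] := ou.
have bel := moment_order_bounded oel.
have ou1 := moment_order_bounded (moment_order_weaken eps_le1 ou).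
have bpos := bounded_momentsD (bounded_momentsD
  (bounded_momentsM (bmcst C10) (bounded_momentsX (2 * k.+1) br))
  (bounded_momentsM (bmcst C20) (bounded_momentsX (2 * k.+1) bD1)))
  (bounded_momentsM (bmcst C30) (bounded_momentsX k.+1 (bounded_momentsM bD bu))).
have [K K0 HK] := bmom_bound bpos 1.
have bZ := bounded_momentsM (bounded_momentsX k (bounded_momentsX 2 bel)) (bounded_momentsM bel ou1).
(* No power of [delta] is extracted from the mean-zero term: [G] only certifies that its integral is
   finite. *)
have [G G0 HG] := bmom_bound bZ 1.
exists (K / (lambda / 2)) => [|i Di]; first by rewrite divr_ge0// ltW.
have iK : 0 <= i.1 ^+ (2 * k.+1) by rewrite exprn_ge0// ltW// i0.
apply: le_trans (full_order_moment Di C10 C20 C30 (mulr_ge0 K0 iK) G0 dis _ _) _.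
- move=> s s0; set j := (i.1, s); have Dj : D j by exact: (conj (proj1 Di) s0).
  rewrite mulrC EFinM.
  apply: le_trans (lee_wpmul2l _ (HK j Dj)); last by rewrite lee_fin.
  rewrite -expectationZ//.
  + rewrite le_eqVlt; apply/orP; left; apply/eqP; apply: eq_integral => w _; congr EFin.
    (* The product of variation and noise, raised to the power [k + 1], carries the same factor
       [delta^(2k+2)] as the other two terms, so that it can be taken out of the whole
       expression. *)
    have E : eps j ^+ 3 * eps j = j.1 ^+ 2 by rewrite -(eps_sqr Dj); ring.
    have alg (a b c g : R) : C1 * (j.1 * a) ^+ (2 * k.+1) + C2 * (j.1 * b) ^+ (2 * k.+1) +
        C3 * (eps j ^+ 3 * c * (eps j * g)) ^+ k.+1 =
        j.1 ^+ (2 * k.+1) * (C1 * a ^+ (2 * k.+1) + C2 * b ^+ (2 * k.+1) + C3 * (c * g) ^+ k.+1).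
      have -> : eps j ^+ 3 * c * (eps j * g) = j.1 ^+ 2 * (c * g) by rewrite -E; ring.
      rewrite [(j.1 * a) ^+ _]exprMn [(j.1 * b) ^+ _]exprMn [(j.1 ^+ 2 * (c * g)) ^+ _]exprMn.
      by rewrite -[(j.1 ^+ 2) ^+ _]exprM; ring.
    rewrite expr1 {1}(scaled_normE w or Dj) {1}(scaled_normE w oD1 Dj).
    rewrite (scaled_normE w oD Dj) (scaled_normE w ou Dj).
    exact: alg.
  + by apply: measurable_funX; exact: (bmom_measurable bpos).
  + by move=> w; rewrite exprn_ge0// (bmom_ge0 bpos).
- move=> s s0; have Dj : D (i.1, s) by exact: (conj (proj1 Di) s0).
  have mZ : measurable_fun setT (fun w => (normF (el (i.1, s) w) ^+ 2) ^+ k * dotv (el (i.1, s) w) (u (i.1, s) w)).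
    apply: measurable_funM; last by apply: measurable_dotv; [exact: mel|exact: (order_measurable ou)].
    by do 2 apply: measurable_funX; apply: measurable_normF; exact: mel.
  have Zle w : `|(normF (el (i.1, s) w) ^+ 2) ^+ k * dotv (el (i.1, s) w) (u (i.1, s) w)| <=
    (normF (el (i.1, s) w) ^+ 2) ^+ k * (normF (el (i.1, s) w) * normF (u (i.1, s) w)).
    rewrite normrM ger0_norm; last by rewrite !exprn_ge0// normF_ge0.
    by apply: ler_wpM2l; [rewrite !exprn_ge0// normF_ge0|exact: normr_dotv_le].
  split.
    apply: le_integrable (bounded_moments_integrable bZ Dj) => //; first exact: measurable_EFin_comp.
    by move=> w _; rewrite /= lee_fin; apply: le_trans (Zle w) _; exact: ler_norm.
  apply: le_trans (HG _ Dj); apply: le_expectation => //.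
  - exact: measurableT_comp.
  - by apply: measurable_funX; exact: (bmom_measurable bZ).
rewrite lee_fin le_eqVlt; apply/orP; left; apply/eqP; ring.
Qed.

End error_families.

(** * Coefficients of the equation and extension to negative times *)

Section powers_of_error.
Context {R : realType} d (T : measurableType d) (P : probability T R) {m : nat}.

Lemma powR_le1D (p x : R) (n : nat) : 0 < p -> p <= n%:R -> 0 <= x -> x `^ p <= 1 + x ^+ n.
Proof.
move=> p0 pn x0; have [x1|/ltW x1] := leP x 1.
  apply: (@le_trans _ _ 1); last by rewrite lerDl exprn_ge0.
  have := ge0_ler_powR (ltW p0) (x := x) (y := 1) x0 ler01 x1.
  by rewrite powR1.
apply: (@le_trans _ _ (x ^+ n)); last by rewrite lerDr.
by rewrite -powR_mulrn//; exact: ler_powR.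
Qed.

(** The error is divided by [delta] before its real power is compared with an integer one; comparing
    [|e|^p] itself with [1 + |e|^n] would lose the rate. *)
Lemma moment_order_powR (D : set (R * R)) (F : R * R -> T -> 'rV[R]_m) (p : R) :
  moment_order P D fst F -> 0 < p -> exists C : R, forall i, D i ->
  (\int[P]_w (normF (F i w) `^ p)%:E <= (C * i.1 `^ p)%:E)%E.
Proof.
move=> oF p0; have [mF c0 bF] := oF; pose n := (Num.truncn p).+1.
have pn : p <= n%:R by exact/ltW/truncnS_gt.
have [K K0 HK] := bmom_bound bF n; exists (1 + K) => i Di.
have mn := bmom_measurable bF Di.
have s0 w : 0 <= scaled_norm fst F i w ^+ n by rewrite exprn_ge0// (bmom_ge0 bF).
have msn : measurable_fun setT (fun w => scaled_norm fst F i w ^+ n) by exact: measurable_funX.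
apply: (@le_trans _ _ (\int[P]_w (i.1 `^ p * (1 + scaled_norm fst F i w ^+ n))%:E)%E).
  apply: le_expectation.
  - apply: (measurableT_comp (measurable_powR p)); apply: measurable_normF; exact: mF.
  - by apply: measurable_funM => //; exact: measurable_funD.
  - by move=> w; exact: powR_ge0.
  - move=> w; rewrite (scaled_normE w oF Di) powRM; [|exact/ltW/c0|exact: (bmom_ge0 bF)].
    by apply: ler_wpM2l; [exact: powR_ge0|apply: powR_le1D => //; exact: (bmom_ge0 bF)].
rewrite expectationZ ?powR_ge0//; [|exact: measurable_funD|by move=> w; rewrite addr_ge0].
rewrite mulrC EFinM; apply: lee_wpmul2l; first by rewrite lee_fin powR_ge0.
rewrite expectationD// expectation_cst EFinD; apply: leeD => //; exact: HK.
Qed.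

End powers_of_error.

Section coefficient_regularity.
Context {R : realType} {m : nat}.

Lemma entry_le_normF p n (A : 'M[R]_(p, n)) i j : `|A i j| <= normF A.
Proof.
rewrite -(@ler_pXn2r _ 2) ?nnegrE ?normF_ge0// real_normK ?num_real// normF_sqrM.
rewrite (bigD1 i)//= (bigD1 j)//= -addrA lerDl addr_ge0//; apply: sumr_ge0 => k _; first exact: sqr_ge0.
by apply: sumr_ge0 => l _; exact: sqr_ge0.
Qed.

Variable f : 'rV[R]_m -> 'rV[R]_m.

(** Each real power is at most one plus an integer power; the two ones turn [gamma] into the
    [2 * gamma] of the constant. *)
Lemma powR_growth_le (gamma mu q : R) (x y : 'rV[R]_m) : 0 < gamma -> 0 < mu -> 0 < q ->
  gamma * (normF x `^ q + normF y `^ q) + mu <=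
  growth (2 * gamma + mu) (Num.truncn q).+1 x y.
Proof.
move=> g0 m0 q0; rewrite /growth; set n := (Num.truncn q).+1.
have qn : q <= n%:R by exact/ltW/truncnS_gt.
have hx := powR_le1D q0 qn (normF_ge0 x); have hy := powR_le1D q0 qn (normF_ge0 y).
have x0 : 0 <= normF x ^+ n by rewrite exprn_ge0// normF_ge0.
have y0 : 0 <= normF y ^+ n by rewrite exprn_ge0// normF_ge0.
move: (normF x `^ q) (normF y `^ q) (normF x ^+ n) (normF y ^+ n) hx hy x0 y0 => a b u v hx hy u0 v0.
have gu : 0 <= gamma * u by rewrite mulr_ge0// ltW.
have gv : 0 <= gamma * v by rewrite mulr_ge0// ltW.
have mu' : 0 <= mu * u by rewrite mulr_ge0// ltW.
have mv' : 0 <= mu * v by rewrite mulr_ge0// ltW.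
have h := ler_wpM2l (ltW g0) (lerD hx hy); lra.
Qed.

(** The right-hand side is continuous in [y] and vanishes at [y = x], and the Frobenius norm
    dominates every entry. *)
Lemma jacobian_continuous (A : R) (N : nat) :
  (forall x y : 'rV[R]_m, normF (jacobian f x - jacobian f y) <= growth A N x y * normF (x - y)) ->
  continuous (jacobian f).
Proof.
move=> HJ; rewrite -[continuous _]/(forall x : 'rV[R]_m, {for x, continuous (jacobian f)}) => x B [Q Qx QB].
have cg : continuous (fun y => growth A N x y * normF (x - y)).
  have cN : continuous (fun y : 'rV[R]_m => normF y ^+ N).
    move=> y; apply: (@continuous_comp _ _ _ (@normF R 1 m) (fun z => z ^+ N)); first exact: normF_continuous.
    exact: exprn_continuous.
  have cB : continuous (fun y : 'rV[R]_m => normF (x - y)).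
    move=> y; apply: (@continuous_comp _ _ _ (fun y : 'rV[R]_m => x - y) (@normF R 1 m)); last exact: normF_continuous.
    have hid : {for y, continuous (fun z : 'rV[R]_m => z)} by exact: cvg_id.
    exact: (continuousB (@cst_continuous _ _ x y) hid).
  move=> y; have cG : {for y, continuous (fun y => growth A N x y)}.
    apply: (@continuousM _ _ (cst A) (fun y : 'rV[R]_m => 1 + normF x ^+ N + normF y ^+ N)); first exact: cst_continuous.
    by apply: (@continuousD _ _ _ (cst (1 + normF x ^+ N))); [exact: cst_continuous|exact: cN].
  exact: (continuousM cG (cB y)).
have cJ i j : {for x, continuous (fun y => jacobian f y i j)}.
  apply/(@cvgrPdist_lt _ _ _ (nbhs x) (nbhs_filter x)) => e e0.
  have := cg x; rewrite /continuous_at subrr normF0 mulr0 => /(@cvgrPdist_lt _ _ _ (nbhs x) (nbhs_filter x))/(_ e e0).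
  apply: filterS => y; rewrite sub0r normrN; apply: le_lt_trans.
  apply: le_trans (ler_norm _); apply: le_trans (HJ x y).
  have E (M1 M2 : 'M[R]_m) : M1 i j - M2 i j = (M1 - M2) i j by rewrite !mxE.
  rewrite E; exact: entry_le_normF.
rewrite /nbhs/=; suff : \forall y \near x, forall i j, Q i j (jacobian f y i j).
  by apply: filterS => y Qy; exact: QB.
apply: (@filter_forall _ _ _ (nbhs x) (nbhs_filter x)) => i.
apply: (@filter_forall _ _ _ (nbhs x) (nbhs_filter x)) => j.
exact: (cJ i j _ (Qx i j)).
Qed.

(** The lower bound on bounded sets comes from the minimum of the continuous [h] over a closed cube.
    For dissipativity the hypothesis on [h] is passed to [hd <= h] and then multiplied by
    [2 * hd x]. *)
Lemma dissipative_step_function (alpha beta hmax delta : R) (h hd : 'rV[R]_m -> R) :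
  0 < delta <= 1 -> 0 < hmax ->
  (forall x, 0 < h x <= hmax) -> continuous h ->
  (forall x, dotv x (f x) + 2^-1 * h x * normF (f x) ^+ 2 <= - alpha * normF x ^+ 2 + beta) ->
  (forall x, 0 < hd x) ->
  measurable_fun [set: borelV R m] (hd : borelV R m -> R) ->
  (forall x, delta * Num.min hmax (h x) <= hd x <= Num.min (delta * hmax) (h x)) ->
  step_function f alpha beta hmax hd.
Proof.
move=> /andP[d0 d1] hm0 hb hc hdis hd0 mhd hdb; split=> //.
- move=> x; have /andP[_] := hdb x; rewrite le_min => /andP[h1 _].
  by apply: (le_trans h1); rewrite ler_piMl// ltW.
- move=> M; pose B := [set v : 'rV[R]_m | forall i, `[- `|M|, `|M|]%classic (v ord0 i)].
  have cB : compact B by apply: (@rV_compact _ _ (fun=> `[- `|M|, `|M|]%classic)) => i; exact: segment_compact.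
  have B0 : B !=set0.
    by exists 0 => i; rewrite /= in_itv/= mxE oppr_le0 normr_ge0.
  have [c _ hcmin] := EVT_min_rV B0 cB (continuous_subspaceT hc).
  have /andP[hc0 _] := hb c.
  exists (delta * Num.min hmax (h c)); first by rewrite mulr_gt0// lt_min hm0.
  move=> x xM; have /andP[hx _] := hdb x; apply: le_trans hx.
  rewrite ler_pM2l// le_min !ge_min lexx/= hcmin ?orbT//.
  rewrite inE => i; rewrite /= in_itv/= -ler_norml.
  by apply: le_trans (coord_le_normF _ _) _; apply: le_trans xM (ler_norm _).
- move=> x; have /andP[_] := hdb x; rewrite le_min => /andP[_ hdh].
  rewrite normF_sqr dotvDl !dotvDr !dotvZl !dotvZr -!normF_sqr (dotvC (f x) x).
  have := hdis x; have f2 : 0 <= normF (f x) ^+ 2 by exact: sqr_ge0.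
  move: (normF (f x) ^+ 2) (normF x ^+ 2) (dotv x (f x)) f2 => F2 X2 xf f2 hx.
  have hx0 := hd0 x.
  have h1 : hd x * F2 <= h x * F2 by exact: ler_wpM2r.
  have h2 : xf + 2^-1 * (hd x * F2) <= - alpha * X2 + beta.
    by apply: le_trans hx; rewrite lerD2l -mulrA ler_wpM2l.
  have h3 := ler_wpM2l (ltW hx0) h2.
  move: h3; rewrite !mulrDr; lra.
Qed.

End coefficient_regularity.

Section time_extension.
Context {R : realType} d (T : measurableType d) (P : probability T R) {m : nat}.
Variables (Ft : R -> set (set T)).
Hypothesis filtered : is_filtration Ft.

Let pos0 (t : R) : 0 <= Num.max 0 t. Proof. by rewrite le_max lexx. Qed.

Definition extend_time {A : Type} (Y : R -> A) : R -> A := fun t => Y (Num.max 0 t).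

Lemma extend_timeE {A : Type} (Y : R -> A) t : 0 <= t -> extend_time Y t = Y t.
Proof. by move=> t0; rewrite /extend_time max_r. Qed.

Lemma extend_time_continuous (Y : R -> T -> 'rV[R]_m) : continuous_paths Y ->
  forall w, continuous (extend_time Y ^~ w).
Proof.
move=> cY w t.
have /subspace_continuousP/(_ (Num.max 0 t)) := cY w.
rewrite /= in_itv/= andbT => /(_ (pos0 t)) h.
have cm : {for t, continuous (fun s : R => Num.max 0 s)}.
  by apply: continuous_max; [exact: cvg_cst|exact: cvg_id].
have h2 : (fun s : R => Num.max 0 s) @ t --> within `[0, +oo[%classic (nbhs (Num.max 0 t)).
  move=> B BP.
  have hB : nbhs t ((fun s : R => Num.max 0 s) @^-1` [set x | `[0, +oo[%classic x -> B x]) := cm _ BP.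
  apply: (@filterS _ (nbhs t) (nbhs_filter t) _ _ _ hB) => s hs; apply: hs.
  by rewrite /= in_itv/= andbT; exact: pos0.
exact: (cvg_comp _ _ h2 h).
Qed.

Lemma extend_time_sigma t : sigma_algebra setT (extend_time Ft t).
Proof. by have := @filtration_sigma _ _ _ _ filtered _ (pos0 t). Qed.

Lemma extend_time_adapted (Y : R -> T -> 'rV[R]_m) : adapted Ft Y ->
  forall i t, measurable_wrt (extend_time Ft t) (fun w => extend_time Y t w ord0 i).
Proof.
move=> aY i t; apply: measurable_coord.
apply/(measurable_wrtP (T' := borelV R m) _ (extend_time_sigma t)) => U mU.
exact: (aY _ (pos0 t)).
Qed.

Lemma extended_brownian_motion (W : R -> T -> 'rV[R]_m) : brownian_motion P Ft W ->
  extended_brownian P (extend_time Ft) (extend_time W).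
Proof.
move=> bW; split.
- exact: extend_time_sigma.
- by move=> t; have := @filtration_measurable _ _ _ _ filtered _ (pos0 t).
- move=> s t st; apply: (filtration_nondecreasing filtered) => //.
  by rewrite ge_max pos0 le_max st orbT.
- exact: extend_time_adapted (brownian_adapted bW).
- move=> i w; have /row_continuousP := extend_time_continuous (brownian_continuous bW) (w := w).
  exact.
- move=> i s t s0 st A V As mV; have t0 := ltW (le_lt_trans s0 st).
  rewrite (extend_timeE W t0) (extend_timeE W s0); rewrite (extend_timeE Ft s0) in As.
  pose B : set (borelV R m) := [set v | V (v ord0 i)].
  have mB : measurable B.
    have := @continuous_borelV_measurable R m (fun v : 'rV[R]_m => v ord0 i) (@coord_continuous _ _ _ ord0 i) measurableT V mV.
    by rewrite setTI.
  have -> : [set w | V (W t w ord0 i - W s w ord0 i)] = (fun w => W t w - W s w) @^-1` B.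
    by apply/seteqP; split => w; rewrite /B /= !mxE.
  rewrite (brownian_independent bW s0 st As mB); congr (_ * _)%E.
  (* Only coordinate [i] is constrained, so the other factors of the product law are one. *)
  pose Bs j : set R := if j == i then V else setT.
  have mBs j : measurable (Bs j) by rewrite /Bs; case: ifP.
  have := brownian_normal bW s0 st mBs.
  rewrite (bigD1 i)//= big1 ?mule1; last first.
    by move=> j /negbTE ji; rewrite /Bs ji; exact: probability_setT.
  rewrite /Bs eqxx => <-; congr (P _); apply/seteqP; split => w.
    by move=> Vw j; case: eqP => // ->.
  by move=> /(_ i); rewrite eqxx.
Qed.

Lemma extend_time_solution (W X : R -> T -> 'rV[R]_m) f x0 : sde_solution P Ft W f x0 X ->
  {ae P, forall w, forall t, 0 <= t ->
    extend_time X t w = x0 + integralV t (fun s => f (extend_time X s w)) +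
      (extend_time W t w - extend_time W 0 w)}.
Proof.
move=> sX; apply: filterS (sde_integral sX) => w XE t t0.
rewrite !extend_timeE// (XE t t0); congr (_ + _ + _).
apply/rowP => i; rewrite !mxE; apply: eq_Rintegral => s; rewrite inE/= in_itv/= => /andP[s0 _].
by rewrite extend_timeE.
Qed.

Lemma em_interpolant_extend f hd x0 (b : R -> 'rV[R]_m) t : (forall x, 0 < hd x) -> 0 <= t ->
  em_interpolant f hd x0 (extend_time b) t = em_interpolant f hd x0 b t.
Proof.
move=> hd0 t0.
have E n : em f hd x0 (extend_time b) n = em f hd x0 b n.
  elim: n => [//|n IH] /=; rewrite IH; case En : (em f hd x0 b n) => [s x].
  have s0 : 0 <= s by have := em_time_ge0 f x0 hd0 b n; rewrite /em_time En.
  by rewrite !extend_timeE// addr_ge0// ltW.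
have Et n : em_time f hd x0 (extend_time b) n = em_time f hd x0 b n by rewrite /em_time E.
have Ex n : em_value f hd x0 (extend_time b) n = em_value f hd x0 b n by rewrite /em_value E.
have Ei : em_index f hd x0 (extend_time b) t = em_index f hd x0 b t.
  rewrite /em_index; congr (xget _ _); apply/seteqP.
  by split=> n [h1 h2]; split => [|k]; move: h1 h2; rewrite ?Et// => h1 h2;
    have := h2 k; rewrite ?Et.
by rewrite /em_interpolant Ei Et Ex !extend_timeE// em_time_ge0.
Qed.

End time_extension.

Unset Implicit Arguments.

Theorem theorem3 (R : realType) (d : measure_display)
  (Omega : measurableType d) (P : probability Omega R)
  (Ft : R -> set (set Omega)) (filtered : is_filtration Ft)
  (m : nat) (m_gt0 : (0 < m)%N)
  (W : R -> Omega -> 'rV[R]_m) (W_brownian : brownian_motion P Ft W)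
  (f : 'rV[R]_m -> 'rV[R]_m) (x0 : 'rV[R]_m)
  (f_differentiable : forall x : 'rV[R]_m, differentiable f x)
  (lambda gamma mu q : R)
  (lambda_gt0 : 0 < lambda) (gamma_gt0 : 0 < gamma)
  (mu_gt0 : 0 < mu) (q_gt0 : 0 < q)
  (f_contractive : forall x y : 'rV[R]_m,
    dotv (x - y) (f x - f y) <= - lambda * normF (x - y) ^+ 2)
  (f_growth : forall x y : 'rV[R]_m,
    normF (f x - f y) + normF (jacobian f x - jacobian f y) <=
    (gamma * (normF x `^ q + normF y `^ q) + mu) * normF (x - y))
  (hmax : R) (hmax_gt0 : 0 < hmax)
  (h : 'rV[R]_m -> R) (h_bounds : forall x, 0 < h x <= hmax)
  (h_continuous : continuous h)
  (alpha beta : R) (alpha_gt0 : 0 < alpha) (beta_gt0 : 0 < beta)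
  (h_dissipative : forall x : 'rV[R]_m,
    dotv x (f x) + 2^-1 * h x * normF (f x) ^+ 2 <=
    - alpha * normF x ^+ 2 + beta)
  (hd : R -> 'rV[R]_m -> R)
  (hd_gt0 : forall delta : R, 0 < delta <= 1 -> forall x, 0 < hd delta x)
  (hd_measurable : forall delta : R, 0 < delta <= 1 ->
    measurable_fun [set: borelV R m] (hd delta : borelV R m -> R))
  (hd_bounds : forall delta : R, 0 < delta <= 1 -> forall x,
    delta * Num.min hmax (h x) <= hd delta x <=
    Num.min (delta * hmax) (h x))
  (X : R -> Omega -> 'rV[R]_m) (X_solution : sde_solution P Ft W f x0 X) :
  forall p : R, 0 < p ->
  exists C : R, forall delta t : R, 0 < delta <= 1 -> 0 <= t ->
    ('E_P[(fun w => normF (em_interpolant f (hd delta) x0 (W ^~ w) t - X t w)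
                    `^ p)%R]
     <= (C * delta `^ p)%:E)%E.
Proof.
move=> p p0.
have fc : continuous f by move=> x; exact: differentiable_continuous (f_differentiable x).
have gr := @powR_growth_le R m gamma mu q _ _ gamma_gt0 mu_gt0 q_gt0.
set A := 2 * gamma + mu in gr; set N := (Num.truncn q).+1 in gr.
have A0 : 0 <= A by rewrite /A addr_ge0 ?mulr_ge0// ltW.
have f_lip (x y : 'rV[R]_m) : normF (f x - f y) <= growth A N x y * normF (x - y).
  apply: le_trans (ler_wpM2r (normF_ge0 _) (gr x y)).
  by apply: le_trans (f_growth x y); rewrite lerDl normF_ge0.
have J_lip (x y : 'rV[R]_m) :
    normF (jacobian f x - jacobian f y) <= growth A N x y * normF (x - y).
  apply: le_trans (ler_wpM2r (normF_ge0 _) (gr x y)).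
  by apply: le_trans (f_growth x y); rewrite lerDr normF_ge0.
have Jc := jacobian_continuous J_lip.
have hdP delta : 0 < delta <= 1 -> step_function f alpha beta hmax (hd delta).
  move=> d1; exact: (dissipative_step_function d1 hmax_gt0 h_bounds h_continuous
    h_dissipative (hd_gt0 delta d1) (hd_measurable delta d1) (hd_bounds delta d1)).
have hdH delta : 0 < delta <= 1 -> forall x, hd delta x <= delta * hmax.
  by move=> d1 x; have /andP[_] := hd_bounds delta d1 x; rewrite le_min => /andP[].
have oe := error_order (extended_brownian_motion filtered W_brownian) f_differentiable fc Jc
  A0 f_lip J_lip lambda_gt0 f_contractive alpha_gt0 beta_gt0 hmax_gt0 hdP hdH
  (extend_time_adapted filtered (sde_adapted X_solution))
  (extend_time_continuous (sde_continuous X_solution)) (extend_time_solution X_solution).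
have [C HC] := moment_order_powR oe p0.
exists C => delta t d1 t0; rewrite unlock.
apply: le_trans (HC (delta, t) (conj d1 t0)).
rewrite le_eqVlt; apply/orP; left; apply/eqP; apply: eq_integral => w _; congr (normF _ `^ _)%:E.
(* At [t >= 0] neither the solution nor the scheme sees negative times, so the extended processes
   give back the original ones. *)
rewrite /= extend_timeE//; congr (_ - _); apply/esym.
exact: (em_interpolant_extend f x0 (W ^~ w) (hd_gt0 delta d1) t0).
Qed.
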